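(* Let $-1\le \tau\le \frac{2}{\pi-2}$. Then the equilibrium measure $\mu_\tau$ is the absolutely continuous measure on $[-1,1]$ given by $$d\mu_\tau(x)=\left(\frac{1+\tau}{\pi\sqrt{1-x^2}}-\frac{\tau}{2}\right)dx ,$$ so that for $z\in\mathbb{C}\setminus[-1,1]$ $$C^{\mu_\tau}(z)=\frac{1+\tau}{(z^2-1)^{1/2}}-\frac{\tau}{2}\log\left(\frac{z+1}{z-1}\right).$$ Furthermore, for $z\in\mathbb{C}\setminus[-1,1]$, $$V^{\mu_\tau}(z)=-(1+\tau)\log\left|\frac{z+(z^2-1)^{1/2}}{2}\right|-\tau-\frac{\tau}{2}\left(\operatorname{Re}(z)\log\left|\frac{z-1}{z+1}\right|+\operatorname{Im}(z)\arg\left(\frac{z+1}{z-1}\right)-\log|z^2-1|\right),$$ and for $x\in[-1,1]$, $$V^{\mu_\tau}(x)=\frac{\tau}{2}\left[(1+x)\log(1+x)+(1-x)\log(1-x)-2\right]+\omega_\tau ,$$ where the equilibrium constant is $$\omega_\tau=(1+\tau)\log(2).$$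
   Context: For a (signed) Borel measure $\sigma$ on $[-1,1]$, its logarithmic potential is $V^\sigma(z)=\int\log\frac{1}{|x-z|}\,d\sigma(x)$, and its Cauchy transform is $C^\sigma(z)=\int\frac{1}{z-x}\,d\sigma(x)$ for $z\in\mathbb{C}\setminus\operatorname{supp}(\sigma)$. Let $\lambda$ be the absolutely continuous probability measure $\frac12 dx$ on $[-1,1]$. For $\tau\in\mathbb{R}$, the equilibrium measure $\mu_\tau$ is the unique probability measure on $[-1,1]$ for which there is a constant $\omega_\tau\in\mathbb{R}$ (the equilibrium constant) such that $$V^{\mu_\tau}(x)+\tau V^\lambda(x)=\omega_\tau \ \text{ for } x\in\operatorname{supp}(\mu_\tau),\qquad V^{\mu_\tau}(x)+\tau V^\lambda(x)\ge\omega_\tau\ \text{ for } x\in[-1,1].$$ Equivalently, $\mu_\tau$ minimizes $\int V^\sigma\,d\sigma+2\tau\int V^\lambda\,d\sigma$ among probability measures $\sigma$ on $[-1,1]$. Conventions: $\sqrt{\cdot}$ is the nonnegative square root of nonnegative reals; $\log$ and $\arg$ are the principal branches in $\mathbb{C}\setminus(-\infty,0]$; $(z^2-1)^{1/2}$ is the branch holomorphic in $\mathbb{C}\setminus[-1,1]$ with $(z^2-1)^{1/2}\sim z$ as $z\to\infty$ (so that $z\mapsto z+(z^2-1)^{1/2}$ maps $\mathbb{C}\setminus[-1,1]$ onto $\{|w|>1\}$); $0\log 0:=0$. *)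

(* Defs.v *)
From HB Require Import structures.
From mathcomp Require Import all_boot all_order all_algebra.
From mathcomp Require Import all_classical all_reals all_analysis.
From mathcomp Require Import complex.
Set Implicit Arguments.
Unset Strict Implicit.
Unset Printing Implicit Defensive.
Import Order.TTheory GRing.Theory Num.Theory.
Import numFieldNormedType.Exports.
Local Open Scope classical_set_scope.
Local Open Scope ring_scope.
Local Open Scope complex_scope.

(* The modulus as an element of R; the ring-scope norm of R[i] lands in R[i]. *)
Notation normc := ComplexField.Normc.normc.

Section LogPotential.
Variable R : realType.
Implicit Types (z : R[i]) (sigma mu : {measure set (measurableTypeR R) -> \bar R}).

Definition segment : set R[i] := [set x%:C | x in `[-1, 1]%classic].

(* Principal argument, with values in ]-pi, pi]; see [argC_def] below. *)
Definition argC z : R :=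
  if 0 <= complex.Im z then acos (complex.Re z / normc z)
  else - acos (complex.Re z / normc z).

Definition logC z : R[i] := ln (normc z) +i* argC z.

Definition is_sqrt_branch (s : R[i] -> R[i]) : Prop :=
  [/\ forall z, ~ segment z -> derivable (s : R[i]^o -> R[i]^o) z 1,
      forall z, ~ segment z -> s z ^+ 2 = z ^+ 2 - 1
    & forall e : R, 0 < e ->
        exists M : R, forall z, M < normc z -> normc (s z / z - 1) < e].

(* In \bar R, 0^-1 = +oo and lne +oo = +oo, so the kernel is +oo at x = z. *)
Definition potential sigma z : \bar R :=
  (\int[sigma]_x lne ((normc (x%:C - z))%:E^-1))%E.

Definition cauchy_transform sigma z : R[i] :=
  (\int[sigma]_x complex.Re (z - x%:C)^-1) +i*
  (\int[sigma]_x complex.Im (z - x%:C)^-1).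

Definition msupport sigma : set R :=
  [set x | forall e : R, 0 < e -> (0 < sigma (ball x e))%E].

Lemma ltN11 : (-1 : R) < 1.
Proof. exact: lt_trans (ltrN10 R) ltr01. Qed.

Definition lambda : probability (measurableTypeR R) R :=
  uniform_prob ltN11.

(* [mu] is a probability measure on [-1,1], viewed as a probability measure on
   R that gives full mass to [-1,1]. *)
Definition is_equilibrium (tau : R) (mu : probability (measurableTypeR R) R)
    (omega : R) : Prop :=
  [/\ mu `[-1, 1]%classic = 1%E,
      forall x : R, msupport mu x ->
        (potential mu x%:C + tau%:E * potential lambda x%:C = omega%:E)%E
    & forall x : R, -1 <= x <= 1 ->
        (omega%:E <= potential mu x%:C + tau%:E * potential lambda x%:C)%E].

Definition equilibrium_density (tau x : R) : R :=
  (1 + tau) / (pi * Num.sqrt (1 - x ^+ 2)) - tau / 2.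

(* The rest shows that [argC] is the principal argument and that the branch
   characterized by [is_sqrt_branch] exists; the witness is built from [sqrtc],
   which is the square root with nonnegative real part. *)

Let arg_aux (a b r : R) : 0 < r -> r ^+ 2 = a ^+ 2 + b ^+ 2 ->
  let t := if 0 <= b then acos (a / r) else - acos (a / r) in
  [/\ -pi < t <= pi, a = r * cos t & b = r * sin t].
Proof.
move=> n0 r2 /=.
have r0 : r != 0 by rewrite gt_eqF.
have c2 : (a / r) ^+ 2 + (b / r) ^+ 2 = 1.
  by rewrite !expr_div_n -mulrDl -r2 divff// sqrf_eq0.
have cB : -1 <= a / r <= 1.
  by rewrite -ler_norml -(expr_le1 (isT : (0<2)%N)) ?normr_ge0 // real_normK ?num_real // -c2 lerDl sqr_ge0.
have a0 := acos_ge0 cB; have api := acos_lepi cB.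
have ca : cos (acos (a / r)) = a / r by rewrite acosK// in_itv.
have sE : sin (acos (a / r)) = `|b / r|.
  by rewrite sin_acos// -c2 addrAC subrr add0r sqrtr_sqr.
have nE : r * (a / r) = a by rewrite mulrC divfK.
have nE' : r * (b / r) = b by rewrite mulrC divfK.
case: ifPn => b0.
- split; first by rewrite api andbT (lt_le_trans _ a0)// oppr_lt0 pi_gt0.
    by rewrite ca nE.
  by rewrite sE ger0_norm ?divr_ge0// ltW.
- rewrite -ltNge in b0.
  have br0 : b / r < 0 by rewrite pmulr_llt0 ?invr_gt0.
  split; last 2 first.
  + by rewrite cosN ca nE.
  + by rewrite sinN sE ltr0_norm// opprK nE'.
  + apply/andP; split.
      rewrite ltrN2 lt_neqAle api andbT; apply/eqP => e.
      by move: sE; rewrite e sinpi => /esym/eqP; rewrite normr_eq0 lt_eqF.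
    by rewrite (le_trans _ (pi_ge0 R))// oppr_le0.
Qed.

Lemma argC_def z : z != 0 ->
  - pi < argC z <= pi /\
  z = normc z * cos (argC z) +i* (normc z * sin (argC z)).
Proof.
case: z => a b z0.
have n0 : 0 < normc (a +i* b).
  rewrite lt_neqAle sqrtr_ge0 andbT eq_sym; apply/eqP => /ComplexField.Normc.eq0_normc h.
  by rewrite h eqxx in z0.
have r2 : normc (a +i* b) ^+ 2 = a ^+ 2 + b ^+ 2.
  by rewrite sqr_sqrtr// addr_ge0// sqr_ge0.
have [h1 h2 h3] := arg_aux n0 r2.
by split; [exact: h1 | congr (_ +i* _)].
Qed.

Lemma Re_sqrtc_ge0 (w : R[i]) : 0 <= complex.Re (sqrtc w).
Proof. by case: w => a b; rewrite /= sqrtr_ge0. Qed.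

Lemma Re_sqrtc_gt0 (w : R[i]) :
  (0 < complex.Re w) || (complex.Im w != 0) -> 0 < complex.Re (sqrtc w).
Proof.
case: w => a b /= h; rewrite sqrtr_gt0 divr_gt0// -ltrBlDr sub0r.
case: (leP a 0) h => a0 /= h; last first.
  by rewrite (lt_le_trans _ (sqrtr_ge0 _))// oppr_lt0.
rewrite -(ger0_norm (_ : 0 <= - a)) ?oppr_ge0// normrN -sqrtr_sqr ltr_sqrt.
  by rewrite ltrDl exprn_even_gt0.
by rewrite ltr_wpDl ?sqr_ge0// exprn_even_gt0.
Qed.

Definition sqrt_branch0 z : R[i] := z * sqrtc (1 - z ^- 2).

Lemma sqrtc_cont (w : R[i]) : (0 < complex.Re w) || (complex.Im w != 0) ->
  {for w, continuous (@sqrtc R : R[i]^o -> R[i]^o)}.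
Proof.
move=> hw; have q0 := Re_sqrtc_gt0 hw; set q := complex.Re _ in q0.
apply/(@cvgrPdist_lt R[i] (R[i]^o) _ (nbhs (w : R[i]^o)) (nbhs_filter _)) => e e0.
have qC : 0 < q%:C by rewrite ltcR.
have bound (v : R[i]) : `|sqrtc w - sqrtc v| <= `|w - v| / q%:C.
  rewrite ler_pdivlMr// -{2}(sqr_sqrtc w) -{2}(sqr_sqrtc v) subr_sqr normrM.
  rewrite ler_wpM2l ?normr_ge0//.
  apply: (le_trans _ (normc_ge_Re _)).
  rewrite lecR raddfD /= (le_trans _ (ler_norm _))// lerDl.
  exact: Re_sqrtc_ge0.
exists (e * q%:C) => [|v hv]; first by rewrite /= mulr_gt0.
by rewrite (le_lt_trans (bound v))// ltr_pdivrMr.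
Qed.

Lemma segment0 : segment (0 : R[i]).
Proof. by exists 0 => //=; rewrite in_itv/= ler01 oppr_le0 ler01. Qed.

Lemma one_subV2_slit z : ~ segment z ->
  (0 < complex.Re (1 - z ^- 2)) || (complex.Im (1 - z ^- 2) != 0).
Proof.
move=> hz; have z0 : z != 0 by apply/eqP => h; apply: hz; rewrite h; exact: segment0.
apply/negPn/negP; rewrite negb_or negbK -leNgt => /andP[hr /eqP hi]; apply: hz.
have [t tE] : exists t, z ^- 2 = t%:C.
  exists (complex.Re (z ^- 2)); apply/eqP; rewrite eq_complex eqxx /=.
  by move: hi; rewrite raddfB /= sub0r => /eqP; rewrite oppr_eq0.
have t1 : 1 <= t by move: hr; rewrite tE /= subr_le0.
have t0 : 0 < t by rewrite (lt_le_trans _ t1).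
pose r := Num.sqrt t^-1.
have r0 : 0 <= r by exact: sqrtr_ge0.
have r1 : r <= 1 by rewrite -sqrtr1 ler_sqrt// invf_le1.
have : z ^+ 2 == r%:C ^+ 2.
  by rewrite -rmorphXn /= sqr_sqrtr ?invr_ge0 ?ltW// -[z ^+ 2]invrK tE fmorphV.
rewrite eqf_sqr => /orP[]/eqP->.
  by exists r => //=; rewrite in_itv/= r1 (le_trans _ r0)// oppr_le0.
by exists (- r); [rewrite /= in_itv/= lerN2 r1 (le_trans _ ler01)// oppr_le0 | rewrite rmorphN].
Qed.

Lemma sqrt_branch0_sqr z : z != 0 -> sqrt_branch0 z ^+ 2 = z ^+ 2 - 1.
Proof.
by move=> z0; rewrite exprMn sqr_sqrtc mulrBr mulr1 divff// sqrf_eq0.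
Qed.

Lemma sqrt_branch0_cont z : ~ segment z -> {for z, continuous (sqrt_branch0 : R[i]^o -> R[i]^o)}.
Proof.
move=> hz; have z0 : z != 0 by apply/eqP => h; apply: hz; rewrite h; exact: segment0.
pose F := nbhs (z : R[i]^o).
have FF : Filter F by exact: nbhs_filter.
have cid : (id : R[i] -> R[i]^o) @ F --> (z : R[i]^o) by exact: cvg_id.
have c2 : (fun y : R[i] => y ^+ 2 : R[i]^o) @ F --> (z ^+ 2 : R[i]^o).
  by rewrite expr2; exact: (@cvgM R[i] _ F FF id id z z cid cid).
have cV : (fun y : R[i] => y ^- 2 : R[i]^o) @ F --> (z ^- 2 : R[i]^o).
  apply: (@cvgV R[i] _ F FF (fun y => y ^+ 2) _ _ c2).
  by rewrite sqrf_eq0.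
have c1 : (fun y : R[i] => 1 - y ^- 2 : R[i]^o) @ F --> (1 - z ^- 2 : R[i]^o).
  apply/(@cvgrPdist_lt R[i] (R[i]^o) _ F FF) => e e0.
  have := (@cvgrPdist_lt R[i] (R[i]^o) _ F FF _ _).1 cV e e0.
  apply: filterS => y; rewrite opprB [1 - _ + _]addrC addrA subrK distrC.
  by [].
have cs : (fun y : R[i] => sqrtc (1 - y ^- 2) : R[i]^o) @ F --> (sqrtc (1 - z ^- 2) : R[i]^o).
  exact: (cvg_comp _ _ c1 (sqrtc_cont (one_subV2_slit hz))).
exact: (@cvgM R[i] _ F FF id (fun y => sqrtc (1 - y ^- 2)) _ _ cid cs).
Qed.

Lemma normcC (u : R[i]) : (normc u)%:C = `|u|.
Proof. by case: u. Qed.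

Lemma sqrt_branch0_asymp (e : R) : 0 < e ->
  exists M : R, forall z, M < normc z -> normc (sqrt_branch0 z / z - 1) < e.
Proof.
move=> e0.
have h1 : (0 < complex.Re (1 : R[i])) || (complex.Im (1 : R[i]) != 0) by rewrite /= ltr01.
have := sqrtc_cont h1.
move/(@cvgrPdist_lt R[i] (R[i]^o) _ (nbhs (1 : R[i]^o)) (nbhs_filter _)).
have eC : 0 < e%:C by rewrite ltcR.
move=> /(_ _ eC) [d /= d0 hd].
have dE : d = (complex.Re d)%:C.
  by case: (d) d0 => x y; rewrite /= ltcE /= => /andP[/eqP -> _].
set r := complex.Re d in dE; have r0 : 0 < r by rewrite -ltcR -dE.
exists (Num.sqrt r^-1 ) => z hM.
have nz : 0 < normc z by rewrite (le_lt_trans _ hM)// sqrtr_ge0.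
have z0 : z != 0 by rewrite -normr_gt0 -normcC ltcR.
rewrite -ltcR normcC /sqrt_branch0 mulrAC divff// mul1r distrC.
have s1 : sqrtc (1 : R[i]) = 1 by rewrite sqrtc_sqrtr ?ler01//= sqrtr1.
rewrite -{1}s1; apply: hd; rewrite /ball_ /= subKr normrV ?unitfE ?expf_neq0// normrX -normcC.
rewrite dE -rmorphXn -fmorphV ltcR -[ltRHS]invrK ltf_pV2 ?posrE ?exprn_gt0 ?invr_gt0//.
by rewrite -[ltLHS]sqr_sqrtr ?invr_ge0 ?ltW// ltr_pXn2r// nnegrE ?sqrtr_ge0// ltW.
Qed.

Lemma cvg_addc (F : set_system R[i]) (FF : Filter F) (f : R[i] -> R[i]) (a c : R[i]) :
  (f : R[i] -> R[i]^o) @ F --> (a : R[i]^o) ->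
  (fun y => f y + c : R[i]^o) @ F --> (a + c : R[i]^o).
Proof.
move=> fa; apply/(@cvgrPdist_lt R[i] (R[i]^o) _ F FF) => e e0.
have := (@cvgrPdist_lt R[i] (R[i]^o) _ F FF _ _).1 fa e e0.
by apply: filterS => y; rewrite opprD addrACA subrr addr0.
Qed.

Lemma cvg_near_neq0 (F : set_system R[i]) (FF : Filter F) (f : R[i] -> R[i]) (a : R[i]) :
  a != 0 -> (f : R[i] -> R[i]^o) @ F --> (a : R[i]^o) -> \forall y \near F, f y != 0.
Proof.
rewrite -normr_gt0 => a0 fa.
have := (@cvgrPdist_lt R[i] (R[i]^o) _ F FF _ _).1 fa _ a0.
by apply: filterS => y; apply: contraTneq => ->; rewrite subr0 ltxx.
Qed.

Lemma sqrt_branch0_der z : ~ segment z -> derivable (sqrt_branch0 : R[i]^o -> R[i]^o) z 1.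
Proof.
move=> hz; have z0 : z != 0 by apply/eqP => h; apply: hz; rewrite h; exact: segment0.
have sz : sqrt_branch0 z != 0.
  rewrite mulf_neq0//; apply/eqP => h; have := Re_sqrtc_gt0 (one_subV2_slit hz).
  by rewrite h ltxx.
pose D := (0 : R[i]^o)^'.
have DF : Filter D by exact: dnbhs_filter.
have sc : (fun h : R[i] => sqrt_branch0 (h + z) : R[i]^o) @ D --> (sqrt_branch0 z : R[i]^o).
  have ch : (fun h : R[i]^o => h + z : R[i]^o) @ D --> (z : R[i]^o).
    apply/(@cvgrPdist_lt R[i] (R[i]^o) _ D _) => e e0.
    exists e => //= y; rewrite /ball_ /= sub0r normrN => ye _.
    by rewrite opprD addrCA subrr addr0 normrN.
  exact: (cvg_comp _ _ ch (sqrt_branch0_cont hz)).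
have cid : (id : R[i] -> R[i]^o) @ D --> (0 : R[i]^o).
  by apply: cvg_within_filter; exact: cvg_id.
have cz := @cvg_addc D DF _ _ z cid; rewrite add0r in cz.
have czz := @cvg_addc D DF _ _ z cz.
have css := @cvg_addc D DF _ _ (sqrt_branch0 z) sc.
have ss0 : sqrt_branch0 z + sqrt_branch0 z != 0 by rewrite -mulr2n mulrn_eq0.
have css' := @cvgV R[i] _ D DF _ _ ss0 css.
have cq := @cvgM R[i] _ D DF _ _ _ _ czz css'.
have n1 := cvg_near_neq0 DF ss0 css.
have n2 := cvg_near_neq0 DF z0 cz.
have n3 : \forall h \near D, h != 0 by exact: nbhs_dnbhs_neq.
rewrite /derivable; apply/cvg_ex; exists ((z + z) / (sqrt_branch0 z + sqrt_branch0 z)).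
apply: cvg_trans cq; apply: near_eq_cvg.
apply: filterS3 n1 n2 n3 => h h1 h2 h3 /=.
rewrite /GRing.scale /= mulr1.
apply: (mulIf h1); rewrite divfK// -mulrA -subr_sqr !sqrt_branch0_sqr//.
rewrite opprB addrA subrK subr_sqr addrK mulrA mulVf// mul1r.
by [].
Qed.

Lemma is_sqrt_branch_exists : exists s : R[i] -> R[i], is_sqrt_branch s.
Proof.
exists sqrt_branch0; split; [exact: sqrt_branch0_der | | exact: sqrt_branch0_asymp].
move=> z hz; apply: sqrt_branch0_sqr; apply/eqP => z0.
by apply: hz; rewrite z0; exact: segment0.
Qed.

End LogPotential.

(* Main.v *)
Require Import Defs.
From HB Require Import structures.
From mathcomp Require Import all_boot all_order all_algebra.
From mathcomp Require Import all_classical all_reals all_analysis.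
From mathcomp Require Import measurable_realfun complex ring lra.
Set Implicit Arguments.
Unset Strict Implicit.
Unset Printing Implicit Defensive.
Import Order.TTheory GRing.Theory Num.Theory.
Import numFieldNormedType.Exports.
Local Open Scope classical_set_scope.
Local Open Scope ring_scope.
Local Open Scope complex_scope.

(** Let [alpha] be the arcsine law and [lambda] the uniform law of [[-1, 1]]. The
    claimed measure is [nu = (1 + tau) alpha - tau lambda]; it is nonnegative
    because of [tau >= -1], which controls the density near the endpoints, and of
    [tau <= 2 / (pi - 2)], which controls it at the origin. All its transforms are
    the same combination of those of [alpha] and [lambda] ([integral_equilibrium]).

    Transforms of [alpha]. Put [w = z + s z] and [v = w^-1]. Off the segment
    [|w| > 1] ([normc_branch_gt1]) and [2 (z - x) = w (1 - 2 x v + v ^+ 2)]. The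
    arcsine law is invariant under [x -> 2 x ^+ 2 - 1] and [x -> - x], and the
    Chebyshev kernel [1 - 2 x v + v ^+ 2] factors along these maps. Hence the mean
    of its logarithm doubles when [v] is squared, and being bounded near [0] it
    vanishes ([integral_ln_cheb_ker]); the mean of the quotient of [1 - v ^+ 2] by
    the kernel does not change when [v] is squared, so it equals its limit [1].
    This gives the potential [ln 2 - ln |w|] and the Cauchy transform [1 / s z].
    The transforms of [lambda] come from elementary antiderivatives
    ([integral_uniform_ln], [integral_uniform_resolvent]), whose inverse tangents
    combine into the principal argument of [(z + 1) / (z - 1)]
    ([argC_segment_ratio]).

    On the segment. When [z] descends vertically to a point of the segment the
    kernel increases, so potentials converge ([cvg_potential_segment]). There
    [|w|] tends to [1], since [|w| + 1 / |w|] is the sum of the distances from [z]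
    to the endpoints, and the potential of [nu] plus [tau] times that of [lambda]
    is the constant [(1 + tau) ln 2]: [nu] is an equilibrium measure.

    Uniqueness. On the segment the kernel [- ln |x - y|] is, up to an additive
    constant, a positive mixture of the lengths of the overlaps of the windows
    [[x, x + a]] and [[y, y + a]] ([mix_ker_windowE]). The energy of a difference of
    two probabilities is thus the squared norm of the difference of their
    profiles. If [mu] is any equilibrium measure, its potential differs from that
    of [nu] by a constant on the support of [mu] and by at least this constant on
    the rest of the segment; integrating against [mu] and [nu] bounds the sum of
    the two energies by twice the mutual energy, so the profiles agree almost
    everywhere ([profile_comparison]). Windows longer than the segment turn
    profiles into distribution functions, so [mu = nu] ([equal_of_comparison]). *)

(** * Integrals and equality of probabilities on the line *)

Section ProbabilityTools.
Context (R : realType).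
Implicit Types (P Q : probability (measurableTypeR R) R).

Lemma integral_full_set P (D : set R) (f : R -> \bar R) : measurable D ->
  P D = 1%E -> measurable_fun setT f ->
  (\int[P]_x f x = \int[P]_(x in D) f x)%E.
Proof.
move=> mD PD mf; rewrite [RHS]integral_mkcond.
have mfD : measurable_fun setT (f \_ D).
  by apply/(measurable_restrictT f mD); exact: measurable_funTS.
apply: ae_eq_integral => //.
exists (~` D); split; first exact: measurableC.
  by apply: etrans (probability_setC P mD) _; rewrite PD subee.
by move=> x /= /not_implyP[_ h] Dx; apply: h; rewrite patchE mem_set.
Qed.

(** An integrand that is bounded below has a finite negative part, so a constant
    can be split off its integral even when that integral is infinite. *)
Lemma integral_add_cst P (D : set R) (f : R -> \bar R) (c : R) : measurable D ->
  P D = 1%E -> measurable_fun D f -> 0 <= c ->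
  (forall x, D x -> ((- c)%:E <= f x)%E) ->
  (\int[P]_(x in D) (f x + c%:E) = \int[P]_(x in D) f x + c%:E)%E.
Proof.
move=> mD PD mf c0 fc.
have fn_c x : D x -> (f^\- x <= c%:E)%E.
  move=> Dx; rewrite funenegE ge_max lee_fin c0 andbT leeNl -EFinN; exact: fc.
have mn : measurable_fun D (f^\-)%E by exact: measurable_funeneg.
have mp : measurable_fun D (f^\+)%E by exact: measurable_funepos.
have mfc : measurable_fun D (fun x => f x + c%:E)%E.
  by apply: emeasurable_funD => //; exact: measurable_cst.
have fc0 x : D x -> (0 <= f x + c%:E)%E.
  by move=> Dx; rewrite -leeBlDr// sub0e -EFinN; exact: fc.
have ic : (\int[P]_(x in D) c%:E = c%:E)%E.
  by rewrite integral_cst// -[RHS]mule1; congr (_ * _)%E; exact: PD.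
have n0 : (0 <= \int[P]_(x in D) f^\- x)%E by exact: integral_ge0.
have nc : (\int[P]_(x in D) f^\- x <= c%:E)%E.
  by rewrite -ic; apply: ge0_le_integral => //.
have nfin : (\int[P]_(x in D) f^\- x)%E \is a fin_num.
  by rewrite ge0_fin_numE// (le_lt_trans nc)// ltry.
have E : (\int[P]_(x in D) (f x + c%:E) + \int[P]_(x in D) f^\- x =
          \int[P]_(x in D) f^\+ x + c%:E)%E.
  rewrite -{2}ic -ge0_integralD// -ge0_integralD//.
  apply: eq_integral => x /set_mem Dx.
  have fE : f x = (f^\+ x - f^\- x)%E by rewrite {1}(funeposneg f).
  have fnfin : (f^\- x)%E \is a fin_num.
    by rewrite ge0_fin_numE// (le_lt_trans (fn_c _ Dx))// ltry.
  by rewrite fE -addeA [(c%:E + _)%E]addeC addeA subeK.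
rewrite [X in (_ = X + _)%E]integralE.
by rewrite addeAC -E addeK.
Qed.

Lemma probability_eq_cdf P (Q : {measure set (measurableTypeR R) -> \bar R}) :
  Q setT = 1%E -> (forall r, P `]-oo, r]%classic = Q `]-oo, r]%classic) ->
  forall A, measurable A -> P A = Q A.
Proof.
move=> Q1 PQ.
pose G := [set A : set R | exists x, A = `]x, +oo[%classic].
have PQr x : P `]x, +oo[%classic = Q `]x, +oo[%classic.
  have Qle : (Q `]-oo, x]%classic < +oo)%E by rewrite -PQ (le_lt_trans (probability_le1 _ _))// ltry.
  rewrite -setCitvl probability_setC// PQ -Q1 -setTD measureD ?setTI//.
  by rewrite [X in (X < _)%E]Q1 ltry.
apply: (@measure_unique _ R (measurableTypeR R) G (fun n => `]-(n%:R), +oo[%classic)).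
- exact: RGenOInfty.measurableE.
- move=> _ _ [x ->] [y ->]; exists (Num.max x y).
  by apply/seteqP; split => z /=; rewrite !in_itv/= !andbT gt_max => /andP.
- by move=> n; exists (- n%:R).
- rewrite -subTset => x _; exists (Num.truncn `|x|).+1 => //=.
  rewrite in_itv/= andbT ltrNl (le_lt_trans (ler_norm _))// normrN.
  by have := real_truncnS_gt (num_real `|x|).
- by move=> _ [x ->]; exact: PQr.
- by move=> n; rewrite (le_lt_trans (probability_le1 _ _))// ltry.
Qed.

End ProbabilityTools.

Section DensityProbability.
Context (R : realType) (h : R -> R).
Hypotheses (mh : measurable_fun setT h) (h0 : forall x, 0 <= h x)
  (h1 : (\int[lebesgue_measure]_x (h x)%:E = 1)%E).

(** The proofs are arguments, so that the probability structure below can be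
    attached to the set function itself. *)
Definition density_prob of measurable_fun setT h & (forall x, 0 <= h x) &
    (\int[lebesgue_measure]_x (h x)%:E = 1)%E : set (measurableTypeR R) -> \bar R :=
  fun A => (\int[lebesgue_measure]_(x in A) (h x)%:E)%E.

Local Notation P := (density_prob mh h0 h1).

Let P0 : P set0 = 0%E. Proof. by rewrite /density_prob integral_set0. Qed.

Let P_ge0 A : (0 <= P A)%E.
Proof. by apply: integral_ge0 => x _; rewrite lee_fin. Qed.

Let P_sigma_additive : semi_sigma_additive P.
Proof.
move=> /= F mF tF mUF; rewrite /density_prob; apply: cvg_toP.
  apply: ereal_nondecreasing_is_cvgn => m n mn.
  apply: lee_sum_nneg_natr => // k _ _.
  by apply: integral_ge0 => x _; rewrite lee_fin.
rewrite ge0_integral_bigcup//=.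
- by apply: measurable_funTS; exact/measurable_EFinP.
- by move=> x _; rewrite lee_fin.
Qed.

HB.instance Definition _ := isMeasure.Build _ _ _ P P0 P_ge0 P_sigma_additive.

Let P_setT : P [set: _] = 1%:E. Proof. exact: h1. Qed.

HB.instance Definition _ := @Measure_isProbability.Build _ _ R P P_setT.

End DensityProbability.

(** * The arcsine law and its invariance under Chebyshev maps *)

Section Arcsine.
Context (R : realType).
Implicit Types x a b : R.

(** Set to zero off the open interval, so that it is a density on the line. *)
Definition arcsine_pdf x : R :=
  if -1 < x < 1 then (pi * Num.sqrt (1 - x ^+ 2))^-1 else 0.

Lemma arcsine_pdf_ge0 x : 0 <= arcsine_pdf x.
Proof.
by rewrite /arcsine_pdf; case: ifP => // _; rewrite invr_ge0 mulr_ge0 ?pi_ge0.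
Qed.

Let sqrt_gt0 x : -1 < x < 1 -> 0 < Num.sqrt (1 - x ^+ 2).
Proof. by move=> h; rewrite sqrtr_gt0; nra. Qed.

Let pdf_cont x : -1 < x < 1 ->
  {for x, continuous (fun y : R => (pi * Num.sqrt (1 - y ^+ 2))^-1)}.
Proof.
move=> h; apply: cvgV; first by rewrite mulf_neq0// gt_eqF ?pi_gt0 ?sqrt_gt0.
apply: cvgM; first exact: cvg_cst.
apply: (@cvg_comp _ _ _ (fun y : R => 1 - y ^+ 2) Num.sqrt); last exact: sqrt_continuous.
by apply: cvgB; [exact: cvg_cst | apply: exprn_continuous].
Qed.

Lemma measurable_arcsine_pdf : measurable_fun setT arcsine_pdf.
Proof.
pose f (x : R) := (pi * Num.sqrt (1 - x ^+ 2))^-1.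
have -> : arcsine_pdf = f \_ `]-1, 1[.
  by apply/funext => x; rewrite patchE mem_setE in_itv.
apply/(measurable_restrictT f _) => //.
apply: open_continuous_measurable_fun; first exact: interval_open.
by move=> x /set_mem/=; rewrite in_itv/= => h; exact: pdf_cont.
Qed.

Lemma integral_arcsine_pdf_itv a b : -1 < a -> a <= b -> b < 1 ->
  (\int[lebesgue_measure]_(x in `[a, b]) (arcsine_pdf x)%:E =
   ((acos a - acos b) / pi)%:E)%E.
Proof.
move=> a1; rewrite le_eqVlt => /predU1P[<-|ab] b1.
  by rewrite set_itv1 integral_set1 subrr mul0r.
have inI x : x \in `[a, b] -> -1 < x < 1.
  by rewrite in_itv/= => /andP[ax xb]; rewrite (lt_le_trans a1)//= (le_lt_trans xb).
pose F : R -> R := (- pi^-1) *: (@acos R).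
have FE x : F x = - (acos x / pi) by rewrite mulrC -mulNr.
have dF x : -1 < x < 1 -> is_derive x 1 F (pi * Num.sqrt (1 - x ^+ 2))^-1.
  move=> h; have := is_derive1_acos h => d.
  apply: is_derive_eq; rewrite /GRing.scale/= mulNr mulrN opprK invfM//.
rewrite (_ : (_ / _)%:E = (F b)%:E - (F a)%:E)%E; last first.
  by rewrite -EFinB !FE opprK mulrBl addrC.
rewrite -(@continuous_FTC2 _ (fun x => (pi * Num.sqrt (1 - x ^+ 2))^-1) F a b)//.
- by apply: eq_integral => x /set_mem/inI h; rewrite /arcsine_pdf h.
- by apply: continuous_in_subspaceT => x /set_mem/inI; exact: pdf_cont.
- split.
  + move=> x /subset_itv_oo_cc /inI h; exact: @ex_derive _ _ _ _ _ _ _ (dF _ h).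
  + apply: cvg_at_right_filter.
    have ha : -1 < a < 1 by apply: inI; rewrite in_itv/= lexx ltW.
    apply: differentiable_continuous; apply/derivable1_diffP.
    exact: @ex_derive _ _ _ _ _ _ _ (dF _ ha).
  + apply: cvg_at_left_filter.
    have hb : -1 < b < 1 by apply: inI; rewrite in_itv/= lexx ltW.
    apply: differentiable_continuous; apply/derivable1_diffP.
    exact: @ex_derive _ _ _ _ _ _ _ (dF _ hb).
- move=> x /subset_itv_oo_cc /inI h.
  by rewrite derive1E; have -> := @derive_val _ _ _ _ _ _ _ (dF _ h).
Qed.

(* The open interval is exhausted by the points [cos (1 / (n + 1))], where [acos]
   is explicit. *)
Let harmonic_pi (n : nat) : 0 < @harmonic R n < pi.
Proof.
rewrite harmonic_gt0/= (le_lt_trans _ (_ : 1 < pi))//.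
  by rewrite /harmonic/= invf_le1// ler1n.
by rewrite (lt_le_trans _ (pi_ge2 R))// ltr1n.
Qed.

Let cos_harmonic_itv (n : nat) : -1 < cos (@harmonic R n) < 1.
Proof.
have /andP[h0 hp] := harmonic_pi n.
have c1 : cos pi < cos (@harmonic R n).
  by rewrite ltr_cos ?in_itv/= ?pi_ge0 ?lexx ?(ltW h0) ?(ltW hp).
have c2 : cos (@harmonic R n) < cos 0.
  by rewrite ltr_cos ?in_itv/= ?pi_ge0 ?lexx ?(ltW h0) ?(ltW hp).
by rewrite cospi in c1; rewrite cos0 in c2; rewrite c1.
Qed.

Let acos_cos_harmonic (n : nat) : acos (cos (@harmonic R n)) = harmonic n.
Proof. by have /andP[h0 hp] := harmonic_pi n; rewrite cosK// in_itv/= !ltW. Qed.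

Let acos_cos_harmonicN (n : nat) : acos (- cos (@harmonic R n)) = pi - harmonic n.
Proof. by rewrite acosN ?acos_cos_harmonic//; have /andP[/ltW-> /ltW->] := cos_harmonic_itv n. Qed.

Let cos_harmonic_mono : {homo (fun n => cos (@harmonic R n)) : m n / (m <= n)%N >-> m <= n}.
Proof.
move=> m n mn; have /andP[h0 hp] := harmonic_pi n; have /andP[h0' hp'] := harmonic_pi m.
rewrite leNgt ltr_cos ?in_itv/= ?ltW// -leNgt.
by rewrite /harmonic/= lef_pV2 ?posrE// ler_nat.
Qed.

Let le_cos_harmonic x : -1 < x < 1 -> exists n, x <= cos (@harmonic R n).
Proof.
move=> /andP[x1 x2]; have xI : -1 <= x <= 1 by rewrite !ltW.
have a0 : 0 < acos x by rewrite acos_gt0// (ltW x1).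
have [n _ hn] := near_infty_natSinv_lt (PosNum a0).
have := hn n (leqnn n) => /= {}hn.
exists n; have /andP[h0 hp] := harmonic_pi n.
rewrite -[leLHS]acosK ?in_itv// leNgt ltr_cos ?in_itv/= ?ltW ?acos_lepi//.
- by rewrite -leNgt ltW.
- by rewrite acos_ltpi// x1 ltW.
Qed.

Let integral_bigcup_pdf (F : nat -> set R) (u : nat -> R) (c : R) :
  {homo F : m n / (m <= n)%N >-> m `<=` n} -> (forall n, measurable (F n)) ->
  (\forall n \near \oo,
    (\int[lebesgue_measure]_(x in F n) (arcsine_pdf x)%:E = (u n)%:E)%E) ->
  u @ \oo --> c ->
  (\int[lebesgue_measure]_(x in \bigcup_n F n) (arcsine_pdf x)%:E = c%:E)%E.
Proof.
move=> ndF mF Fu uc.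
have h1 : (\int[lebesgue_measure]_(x in F n) (arcsine_pdf x)%:E)%E @[n --> \oo] -->
   (\int[lebesgue_measure]_(x in \bigcup_n F n) (arcsine_pdf x)%:E)%E.
  apply: ge0_nondecreasing_set_cvg_integral => //.
  - by move=> m n mn; apply/subsetPset; exact: ndF.
  - move=> i; apply: measurable_funTS; apply/measurable_EFinP.
    exact: measurable_arcsine_pdf.
  - by move=> i y _; rewrite lee_fin arcsine_pdf_ge0.
have h2 : (\int[lebesgue_measure]_(x in F n) (arcsine_pdf x)%:E)%E @[n --> \oo] --> c%:E.
  have : (u n)%:E @[n --> \oo] --> c%:E by apply: cvg_EFin => //; exact: nearW.
  by apply: cvg_trans; apply: near_eq_cvg; apply: filterS Fu => n ->.
exact: cvg_unique h1 h2.
Qed.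

Lemma integral_arcsine_pdf_oc x : -1 < x < 1 ->
  (\int[lebesgue_measure]_(x in `](-1)%R, x]) (arcsine_pdf x)%:E =
   (1 - acos x / pi)%:E)%E.
Proof.
move=> /andP[x1 x2]; pose F n := `[- cos (@harmonic R n), x]%classic.
have FE : \bigcup_n F n = `]-1, x]%classic.
  apply/seteqP; split => [y [n _]|y]; rewrite /F/= !in_itv/=.
    by have /andP[_ h] := cos_harmonic_itv n; move=> /andP[hy ->]; rewrite andbT (lt_le_trans _ hy)// ltrN2.
  move=> /andP[y1 yx]; have [|n hn] := @le_cos_harmonic (- y).
    by rewrite ltrN2 ltrNl y1 andbT (le_lt_trans yx).
  by exists n => //; rewrite /F/= in_itv/= yx andbT lerNl.
rewrite -FE; apply: (integral_bigcup_pdf (u := fun n => (pi - harmonic n - acos x) / pi)).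
- move=> m n mn y; rewrite /F/= !in_itv/= => /andP[h ->].
  by rewrite andbT (le_trans _ h)// lerN2 cos_harmonic_mono.
- by move=> n; rewrite /F.
- have [|N hN] := @le_cos_harmonic (- x); first by rewrite ltrN2 ltrNl x1 x2.
  exists N => // n /= Nn; rewrite integral_arcsine_pdf_itv ?acos_cos_harmonicN//.
  + by rewrite ltrN2; have /andP[] := cos_harmonic_itv n.
  + by rewrite lerNl (le_trans hN)// cos_harmonic_mono.
- rewrite [X in _ --> X](_ : _ = (pi - 0 - acos x) / pi); last first.
    by rewrite subr0 mulrBl divff// gt_eqF// pi_gt0.
  apply: cvgMl; apply: cvgB; last exact: cvg_cst.
  by apply: cvgB; [exact: cvg_cst | exact: cvg_harmonic].
Qed.

Lemma integral_arcsine_pdf : (\int[lebesgue_measure]_x (arcsine_pdf x)%:E = 1)%E.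
Proof.
pose F n := `]-1, cos (@harmonic R n)]%classic.
have FE : \bigcup_n F n = `]-1, 1[%classic.
  apply/seteqP; split => [y [n _]|y]; rewrite /F/= !in_itv/=.
    by have /andP[_ h] := cos_harmonic_itv n; move=> /andP[-> hy]; rewrite (le_lt_trans hy).
  by move=> hy; have [n hn] := le_cos_harmonic hy; exists n => //; rewrite /F/= in_itv/= hn; case/andP: hy => ->.
transitivity (\int[lebesgue_measure]_(x in `](-1)%R, 1%R[) (arcsine_pdf x)%:E)%E.
  rewrite [RHS]integral_mkcond; apply: eq_integral => x _.
  rewrite patchE mem_setE in_itv/=; case: ifPn => // /negbTE h.
  by rewrite /arcsine_pdf h.
rewrite -FE; apply: (integral_bigcup_pdf (u := fun n => 1 - harmonic n / pi)).
- move=> m n mn y; rewrite /F/= !in_itv/= => /andP[-> h].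
  by rewrite (le_trans h)// cos_harmonic_mono.
- by move=> n; rewrite /F.
- by apply: nearW => n; rewrite integral_arcsine_pdf_oc ?cos_harmonic_itv//= -/(harmonic n) acos_cos_harmonic.
- rewrite [X in _ --> X](_ : _ = 1 - 0 / pi); last by rewrite mul0r subr0.
  apply: cvgB; first exact: cvg_cst.
  by apply: cvgMl; exact: cvg_harmonic.
Qed.

Definition arcsine : probability (measurableTypeR R) R :=
  density_prob measurable_arcsine_pdf arcsine_pdf_ge0 integral_arcsine_pdf.

Let arcsine_oo (A : set R) : measurable A ->
  arcsine A = (\int[lebesgue_measure]_(x in A `&` `](-1)%R, 1%R[) (arcsine_pdf x)%:E)%E.
Proof.
move=> mA; rewrite [RHS]integral_mkcondr; apply: eq_integral => x _.
rewrite patchE mem_setE in_itv/=; case: ifPn => // /negbTE h.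
by rewrite /arcsine_pdf h.
Qed.

Lemma arcsine_set1 x : arcsine [set x] = 0%E.
Proof. exact: integral_set1. Qed.

Lemma arcsine_cdf_leN1 x : x <= -1 -> arcsine `]-oo, x]%classic = 0%E.
Proof.
move=> x1; rewrite arcsine_oo// (_ : _ `&` _ = set0) ?integral_set0//.
apply/seteqP; split => y //= []; rewrite !in_itv/= => yx /andP[y1 _].
by move: (lt_le_trans y1 (le_trans yx x1)); rewrite ltxx.
Qed.

Lemma arcsine_cdf x : -1 <= x <= 1 ->
  arcsine `]-oo, x]%classic = (1 - acos x / pi)%:E.
Proof.
move=> /andP[]; rewrite le_eqVlt => /predU1P[<- _|x1].
  by rewrite arcsine_cdf_leN1// acosN1 divff ?subrr// gt_eqF// pi_gt0.
rewrite le_eqVlt => /predU1P[->|x2].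
  rewrite acos1 mul0r subr0 -(probability_setT arcsine) !arcsine_oo//.
  congr (integral _ _ _); apply/seteqP; split => y /=; rewrite !in_itv/=; first by case.
  by move=> [_ /andP[y1 y2]]; rewrite y1 y2 ltW.
rewrite arcsine_oo// -integral_arcsine_pdf_oc ?x1//.
congr (integral _ _ _); apply/seteqP; split => y /=; rewrite !in_itv/=.
  by move=> [-> /andP[-> _]].
by move=> /andP[-> yx]; rewrite yx (le_lt_trans yx).
Qed.

Lemma arcsine_segment : arcsine `[-1, 1]%classic = 1%E.
Proof.
rewrite -(probability_setT arcsine) !arcsine_oo//.
congr (integral _ _ _); apply/seteqP; split => y /=; rewrite !in_itv/=; first by case.
by move=> [_ /andP[y1 y2]]; rewrite y1 y2 !ltW.
Qed.

Lemma arcsine_symmetric_segment x : 0 <= x <= 1 ->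
  arcsine `[-x, x]%classic = (1 - 2 * acos x / pi)%:E.
Proof.
move=> /andP[x0 x1].
have xI : -1 <= x <= 1 by rewrite x1 (le_trans _ x0).
have NxI : -1 <= - x <= 1 by rewrite lerN2 x1 lerNl (le_trans _ x0).
have -> : `[-x, x]%classic = (`]-oo, x] `\` `]-oo, -x]) `|` [set - x].
  apply/seteqP; split => y /=; rewrite !in_itv/=.
    move=> /andP[h ->]; have [->|yx] := eqVneq y (- x); [by right|left].
    by split => //; apply/negP; rewrite -ltNge lt_neqAle eq_sym yx.
  move=> [[-> /negP]|->]; first by rewrite -ltNge => /ltW ->.
  by rewrite lexx/= ge0_cp.
rewrite measureU//; last 2 first.
- exact: measurableD.
- by apply/seteqP; split => y //= [[_ +] yx]; rewrite yx in_itv/= lexx.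
rewrite [X in (_ + X)%E]arcsine_set1 adde0 measureD//; last 1 first.
  by rewrite [ltLHS]arcsine_cdf// ltry.
rewrite setIidr; last first.
  by move=> y /=; rewrite !in_itv/= => h; rewrite (le_trans h)// ge0_cp.
rewrite [X in (X - _)%E]arcsine_cdf// [X in (_ - X)%E]arcsine_cdf//.
rewrite acosN// -EFinB; congr (_%:E).
have := pi_gt0 R; move: (acos x) (pi : R) => a p p0.
by field; rewrite gt_eqF.
Qed.

Lemma arcsine_cdf_ge1 x : 1 <= x -> arcsine `]-oo, x]%classic = 1%E.
Proof.
move=> x1; apply/eqP; rewrite eq_le probability_le1//= -arcsine_segment le_measure//.
- exact: mem_set.
- exact: mem_set.
- by move=> y /=; rewrite !in_itv/= => /andP[_ /le_trans]; exact.
Qed.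

(** The law and its image both live on the segment, so their distribution
    functions can only differ in [[-1, 1[]. *)
Let invariant (phi : R -> R) (mphi : measurable_fun setT phi) :
  (forall x, phi x \in `[-1, 1] = (x \in `[-1, 1])) ->
  (forall r, -1 <= r < 1 ->
    arcsine (phi @^-1` `]-oo, r]%classic) = arcsine `]-oo, r]%classic) ->
  forall A, measurable A -> arcsine (phi @^-1` A) = arcsine A.
Proof.
move=> phiI phir.
have mX (A : set R) : measurable A -> measurable (phi @^-1` A).
  by move=> mA; rewrite -[X in measurable X]setTI; exact: mphi.
have I1 : arcsine (phi @^-1` `[-1, 1]%classic) = 1%E.
  rewrite -arcsine_segment; congr (arcsine _).
  by apply/seteqP; split => x /=; rewrite phiI.
pose Q : set (measurableTypeR R) -> \bar R :=
  @pushforward _ _ (measurableTypeR R) (measurableTypeR R) R arcsine phi.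
suff : forall A, measurable A -> arcsine A = Q A.
  by move=> h A /h.
apply: probability_eq_cdf => [|r].
  by apply: etrans (probability_setT arcsine); congr (arcsine _).
rewrite -[RHS]/(arcsine (phi @^-1` `]-oo, r]%classic)); apply/esym.
have [r1|r1] := leP 1 r.
  rewrite [RHS]arcsine_cdf_ge1//; apply/eqP; rewrite eq_le probability_le1/=; last exact: mX.
  rewrite -I1 le_measure ?inE//; [exact: mX|exact: mX|].
  by move=> x /=; rewrite !in_itv/= => /andP[_ /le_trans]; exact.
have [r2|r2] := leP (-1) r; first by apply: phir; rewrite r2.
rewrite [RHS]arcsine_cdf_leN1 ?ltW//; apply/eqP; rewrite eq_le measure_ge0 andbT.
have I0 : arcsine (~` (phi @^-1` `[-1, 1]%classic)) = 0%E.
  by rewrite probability_setC ?I1 ?subee//; exact: mX.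
rewrite -[leRHS]I0 le_measure ?inE//; [exact: mX|apply: measurableC; exact: mX|].
by move=> x /=; rewrite !in_itv/= => xr /andP[h _]; move: (lt_le_trans r2 (le_trans h xr)); rewrite ltxx.
Qed.

(** In the angle [acos x] the arcsine law is uniform and the map doubles the
    angle, hence the invariance. *)
Lemma arcsine_chebyshev (A : set R) : measurable A ->
  arcsine ((fun x => 2 * x ^+ 2 - 1) @^-1` A) = arcsine A.
Proof.
move: A; apply: invariant => [|x|r /andP[r1 r2]].
- by apply: measurable_funB => //; apply: measurable_funM => //; exact: exprn_measurable.
- by rewrite !in_itv/=; apply/idP/idP => /andP[h1 h2]; apply/andP; split; nra.
have rI : -1 <= r <= 1 by rewrite r1 ltW.
pose c := Num.sqrt ((1 + r) / 2).
have c2 : c ^+ 2 = (1 + r) / 2 by rewrite sqr_sqrtr//; lra.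
have c0 : 0 <= c by exact: sqrtr_ge0.
have c1 : c <= 1 by nra.
rewrite [RHS]arcsine_cdf//.
have -> : (fun x => 2 * x ^+ 2 - 1) @^-1` `]-oo, r]%classic = `[-c, c]%classic :> set R.
  by apply/seteqP; split => x /=; rewrite !in_itv/= => h; nra.
rewrite arcsine_symmetric_segment ?c0//; congr (1 - _ / _)%:E.
have a0 := acos_ge0 rI; have ap := acos_lepi rI.
have yI : 0 <= acos r / 2 <= pi by apply/andP; split; lra.
have -> : c = cos (acos r / 2).
  have cc : 0 <= cos (acos r / 2).
    by apply: cos_ge0_pihalf; apply/andP; split; have := pi_ge0 R; lra.
  apply/eqP; rewrite -(eqrXn2 (n := 2))// c2; apply/eqP.
  have : cos (acos r) = cos (acos r / 2 *+ 2) by rewrite -mulr_natr divfK.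
  rewrite acosK ?in_itv// cos_mulr2n mulr2n; move: (cos _) => t; lra.
by rewrite cosK ?in_itv//; lra.
Qed.

Lemma arcsine_opp (A : set R) : measurable A -> arcsine (-%R @^-1` A) = arcsine A.
Proof.
move: A; apply: invariant => [|x|r /andP[r1 r2]].
- exact: oppr_measurable.
- by rewrite !in_itv/=; apply/idP/idP => /andP[h1 h2]; apply/andP; split; lra.
have rI : -1 <= r <= 1 by rewrite r1 ltW.
have NrI : -1 <= - r <= 1 by lra.
have -> : -%R @^-1` `]-oo, r]%classic = ~` `]-oo, -r]%classic `|` [set - r] :> set R.
  apply/seteqP; split => x /=; rewrite !in_itv/=.
    move=> h; have [->|xr] := eqVneq x (- r); [by right|left].
    by apply/negP; rewrite -ltNge lt_neqAle eq_sym xr lerNl.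
  by move=> [/negP|->]; rewrite ?opprK// -ltNge => h; rewrite lerNl ltW.
rewrite measureU//; last 2 first.
- exact: measurableC.
- by apply/seteqP; split => x //= [+ xr]; rewrite xr in_itv/= lexx.
rewrite [X in (_ + X)%E]arcsine_set1 adde0 [X in X = _]probability_setC//.
rewrite [X in (_ - X)%E]arcsine_cdf// [RHS]arcsine_cdf// acosN// -EFinB; congr (_%:E).
have := pi_gt0 R; move: (acos r) (pi : R) => a p p0.
by field; rewrite gt_eqF.
Qed.

Let integral_invariant (phi : R -> R) (f : R -> R) (M : R) :
  measurable_fun setT phi -> (forall x, phi x \in `[-1, 1] = (x \in `[-1, 1])) ->
  (forall A, measurable A -> arcsine (phi @^-1` A) = arcsine A) ->
  measurable_fun setT f -> (forall x, -1 <= x <= 1 -> `|f x| <= M) ->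
  \int[arcsine]_(x in `[-1, 1]) f (phi x) = \int[arcsine]_(x in `[-1, 1]) f x.
Proof.
move=> mphi phiI phiA mf fM; rewrite /Rintegral; congr fine.
have phiIE : phi @^-1` `[-1, 1]%classic = `[-1, 1]%classic.
  by apply/seteqP; split => x /=; rewrite phiI.
have intf : arcsine.-integrable (phi @^-1` `[-1, 1]%classic) (EFin \o f \o phi).
  rewrite phiIE; apply: measurable_bounded_integrable => //.
  - exact: le_lt_trans (probability_le1 _ _) (ltry _).
  - by apply: measurable_funTS; exact: measurableT_comp.
  - exists M; split; first exact: num_real.
    move=> y My x /= xI; apply: le_trans (ltW My); apply: fM.
    by move: xI; rewrite -phiI in_itv.
rewrite -[in LHS]phiIE.
have mEf : measurable_fun setT (EFin \o f) by exact/measurable_EFinP.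
have := @integral_pushforward _ _ (measurableTypeR R) (measurableTypeR R) R phi mphi arcsine `[-1, 1]%classic (EFin \o f) mEf intf.
move=> /(_ (measurable_itv _)) <-.
apply: eq_measure_integral => A mA _; rewrite /pushforward/=; exact: phiA.
Qed.

Lemma integral_arcsine_chebyshev (f : R -> R) (M : R) :
  measurable_fun setT f -> (forall x, -1 <= x <= 1 -> `|f x| <= M) ->
  \int[arcsine]_(x in `[-1, 1]) f (2 * x ^+ 2 - 1) = \int[arcsine]_(x in `[-1, 1]) f x.
Proof.
apply: integral_invariant => [|x|]; last exact: arcsine_chebyshev.
- by apply: measurable_funB => //; apply: measurable_funM => //; exact: exprn_measurable.
- by rewrite !in_itv/=; apply/idP/idP => /andP[h1 h2]; apply/andP; split; nra.
Qed.

Lemma integral_arcsine_opp (f : R -> R) (M : R) :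
  measurable_fun setT f -> (forall x, -1 <= x <= 1 -> `|f x| <= M) ->
  \int[arcsine]_(x in `[-1, 1]) f (- x) = \int[arcsine]_(x in `[-1, 1]) f x.
Proof.
apply: integral_invariant => [|x|]; last exact: arcsine_opp.
- exact: oppr_measurable.
- by rewrite !in_itv/=; apply/idP/idP => /andP[h1 h2]; apply/andP; split; lra.
Qed.

End Arcsine.

(** * Moduli and real and imaginary parts of affine kernels *)

Section ComplexKernels.
Context (R : realType).
Implicit Types (x : R) (z w : R[i]).

Lemma measurable_invr : measurable_fun setT (@GRing.inv R).
Proof.
pose D : set R := [set x | x != 0].
have oD : open D by exact: open_neq.
have -> : @GRing.inv R = @GRing.inv R \_ D.
  apply/funext => x; rewrite patchE; case: ifPn => //.
  by move/negP; rewrite inE /D/= => /negP; rewrite negbK => /eqP ->; rewrite invr0.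
apply/(measurable_restrictT (@GRing.inv R) (open_measurable oD)).
apply: open_continuous_measurable_fun => // x /set_mem x0.
exact: inv_continuous.
Qed.

Lemma measurable_sqrtr : measurable_fun setT (@Num.sqrt R).
Proof. by apply: continuous_measurable_fun => x; exact: sqrt_continuous. Qed.

Let measurable_affine (a c : R) : measurable_fun setT (fun x : R => a + x * c).
Proof. by apply: measurable_funD => //; exact: measurable_funM. Qed.

Let measurable_sum_sqr (a b c d : R) :
  measurable_fun setT (fun x : R => (a + x * c) ^+ 2 + (b + x * d) ^+ 2).
Proof.
apply: measurable_funD; apply: measurable_funX; exact: measurable_affine.
Qed.

Lemma measurable_normc_affine z w : measurable_fun setT (fun x => normc (z + x%:C * w)).
Proof.
case: z w => [a b] [c d].
apply: (eq_measurable_fun (fun x => Num.sqrt ((a + x * c) ^+ 2 + (b + x * d) ^+ 2))).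
  by move=> x _ /=; rewrite !mul0r subr0 addr0.
exact: measurableT_comp measurable_sqrtr (measurable_sum_sqr _ _ _ _).
Qed.

Lemma Re_mulc z w : complex.Re (z * w) = complex.Re z * complex.Re w - complex.Im z * complex.Im w.
Proof. by case: z w => [? ?] [? ?]. Qed.

Lemma Im_mulc z w : complex.Im (z * w) = complex.Re z * complex.Im w + complex.Im z * complex.Re w.
Proof. by case: z w => [? ?] [? ?]. Qed.

Lemma measurable_Re_inv_affine z w :
  measurable_fun setT (fun x => complex.Re (z + x%:C * w)^-1).
Proof.
case: z w => [a b] [c d].
apply: (eq_measurable_fun (fun x => (a + x * c) / ((a + x * c) ^+ 2 + (b + x * d) ^+ 2))).
  by move=> x _ /=; rewrite !mul0r subr0 addr0.
apply: measurable_funM => //.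
exact: measurableT_comp measurable_invr (measurable_sum_sqr _ _ _ _).
Qed.

Lemma measurable_Im_inv_affine z w :
  measurable_fun setT (fun x => complex.Im (z + x%:C * w)^-1).
Proof.
case: z w => [a b] [c d].
apply: (eq_measurable_fun (fun x => - ((b + x * d) / ((a + x * c) ^+ 2 + (b + x * d) ^+ 2)))).
  by move=> x _ /=; rewrite !mul0r subr0 addr0.
apply: measurableT_comp (@oppr_measurable R setT) _.
apply: measurable_funM => //.
exact: measurableT_comp measurable_invr (measurable_sum_sqr _ _ _ _).
Qed.

Lemma normc_ge0 z : 0 <= normc z.
Proof. by case: z => a b; exact: sqrtr_ge0. Qed.

Lemma normc_eq0 z : (normc z == 0) = (z == 0).
Proof. by apply/eqP/eqP => [/ComplexField.Normc.eq0_normc//|->]; rewrite ComplexField.Normc.normc0. Qed.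

Lemma normc_gt0 z : (0 < normc z) = (z != 0).
Proof. by rewrite lt_neqAle normc_ge0 andbT eq_sym normc_eq0. Qed.

Lemma normcX z n : normc (z ^+ n) = normc z ^+ n.
Proof.
elim: n => [|n ih]; first by rewrite !expr0 ComplexField.Normc.normc1.
by rewrite !exprS ComplexField.Normc.normcM ih.
Qed.

Lemma normcN z : normc (- z) = normc z.
Proof. by case: z => a b /=; rewrite !sqrrN. Qed.

Lemma normcR x : normc (x%:C) = `|x|.
Proof. by rewrite /= expr0n/= addr0 sqrtr_sqr. Qed.

Lemma normc_div z w : normc (z / w) = normc z / normc w.
Proof. by rewrite ComplexField.Normc.normcM ComplexField.Normc.normcV. Qed.

Lemma ler_normcD z w : normc (z + w) <= normc z + normc w.
Proof. exact: le_normcD. Qed.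

Lemma ler_normcB z w : normc z - normc w <= normc (z - w).
Proof. by rewrite lerBlDr -{1}(subrK w z) ler_normcD. Qed.

Lemma Re_le_normc z : `|complex.Re z| <= normc z.
Proof. by case: z => a b /=; rewrite -sqrtr_sqr ler_wsqrtr// lerDl sqr_ge0. Qed.

Lemma Im_le_normc z : `|complex.Im z| <= normc z.
Proof. by case: z => a b /=; rewrite -sqrtr_sqr ler_wsqrtr// lerDr sqr_ge0. Qed.

End ComplexKernels.

(** * Integrals of the Chebyshev kernel against the arcsine law *)

Section ChebyshevKernel.
Context (R : realType).
Implicit Types (x : R) (v : R[i]).

(** Twice the ratio of [z - x] to the exterior Joukowski variable [w = 1 / v]
    of [z]. *)
Definition cheb_ker v x : R[i] := 1 - (2 * x)%:C * v + v ^+ 2.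

Lemma cheb_kerE v x : cheb_ker v x = (1 + v ^+ 2) + x%:C * (- (2 * v)).
Proof. by rewrite /cheb_ker; ring. Qed.

(** The kernel at [v ^+ 2] and the image of [x] under the Chebyshev map factors
    into two kernels at [v], with opposite [x]. *)
Lemma cheb_kerM v x :
  cheb_ker (v ^+ 2) (2 * x ^+ 2 - 1) = cheb_ker v x * cheb_ker v (- x).
Proof. by rewrite /cheb_ker; ring. Qed.

(** With [x = cos t] the kernel is the product of [1 - exp(it) v] and
    [1 - exp(-it) v]. *)
Lemma cheb_ker_ge v x : -1 <= x <= 1 -> normc v < 1 ->
  (1 - normc v) ^+ 2 <= normc (cheb_ker v x).
Proof.
move=> /andP[x1 x2] v1.
pose y := Num.sqrt (1 - x ^+ 2).
have y2 : x ^+ 2 + y ^+ 2 = 1 by rewrite sqr_sqrtr; [ring | nra].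
have -> : cheb_ker v x = (1 - (x +i* y) * v) * (1 - (x -i* y) * v).
  have e1 : (x +i* y) * (x -i* y) = 1 :> R[i].
    by apply/eqP; rewrite eq_complex/=; apply/andP; split; apply/eqP; [rewrite -y2|]; ring.
  have e2 : (x +i* y) + (x -i* y) = (2 * x)%:C :> R[i].
    by apply/eqP; rewrite eq_complex/=; apply/andP; split; apply/eqP; ring.
  rewrite mulrBl mul1r mulrBr mulr1 mulrACA e1 mul1r -expr2 /cheb_ker -e2; ring.
have n1 : normc (x +i* y) = 1 by rewrite /= y2 sqrtr1.
have n2 : normc (x -i* y) = 1 by rewrite /= sqrrN y2 sqrtr1.
have B (e : R[i]) : normc e = 1 -> 1 - normc v <= normc (1 - e * v).
  move=> ne; apply: le_trans (ler_normcB _ _).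
  by rewrite ComplexField.Normc.normc1 ComplexField.Normc.normcM ne mul1r.
rewrite ComplexField.Normc.normcM expr2.
by apply: ler_pM; rewrite ?B ?subr_ge0 ?(ltW v1).
Qed.

Lemma cheb_ker_gt0 v x : -1 <= x <= 1 -> normc v < 1 -> 0 < normc (cheb_ker v x).
Proof.
by move=> xI v1; rewrite (lt_le_trans _ (cheb_ker_ge xI v1))// exprn_gt0// subr_gt0.
Qed.

Lemma cheb_ker_sub1 v x : -1 <= x <= 1 -> normc v <= 1 ->
  normc (cheb_ker v x - 1) <= 3 * normc v.
Proof.
move=> xI v1.
have -> : cheb_ker v x - 1 = v * (v - (2 * x)%:C) by rewrite /cheb_ker; ring.
rewrite ComplexField.Normc.normcM mulrC ler_wpM2r ?normc_ge0//.
rewrite (le_trans (ler_normcD _ _))// normcN normcR.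
rewrite normrM ger0_norm// (_ : 3 = 1 + 2 * 1)//; last by lra.
by rewrite lerD// ler_wpM2l// ler_norml.
Qed.

Lemma cheb_ker_le v x : -1 <= x <= 1 -> normc v <= 1 -> normc (cheb_ker v x) <= 4.
Proof.
move=> xI v1; rewrite -(subrK 1 (cheb_ker v x)) (le_trans (ler_normcD _ _))//.
by rewrite ComplexField.Normc.normc1; have := cheb_ker_sub1 xI v1; lra.
Qed.

Lemma ln_abs_le (y : R) : 1 / 2 <= y <= 3 / 2 -> `|ln y| <= 1.
Proof.
move=> /andP[y1 y2]; have y0 : 0 < y by lra.
rewrite ler_norml; apply/andP; split; last first.
  by have := @le_ln1Dx R (y - 1); rewrite [1 + _]addrC subrK; lra.
have : ln y^-1 <= y^-1 - 1.
  by have := @le_ln1Dx R (y^-1 - 1); rewrite [1 + _]addrC subrK; apply; rewrite ltrBrDl subrr invr_gt0.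
rewrite lnV ?posrE//.
have : y^-1 <= 2 by rewrite invf_ple ?posrE//; lra.
lra.
Qed.

Let normc_sqr_lt1 v : normc v < 1 -> normc (v ^+ 2) < 1.
Proof. by move=> v1; rewrite normcX exprn_ilt1 ?normc_ge0. Qed.

Let ln_cheb_ker_bounded v : normc v < 1 -> exists M : R, forall x, -1 <= x <= 1 -> `|ln (normc (cheb_ker v x))| <= M.
Proof.
move=> v1; pose a := (1 - normc v) ^+ 2.
exists (`|ln a| + `|ln 4|) => x xI.
have a0 : 0 < a by rewrite exprn_gt0// subr_gt0.
have n0 := cheb_ker_gt0 xI v1.
have l1 : ln a <= ln (normc (cheb_ker v x)) by rewrite ler_ln ?posrE//; exact: cheb_ker_ge.
have l2 : ln (normc (cheb_ker v x)) <= ln 4 by rewrite ler_ln ?posrE//; exact/cheb_ker_le/ltW.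
rewrite ler_norml; have := ler_norm (ln 4 : R); have := ler_norm (- ln a); rewrite normrN.
have := normr_ge0 (ln 4 : R); have := normr_ge0 (ln a); lra.
Qed.

Lemma measurable_ln_cheb_ker v : measurable_fun setT (fun x => ln (normc (cheb_ker v x))).
Proof.
apply: measurableT_comp (@measurable_ln R) _.
under eq_fun do rewrite cheb_kerE.
exact: measurable_normc_affine.
Qed.

Local Notation I := (`[(-1)%R, 1%R]%classic).

Lemma integrable_bounded_segment (P : probability (measurableTypeR R) R) (f : R -> R) (M : R) :
  measurable_fun setT f -> (forall x, -1 <= x <= 1 -> `|f x| <= M) ->
  P.-integrable I (EFin \o f).
Proof.
move=> mf fM; apply: measurable_bounded_integrable => //.
- exact: le_lt_trans (probability_le1 _ _) (ltry _).
- exact: measurable_funTS.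
- exists M; split; first exact: num_real.
  by move=> y My x /= xI; apply: le_trans (ltW My); apply: fM; rewrite in_itv in xI.
Qed.

Let L v := \int[@arcsine R]_(x in `[-1, 1]) ln (normc (cheb_ker v x)).

Let L_sqr v : normc v < 1 -> L (v ^+ 2) = 2 * L v.
Proof.
move=> v1; have [M hM] := ln_cheb_ker_bounded v1; have [M' hM'] := ln_cheb_ker_bounded (normc_sqr_lt1 v1).
have hMN x : -1 <= x <= 1 -> `|ln (normc (cheb_ker v (- x)))| <= M.
  by move=> xI; apply: hM; lra.
have mlnN : measurable_fun setT (fun x => ln (normc (cheb_ker v (- x)))).
  exact: measurableT_comp (measurable_ln_cheb_ker v) (@oppr_measurable R setT).
rewrite /L -(integral_arcsine_chebyshev (measurable_ln_cheb_ker _) hM').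
transitivity (\int[@arcsine R]_(x in `[-1, 1])
    (ln (normc (cheb_ker v x)) + ln (normc (cheb_ker v (- x))))).
  apply: eq_Rintegral => x /set_mem; rewrite /= in_itv/= => xI.
  by rewrite cheb_kerM ComplexField.Normc.normcM lnM// posrE; apply: cheb_ker_gt0 => //; lra.
rewrite RintegralD; [|by []| |].
2: exact: integrable_bounded_segment (measurable_ln_cheb_ker v) hM.
2: exact: integrable_bounded_segment mlnN hMN.
by rewrite (integral_arcsine_opp (measurable_ln_cheb_ker v) hM); ring.
Qed.

Let iter_sqr (f : R[i] -> R) (c : R) v : 0 <= c -> normc v < 1 ->
  (forall u, normc u < 1 -> f (u ^+ 2) = c * f u) ->
  forall n, normc (v ^+ (2 ^ n)) < 1 /\ f (v ^+ (2 ^ n)) = c ^+ n * f v.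
Proof.
move=> c0 v1 fE; elim => [|n [vn ih]]; first by rewrite !expr1 expr0 mul1r.
by rewrite expnSr exprM; split; [exact: normc_sqr_lt1 | rewrite fE// ih mulrA exprS].
Qed.

Let cvg_iter_sqr v : normc v < 1 -> normc (v ^+ (2 ^ n)) @[n --> \oo] --> 0.
Proof.
move=> v1.
have h : (normc v) ^+ n @[n --> \oo] --> 0 by apply: cvg_expr; rewrite ger0_norm ?normc_ge0.
apply: (squeeze_cvgr _ (cvg_cst 0) h); apply: nearW => n.
rewrite normc_ge0 normcX ler_wiXn2l ?normc_ge0 ?(ltW v1)//.
by rewrite ltnW// ltn_expl.
Qed.

Lemma integrable_scale (P : probability (measurableTypeR R) R) (a : R) (f : R -> R) :
  P.-integrable I (EFin \o f) -> P.-integrable I (EFin \o (fun x => a * f x)).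
Proof.
move=> If; have := @integrableZl _ _ _ P I (measurable_itv _) a _ If.
by apply: eq_integrable => // x _; rewrite /= EFinM.
Qed.

Let le_Rintegral_segment (P : probability (measurableTypeR R) R) (f : R -> R) (M : R) :
  measurable_fun setT f -> (forall x, -1 <= x <= 1 -> `|f x| <= M) ->
  `|\int[P]_(x in I) f x| <= M.
Proof.
move=> mf fM; have M0 : 0 <= M by rewrite (le_trans _ (fM 0 _))//; lra.
have If := @integrable_bounded_segment P f M mf fM.
rewrite (le_trans (le_normr_Rintegral _ If))//.
apply: (@le_trans _ _ (\int[P]_(x in I) M)).
  apply: le_Rintegral => //.
  - by apply: (@integrable_bounded_segment P (fun x => `|f x|) M) => [|x xI]; [exact: measurableT_comp | rewrite normr_id fM].
  - by apply: (@integrable_bounded_segment P (cst M) `|M|) => [|x xI].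
rewrite Rintegral_cst// ler_piMr// -lee_fin fineK ?probability_le1//.
by rewrite ge0_fin_numE// (le_lt_trans (probability_le1 _ _))// ltry.
Qed.

(** By [cheb_kerM] and the two invariances, squaring [v] doubles the integral.
    Repeated squaring drives [v] to the origin, near which the integral is
    bounded, so the integral can only be zero. *)
Lemma integral_ln_cheb_ker v : normc v < 1 ->
  \int[@arcsine R]_(x in `[-1, 1]) ln (normc (cheb_ker v x)) = 0.
Proof.
move=> v1; rewrite -/(L v); apply/eqP; rewrite -normr_eq0; apply/negPn/negP => Lv0.
have {}Lv0 : 0 < `|L v| by rewrite lt_neqAle eq_sym Lv0 normr_ge0.
(* Below [1 / 6] the kernel is within [1 / 2] of [1], so that [ln_abs_le]
   applies. *)
have [N1 _ h1] : \forall n \near \oo, normc (v ^+ (2 ^ n)) < 1 / 6.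
  have := @cvgr_lt _ _ _ _ _ _ (cvg_iter_sqr v1) (1 / 6); apply; lra.
have e1 n : (N1 <= n)%N -> 2 ^+ n * `|L v| <= 1.
  move=> nN; have [u1 uE] := iter_sqr (ler0n R 2) v1 L_sqr n.
  rewrite -{1}[2]ger0_norm// -normrX -normrM -uE; apply: le_Rintegral_segment; first exact: measurable_ln_cheb_ker.
  move=> x xI; apply: ln_abs_le; have /= h := h1 _ nN.
  have := cheb_ker_sub1 xI (ltW u1); set q := cheb_ker _ x => h2.
  have e : normc (1 - q) = normc (q - 1) by rewrite -normcN opprB.
  have h3 := ler_normcB 1 (1 - q); rewrite subKr e ComplexField.Normc.normc1 in h3.
  have h4 := ler_normcD (q - 1) 1; rewrite subrK ComplexField.Normc.normc1 in h4.
  by lra.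
pose N2 := (Num.truncn (`|L v|^-1)).+1.
have := e1 (maxn N1 N2) (leq_maxl _ _); rewrite leNgt => /negP; apply.
rewrite -ltr_pdivrMr// div1r.
apply: (lt_le_trans (truncnS_gt _)); rewrite -natrX ler_nat.
by rewrite (leq_trans (leq_maxr N1 N2))// ltnW// ltn_expl.
Qed.

Let cheb_ker_neq0 v x : -1 <= x <= 1 -> normc v < 1 -> cheb_ker v x != 0.
Proof. by move=> xI v1; rewrite -normc_gt0 cheb_ker_gt0. Qed.

Let D v x : R[i] := (1 - v ^+ 2) / cheb_ker v x.

Let D_sqr v x : -1 <= x <= 1 -> normc v < 1 ->
  D (v ^+ 2) (2 * x ^+ 2 - 1) = (1 / 2)%:C * (D v x + D v (- x)).
Proof.
move=> xI v1; have NxI : -1 <= - x <= 1 by lra.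
have h1 := cheb_ker_neq0 xI v1; have h2 := cheb_ker_neq0 NxI v1.
rewrite /D cheb_kerM.
have e : cheb_ker v x + cheb_ker v (- x) = 2 * (1 + v ^+ 2) by rewrite /cheb_ker; ring.
have -> : (1 / 2)%:C = 2^-1 :> R[i] by rewrite mul1r fmorphV rmorph_nat.
have -> : 1 - (v ^+ 2) ^+ 2 = (1 - v ^+ 2) * (2^-1 * (cheb_ker v x + cheb_ker v (- x))).
  by rewrite e mulKf ?pnatr_eq0//; ring.
by field; rewrite h1 h2.
Qed.

Let D_bound v x : -1 <= x <= 1 -> normc v < 1 ->
  normc (D v x - 1) <= 4 * normc v / (1 - normc v) ^+ 2.
Proof.
move=> xI v1; have h1 := cheb_ker_neq0 xI v1.
have -> : D v x - 1 = v * ((2 * x)%:C - 2 * v) / cheb_ker v x.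
  by rewrite /D; apply: (mulIf h1); rewrite mulrBl !divfK// /cheb_ker; ring.
rewrite normc_div ler_pM ?normc_ge0 ?invr_ge0// ?normc_ge0//.
- rewrite ComplexField.Normc.normcM mulrC ler_wpM2r ?normc_ge0//.
  rewrite (le_trans (ler_normcD _ _))// normcN normcR ComplexField.Normc.normcM.
  rewrite (_ : normc 2 = 2); last by rewrite -(rmorph_nat (real_complex R)) normcR ger0_norm.
  rewrite normrM ger0_norm//; have : `|x| <= 1 by rewrite ler_norml.
  by have := normc_ge0 v; lra.
- by rewrite lef_pV2 ?posrE ?cheb_ker_gt0 ?exprn_gt0 ?subr_gt0//; exact: cheb_ker_ge.
Qed.

(* The mean of [D v] does not change when [v] is squared, and [D v] tends
   uniformly to [1] at the origin; [p] is the real or the imaginary part. *)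
Let integral_part_D (p : R[i] -> R) (l : R) v :
  (forall z, `|p z| <= normc z) -> (forall z w, p (z + w) = p z + p w) ->
  (forall (r : R) z, p (r%:C * z) = r * p z) -> p 1 = l ->
  (forall v, measurable_fun setT (fun x => p (D v x))) -> normc v < 1 ->
  \int[@arcsine R]_(x in I) p (D v x) = l.
Proof.
move=> p_le pD pZ p1 mp v1.
have pB z : p z - l = p (z - 1) by have := pD (z - 1) 1; rewrite subrK p1 => ->; rewrite addrK.
pose e (u : R[i]) : R := 4 * normc u / (1 - normc u) ^+ 2.
have pe u x : -1 <= x <= 1 -> normc u < 1 -> `|p (D u x) - l| <= e u.
  by move=> xI u1; rewrite pB (le_trans (p_le _))// D_bound.
have pM u : normc u < 1 -> forall x, -1 <= x <= 1 -> `|p (D u x)| <= e u + `|l|.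
  move=> u1 x xI; rewrite -(subrK l (p _)) (le_trans (ler_normD _ _))// lerD2r.
  exact: pe.
pose F (u : R[i]) : R := \int[@arcsine R]_(x in I) p (D u x) - l.
have F_sqr u : normc u < 1 -> F (u ^+ 2) = 1 * F u.
  move=> u1; rewrite mul1r /F; congr (_ - _).
  rewrite -(integral_arcsine_chebyshev (mp _) (pM _ (normc_sqr_lt1 u1))).
  transitivity (\int[@arcsine R]_(x in I) ((1 / 2) * (p (D u x) + p (D u (- x))))).
    apply: eq_Rintegral => x /set_mem; rewrite /= in_itv/= => xI.
    by rewrite D_sqr// pZ pD.
  have mpN : measurable_fun setT (fun x => p (D u (- x))).
    exact: measurableT_comp (mp u) (@oppr_measurable R setT).
  have pMN x : -1 <= x <= 1 -> `|p (D u (- x))| <= e u + `|l|.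
    by move=> xI; apply: pM => //; lra.
  have i1 := @integrable_bounded_segment (@arcsine R) _ _ (mp u) (pM _ u1).
  have i2 := @integrable_bounded_segment (@arcsine R) _ _ mpN pMN.
  rewrite RintegralZl; [|by []|]; last first.
    by apply: (@integrable_bounded_segment _ _ (e u + `|l| + (e u + `|l|))) => [|x xI];
      [exact: measurable_funD | rewrite (le_trans (ler_normD _ _))// lerD//; [exact: pM | exact: pMN]].
  rewrite RintegralD; [|by []|exact: i1|exact: i2].
  by rewrite (integral_arcsine_opp (mp u) (pM _ u1)); field.
have F_le u : normc u < 1 -> `|F u| <= e u.
  move=> u1; rewrite /F -[X in _ - X](_ : \int[@arcsine R]_(x in I) l = l); last first.
    by rewrite Rintegral_cst//= [fine _](_ : _ = 1) ?mulr1// [X in fine X]arcsine_segment.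
  rewrite -RintegralB; [|by []| |]; last 2 first.
  - exact: integrable_bounded_segment (mp u) (pM _ u1).
  - by apply: (@integrable_bounded_segment _ (cst l) `|l|).
  apply: le_Rintegral_segment => [|x xI]; last exact: pe.
  by apply: measurable_funB => //; exact: mp.
apply/eqP; rewrite -subr_eq0 -/(F v); apply/negPn/negP; rewrite -normr_gt0 => F0.
(* For a modulus [r] below [1 / 2] the bound [e] is at most [16 * r]. *)
have [N _ h1] : \forall n \near \oo, normc (v ^+ (2 ^ n)) < Num.min (1 / 2) (`|F v| / 17).
  have := @cvgr_lt _ _ _ _ _ _ (cvg_iter_sqr v1) (Num.min (1 / 2) (`|F v| / 17)); apply.
  by rewrite lt_min !divr_gt0.
have [u1 uE] := iter_sqr ler01 v1 F_sqr N.
have /= := h1 N (leqnn _); rewrite lt_min => /andP[].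
have := F_le _ u1; rewrite uE expr1n mul1r /e.
set r := normc _ in u1 *; have r0 : 0 <= r by exact: normc_ge0.
rewrite ler_pdivlMr; last by rewrite exprn_gt0// subr_gt0.
move=> h2 h3 h4; have q : 1 / 4 <= (1 - r) ^+ 2 by nra.
by have := ler_wpM2l (ltW F0) q; lra.
Qed.

Lemma measurable_Re_cheb_ker v :
  measurable_fun setT (fun x => complex.Re ((1 - v ^+ 2) / cheb_ker v x)).
Proof.
under eq_fun do rewrite Re_mulc cheb_kerE.
apply: measurable_funB; apply: measurable_funM => //.
- exact: measurable_Re_inv_affine.
- exact: measurable_Im_inv_affine.
Qed.

Lemma measurable_Im_cheb_ker v :
  measurable_fun setT (fun x => complex.Im ((1 - v ^+ 2) / cheb_ker v x)).
Proof.
under eq_fun do rewrite Im_mulc cheb_kerE.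
apply: measurable_funD; apply: measurable_funM => //.
- exact: measurable_Im_inv_affine.
- exact: measurable_Re_inv_affine.
Qed.

Lemma integral_Re_cheb_ker v : normc v < 1 ->
  \int[@arcsine R]_(x in I) complex.Re ((1 - v ^+ 2) / cheb_ker v x) = 1.
Proof.
apply: (@integral_part_D (@complex.Re R)) => //; last exact: measurable_Re_cheb_ker.
- exact: Re_le_normc.
- by move=> [? ?] [? ?].
- by move=> r [? ?] /=; rewrite mul0r subr0.
Qed.

Lemma integral_Im_cheb_ker v : normc v < 1 ->
  \int[@arcsine R]_(x in I) complex.Im ((1 - v ^+ 2) / cheb_ker v x) = 0.
Proof.
apply: (@integral_part_D (@complex.Im R)) => //; last exact: measurable_Im_cheb_ker.
- exact: Im_le_normc.
- by move=> [? ?] [? ?].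
- by move=> r [? ?] /=; rewrite mul0r addr0.
Qed.

End ChebyshevKernel.

(** * The exterior variable of the segment *)

Section ExteriorVariable.
Context (R : realType).
Implicit Types (z w : R[i]) (t : R).

Lemma notin_segment_neq0 z : ~ segment z -> z != 0.
Proof. by apply: contra_notN => /eqP ->; exact: segment0. Qed.

Lemma notin_segment_ray z t : ~ segment z -> 1 <= t -> ~ segment (t%:C * z).
Proof.
move=> zI t1 [x]; rewrite /= in_itv/= => /andP[x1 x2] xE; apply: zI.
have t0 : 0 < t by lra.
exists (x / t); first by rewrite /= in_itv/= ler_pdivlMr// ler_pdivrMr//; apply/andP; split; lra.
by rewrite rmorphM fmorphV /= xE mulrC mulKf//; apply/eqP => -[] /eqP; rewrite gt_eqF.
Qed.

Lemma normc1_inv w : normc w = 1 -> w^-1 = (complex.Re w) -i* (complex.Im w).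
Proof.
case: w => a b h; have : a ^+ 2 + b ^+ 2 = 1.
  by rewrite -[LHS]sqr_sqrtr ?addr_ge0 ?sqr_ge0// [Num.sqrt _]h expr1n.
by move=> h2; apply/eqP; rewrite eq_complex/= h2 !divr1 !eqxx.
Qed.

Variable s : R[i] -> R[i].
Hypothesis hs : is_sqrt_branch s.

Let w z := z + s z.

Lemma branch_wV z : ~ segment z -> w z * (z - s z) = 1.
Proof.
have [_ s2 _] := hs => zI; rewrite /w mulrC -subr_sqr s2//.
by rewrite opprB addrCA subrr addr0.
Qed.

(* If [w] lies on the unit circle then [w^-1] is its conjugate, and
   [z = (w + w^-1) / 2] is its real part. *)
Let normc_w_neq1 z : ~ segment z -> normc (w z) <> 1.
Proof.
move=> zI n1.
have wV : z - s z = (w z)^-1.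
  have := branch_wV zI; have w0 : w z != 0 by rewrite -normc_gt0 n1.
  by move=> h; rewrite -[LHS](mulKf w0) h mulr1.
have zE : z = (complex.Re (w z))%:C.
  have : w z + (z - s z) = 2 * z by rewrite /w; ring.
  rewrite wV normc1_inv//; case: (w z) => a b /= e.
  have : 2 * z = 2 * a%:C by rewrite -e; apply/eqP; rewrite eq_complex/=; apply/andP; split; apply/eqP; ring.
  by apply: mulfI; rewrite pnatr_eq0.
apply: zI; exists (complex.Re (w z)) => //.
by rewrite /= in_itv/= -ler_norml -n1 Re_le_normc.
Qed.

Let w_ray_continuous z t : ~ segment z -> 1 <= t ->
  {for t, continuous (fun t => normc (w (t%:C * z)))}.
Proof.
have [ds _ _] := hs => zI t1.
have /derivable1_diffP/differentiable_continuous := ds _ (notin_segment_ray zI t1).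
move=> /(@cvgrPdist_lt R[i] (R[i]^o) _ (nbhs (t%:C * z : R[i]^o)) (nbhs_filter _)) cs.
apply/cvgrPdist_lt => e e0.
have e2 : 0 < (e / 2)%:C :> R[i] by rewrite ltcR; lra.
have [d /= d0 hd] := cs _ e2.
have dE : d = (complex.Re d)%:C by case: (d) d0 => x y; rewrite /= ltcE /= => /andP[/eqP -> _].
set r := complex.Re d in dE; have r0 : 0 < r by rewrite -ltcR -dE.
have nz : 0 < normc z by rewrite normc_gt0 notin_segment_neq0.
have m0 : 0 < Num.min r (e / 2) / normc z by rewrite divr_gt0// lt_min r0; lra.
near=> t'.
have ht : `|t - t'| * normc z < Num.min r (e / 2).
  by rewrite -ltr_pdivlMr//; near: t'; apply: cvgr_dist_lt.
have hz : normc (t%:C * z - t'%:C * z) < Num.min r (e / 2).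
  by rewrite -mulrBl -rmorphB ComplexField.Normc.normcM normcR.
move: hz; rewrite lt_min => /andP[hz1 hz2].
have hs' : normc (s (t%:C * z) - s (t'%:C * z)) < e / 2.
  by rewrite -ltcR normcC; apply: hd; rewrite /ball_ /= -normcC dE ltcR.
have B a b : `|normc a - normc b| <= normc (a - b) :> R.
  by rewrite ler_norml ler_normcB andbT lerNl opprB (le_trans (ler_normcB _ _))// -normcN opprB.
rewrite (le_lt_trans (B _ _))// /w.
rewrite (_ : _ - _ = (t%:C * z - t'%:C * z) + (s (t%:C * z) - s (t'%:C * z))); last by ring.
by rewrite (le_lt_trans (ler_normcD _ _))//; lra.
Unshelve. all: by end_near. Qed.

Let normc_w_far z : ~ segment z -> exists2 T, 1 <= T & 1 < normc (w (T%:C * z)).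
Proof.
have [_ _ as_] := hs => zI.
have nz : 0 < normc z by rewrite normc_gt0 notin_segment_neq0.
have [M hM] := as_ (1 / 2) (ltac:(lra)).
pose T := 1 + (`|M| + 1) / normc z.
have T1 : 1 <= T by rewrite lerDl divr_ge0 ?(ltW nz)//; have := normr_ge0 M; lra.
exists T => //.
set y := T%:C * z.
have ny : normc y = normc z + (`|M| + 1).
  rewrite ComplexField.Normc.normcM normcR ger0_norm; last by lra.
  by rewrite mulrDl mul1r divfK// gt_eqF.
have yM : M < normc y by rewrite ny; have := ler_norm M; lra.
have y1 : 1 < normc y by rewrite ny; have := normr_ge0 M; lra.
have y0 : y != 0 by rewrite -normc_gt0; lra.
have := hM _ yM => h.
have -> : w y = y * (2 + (s y / y - 1)) by rewrite /w; field.
rewrite ComplexField.Normc.normcM.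
have : 2 - normc (s y / y - 1) <= normc (2 + (s y / y - 1)).
  have := ler_normcB (2 : R[i]) (- (s y / y - 1)); rewrite opprK normcN.
  by rewrite -(rmorph_nat (real_complex R)) normcR ger0_norm.
by move=> ?; nra.
Qed.

(** Off the segment the modulus of [z + s z] never equals [1], and it exceeds
    [1] far out on the ray through [z], on which it varies continuously. *)
Lemma normc_branch_gt1 z : ~ segment z -> 1 < normc (z + s z).
Proof.
move=> zI; rewrite -[z + s z]/(w z) ltNge; apply/negP => w1.
have [T T1 wT] := normc_w_far zI.
have c1 : {within `[1, T], continuous (fun t => normc (w (t%:C * z)))}.
  apply: continuous_in_subspaceT => t /set_mem/=; rewrite in_itv/= => /andP[t1 _].
  exact: w_ray_continuous.
have [|c] := IVT T1 c1 (v := 1).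
  by rewrite mul1r ge_min le_max w1 (ltW wT) orbT.
rewrite in_itv/= => /andP[c1' _]; apply: normc_w_neq1.
exact: notin_segment_ray.
Qed.

End ExteriorVariable.

(** * Transforms off the segment *)

Section OffSegment.
Context (R : realType).
Implicit Types (P : probability (measurableTypeR R) R) (x : R) (z : R[i]).
Local Notation I := (`[(-1)%R, 1%R]%classic).

Lemma real_subE x z : x%:C - z = - z + x%:C * 1.
Proof. by rewrite mulr1 addrC. Qed.

Lemma log_kernelE x z : lne ((normc (x%:C - z))%:E^-1)%E =
  if normc (x%:C - z) <= 0 then +oo%E else (- ln (normc (x%:C - z)))%:E.
Proof.
have := normc_ge0 (x%:C - z); set r := normc _ => r0; case: ifPn => [r1|].
  by rewrite (_ : r = 0) ?inver ?eqxx//; lra.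
rewrite -ltNge => r1; rewrite inver gt_eqF//= leNgt invr_gt0 r1/= lnV ?posrE//.
Qed.

Lemma measurable_normc_sub z : measurable_fun setT (fun x => normc (x%:C - z)).
Proof. by under eq_fun do rewrite real_subE; exact: measurable_normc_affine. Qed.

Lemma measurable_ln_normc z : measurable_fun setT (fun x => - ln (normc (x%:C - z))).
Proof.
apply: measurableT_comp (@oppr_measurable R setT) _.
exact: measurableT_comp (@measurable_ln R) (measurable_normc_sub z).
Qed.

Lemma measurable_log_kernel z :
  measurable_fun setT (fun x => lne ((normc (x%:C - z))%:E^-1)%E).
Proof.
under eq_fun do rewrite log_kernelE.
apply: measurable_fun_if => //=.
- by apply: measurable_fun_ler => //; exact: measurable_normc_sub.
- by apply/measurable_funTS/measurable_EFinP; exact: measurable_ln_normc.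
Qed.

Section WithBranch.
Variables (s : R[i] -> R[i]) (hs : is_sqrt_branch s) (z : R[i]) (zI : ~ segment z).
Let w := z + s z.
Let v := w^-1.

Let w_neq0 : w != 0.
Proof. by rewrite -normc_gt0 (lt_trans _ (normc_branch_gt1 hs zI)). Qed.

Let v_lt1 : normc v < 1.
Proof. by rewrite ComplexField.Normc.normcV invf_lt1 ?normc_branch_gt1// normc_gt0. Qed.

Let vE : v = z - s z.
Proof. by rewrite -[RHS](mulKf w_neq0) (branch_wV hs zI) mulr1. Qed.

Lemma branch_neq0 : s z != 0.
Proof.
apply/eqP => s0; have := branch_wV hs zI; rewrite s0 addr0 subr0 => z1.
have := normc_branch_gt1 hs zI; rewrite s0 addr0.
have : normc (z * z) = 1 by rewrite z1 ComplexField.Normc.normc1.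
by rewrite ComplexField.Normc.normcM; nra.
Qed.

(** The factorization [2 (z - x) = w (1 - 2 x v + v ^+ 2)], through which the
    arcsine integrals become integrals of the Chebyshev kernel. *)
Lemma sub_cheb_ker x : z - x%:C = w / 2 * cheb_ker v x.
Proof.
have vw : v * w = 1 by rewrite mulVf.
have wv : w + v = 2 * z by rewrite vE /w; ring.
apply: (@mulfI _ 2); first by rewrite pnatr_eq0.
transitivity (w + v * (v * w) - 2 * x%:C * (v * w)).
  by rewrite vw !mulr1 wv; ring.
by rewrite /cheb_ker; field.
Qed.

Lemma normc_sub_cheb_ker x :
  normc (x%:C - z) = normc w / 2 * normc (cheb_ker v x).
Proof.
rewrite -normcN opprB sub_cheb_ker ComplexField.Normc.normcM normc_div.
by rewrite -(rmorph_nat (real_complex R)) normcR ger0_norm.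
Qed.

End WithBranch.

Lemma normc_sub_bounds z : ~ segment z -> exists a b : R, 0 < a /\
  forall x, -1 <= x <= 1 -> a <= normc (x%:C - z) <= b.
Proof.
move=> zI; have [s hs] := is_sqrt_branch_exists R.
have w1 := normc_branch_gt1 hs zI; set w := z + s z in w1.
have v1 : normc w^-1 < 1 by rewrite ComplexField.Normc.normcV invf_lt1//; lra.
exists (normc w / 2 * (1 - normc w^-1) ^+ 2), (normc w / 2 * 4); split.
  by rewrite mulr_gt0 ?exprn_gt0 ?subr_gt0//; lra.
move=> x xI; rewrite (normc_sub_cheb_ker hs zI) -/w !ler_wpM2l ?cheb_ker_ge//; try lra.
exact/cheb_ker_le/ltW.
Qed.

Lemma ln_normc_sub_bounded z : ~ segment z ->
  exists M : R, forall x, -1 <= x <= 1 -> `|- ln (normc (x%:C - z))| <= M.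
Proof.
move=> zI; have [a [b [a0 ab]]] := normc_sub_bounds zI.
exists (`|ln a| + `|ln b|) => x xI.
have /andP[h1 h2] := ab _ xI; have n0 := lt_le_trans a0 h1.
have b0 := lt_le_trans n0 h2.
have l1 : ln a <= ln (normc (x%:C - z)) by rewrite ler_ln.
have l2 : ln (normc (x%:C - z)) <= ln b by rewrite ler_ln.
rewrite normrN ler_norml; have := ler_norm (ln b); have := ler_norm (- ln a); rewrite normrN.
have := normr_ge0 (ln b); have := normr_ge0 (ln a); lra.
Qed.

Lemma potential_off P z : P I = 1%E -> ~ segment z ->
  potential P z = (\int[P]_(x in I) (- ln (normc (x%:C - z))))%:E.
Proof.
move=> PI zI; rewrite /potential (integral_full_set _ PI)//; last first.
  exact: measurable_log_kernel.
have [M hM] := ln_normc_sub_bounded zI.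
have If := integrable_bounded_segment P (measurable_ln_normc z) hM.
rewrite fineK ?integrable_fin_num//.
have [a [b [a0 ab]]] := normc_sub_bounds zI.
apply: eq_integral => x /set_mem; rewrite /= in_itv/= => xI.
by rewrite log_kernelE leNgt (lt_le_trans a0)//; have /andP[] := ab _ xI.
Qed.

Lemma resolvent_bounded z : ~ segment z ->
  exists M : R, forall x, -1 <= x <= 1 -> normc (z - x%:C)^-1 <= M.
Proof.
move=> zI; have [a [b [a0 ab]]] := normc_sub_bounds zI; exists a^-1 => x xI.
have /andP[h _] := ab _ xI.
by rewrite ComplexField.Normc.normcV -normcN opprB lef_pV2 ?posrE// (lt_le_trans a0).
Qed.

Let resE z x : (z - x%:C)^-1 = (z + x%:C * (-1))^-1.
Proof. by rewrite mulrN1. Qed.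

Lemma measurable_Re_resolvent z : measurable_fun setT (fun x => complex.Re (z - x%:C)^-1).
Proof. by under eq_fun do rewrite resE; exact: measurable_Re_inv_affine. Qed.

Lemma measurable_Im_resolvent z : measurable_fun setT (fun x => complex.Im (z - x%:C)^-1).
Proof. by under eq_fun do rewrite resE; exact: measurable_Im_inv_affine. Qed.

Lemma cauchy_transformE P z : P I = 1%E -> cauchy_transform P z =
  (\int[P]_(x in I) complex.Re (z - x%:C)^-1) +i*
  (\int[P]_(x in I) complex.Im (z - x%:C)^-1).
Proof.
move=> PI; rewrite /cauchy_transform /Rintegral.
rewrite (integral_full_set _ PI)//; last by apply/measurable_EFinP; exact: measurable_Re_resolvent.
rewrite (integral_full_set _ PI)//; last by apply/measurable_EFinP; exact: measurable_Im_resolvent.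
Qed.

End OffSegment.

(** * Transforms of the arcsine law *)

Section ArcsineTransforms.
Context (R : realType).
Variables (s : R[i] -> R[i]) (hs : is_sqrt_branch s) (z : R[i]) (zI : ~ segment z).
Local Notation I := (`[(-1)%R, 1%R]%classic).
Let w := z + s z.
Let v := w^-1.

Let w_gt1 : 1 < normc w := normc_branch_gt1 hs zI.

Let v_lt1 : normc v < 1.
Proof. by rewrite ComplexField.Normc.normcV invf_lt1 ?w_gt1// (lt_trans _ w_gt1). Qed.

Lemma integral_arcsine_ln :
  \int[@arcsine R]_(x in I) (- ln (normc (x%:C - z))) = ln 2 - ln (normc w).
Proof.
have w2 : 0 < normc w / 2 by have := w_gt1; lra.
have c0 x : -1 <= x <= 1 -> 0 < normc (cheb_ker v x).
  by move=> xI; exact: cheb_ker_gt0.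
transitivity (\int[@arcsine R]_(x in I) ((ln 2 - ln (normc w)) - ln (normc (cheb_ker v x)))).
  apply: eq_Rintegral => x /set_mem; rewrite /= in_itv/= => xI.
  rewrite (normc_sub_cheb_ker hs zI) -/w -/v lnM ?posrE ?c0// ln_div ?posrE//; last by have := w_gt1; lra.
  ring.
have mk := @measurable_ln_cheb_ker R v.
have [M hM] := ln_normc_sub_bounded zI.
rewrite RintegralB; [|by []| |]; last 2 first.
- by apply: (@integrable_bounded_segment _ _ (cst (ln 2 - ln (normc w))) `|ln 2 - ln (normc w)|).
- apply: (@integrable_bounded_segment _ _ _ (M + `|ln 2 - ln (normc w)|)) => // x xI.
  have := hM _ xI; rewrite (normc_sub_cheb_ker hs zI) -/w -/v lnM ?posrE ?c0// ln_div ?posrE//; last by have := w_gt1; lra.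
  rewrite normrN => h; rewrite -(lerBlDr _ `|_|) (le_trans _ h)//.
  have := lerB_dist (ln (normc (cheb_ker v x))) (ln 2 - ln (normc w)).
  by move/le_trans; apply; rewrite (_ : _ - _ = ln (normc w) - ln 2 + ln (normc (cheb_ker v x)))//; ring.
by rewrite integral_ln_cheb_ker// subr0 Rintegral_cst//= [fine _](_ : _ = 1) ?mulr1// [X in fine X]arcsine_segment.
Qed.

Let resolventE x : -1 <= x <= 1 ->
  (z - x%:C)^-1 = (s z)^-1 * ((1 - v ^+ 2) / cheb_ker v x).
Proof.
move=> xI; have s0 := branch_neq0 hs zI.
have k0 : cheb_ker v x != 0 by rewrite -normc_gt0 cheb_ker_gt0.
have w0 : w != 0 by rewrite -normc_gt0 (lt_trans _ w_gt1).
have vE : v = z - s z by rewrite -[RHS](mulKf w0) (branch_wV hs zI) mulr1.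
have -> : 1 - v ^+ 2 = 2 * s z * v.
  transitivity (v * w - v * v); first by rewrite mulVf.
  by rewrite -mulrBr mulrC (_ : w - v = 2 * s z)// vE /w; ring.
rewrite (sub_cheb_ker hs zI) -/w -/v.
by rewrite /v; field; rewrite w0 k0 s0.
Qed.

Lemma integral_arcsine_resolvent :
  (\int[@arcsine R]_(x in I) complex.Re (z - x%:C)^-1) +i*
  (\int[@arcsine R]_(x in I) complex.Im (z - x%:C)^-1) = (s z)^-1.
Proof.
have D_le x : -1 <= x <= 1 -> normc ((1 - v ^+ 2) / cheb_ker v x) <= 2 / (1 - normc v) ^+ 2.
  move=> xI; rewrite normc_div ler_pM ?normc_ge0 ?invr_ge0 ?normc_ge0//.
    rewrite (le_trans (ler_normcD _ _))// normcN ComplexField.Normc.normc1 normcX.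
    by have := v_lt1; have := normc_ge0 v; nra.
  rewrite lef_pV2 ?posrE ?cheb_ker_gt0 ?exprn_gt0 ?subr_gt0//; exact: cheb_ker_ge.
set B := 2 / _ in D_le.
pose D x := (1 - v ^+ 2) / cheb_ker v x.
have mDR := measurable_Re_cheb_ker v; have mDI := measurable_Im_cheb_ker v.
have iR := @integrable_bounded_segment _ (@arcsine R) _ B mDR
  (fun x xI => le_trans (Re_le_normc _) (D_le x xI)).
have iI := @integrable_bounded_segment _ (@arcsine R) _ B mDI
  (fun x xI => le_trans (Im_le_normc _) (D_le x xI)).
have lin (a b : R) (f : R -> R) :
    (forall x, -1 <= x <= 1 -> f x = a * complex.Re (D x) + b * complex.Im (D x)) ->
    \int[@arcsine R]_(x in I) f x = a.
  move=> fE.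
  transitivity (\int[@arcsine R]_(x in I) (a * complex.Re (D x) + b * complex.Im (D x))).
    by apply: eq_Rintegral => x /set_mem; rewrite /= in_itv/=; exact: fE.
  rewrite RintegralD; [|by []|exact: integrable_scale|exact: integrable_scale].
  rewrite RintegralZl; [|by []|exact: iR]; rewrite RintegralZl; [|by []|exact: iI].
  by rewrite integral_Re_cheb_ker// integral_Im_cheb_ker// mulr1 mulr0 addr0.
rewrite (lin (complex.Re (s z)^-1) (- complex.Im (s z)^-1)); last first.
  by move=> x xI; rewrite resolventE// Re_mulc mulNr.
rewrite (lin (complex.Im (s z)^-1) (complex.Re (s z)^-1)); last first.
  by move=> x xI; rewrite resolventE// Im_mulc addrC.
by case: (s z)^-1.
Qed.

End ArcsineTransforms.

(** * The angle under which the segment is seen *)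

Section PrincipalArgument.
Context (R : realType).
Implicit Types (t : R) (w z : R[i]).

Lemma argC_unique w t : - pi < t <= pi -> w != 0 ->
  w = normc w * cos t +i* (normc w * sin t) -> argC w = t.
Proof.
move=> /andP[t1 t2] w0 wE; rewrite -normc_gt0 in w0.
have -> : argC w = if 0 <= sin t then acos (cos t) else - acos (cos t).
  have ReE : complex.Re w = normc w * cos t by rewrite {1}wE.
  have ImE : complex.Im w = normc w * sin t by rewrite {1}wE.
  rewrite /argC ReE ImE pmulr_rge0//.
  by rewrite mulrC mulKf// gt_eqF.
case: ifPn => st.
- have t0 : 0 <= t.
    rewrite leNgt; apply/negP => t0; move: st; rewrite leNgt => /negP; apply.
    by rewrite -oppr_gt0 -sinN; apply: sin_gt0_pi; apply/andP; split; lra.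
  by rewrite cosK// in_itv/= t0.
- have t0 : t < 0.
    rewrite ltNge; apply: contra st => t0; apply: sin_ge0_pi; exact/andP.
  by rewrite cosKN ?opprK//; apply/andP; split; lra.
Qed.

Let sin_atanE (u : R) : sin (atan u) = u * cos (atan u).
Proof.
rewrite -{2}[u]atanK /tan divfK// cos_atan invr_neq0// sqrtr_eq0 -ltNge.
by rewrite ltr_pwDl// sqr_ge0.
Qed.

Lemma normc_endpoints_gt0 z : ~ segment z -> 0 < normc (z + 1) /\ 0 < normc (z - 1).
Proof.
move=> zI; rewrite !normc_gt0; split; apply/eqP => h; apply: zI.
  exists (-1); first by rewrite /= in_itv/= lexx ltW// ltN11.
  by rewrite rmorphN rmorph1 -[RHS](addrK 1) h sub0r.
exists 1; first by rewrite /= in_itv/= lexx ltW// ltN11.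
by rewrite rmorph1 -[RHS](subrK 1) h add0r.
Qed.

(** The inverse tangents are the angles of [z + 1] and [z - 1] with the vertical,
    and their difference stays in [-pi, pi]. For real [z] both quotients are
    divisions by zero, with value zero; the difference is then [0], which is the
    argument of the positive ratio. *)
Lemma argC_segment_ratio z : ~ segment z ->
  argC ((z + 1) / (z - 1)) =
  atan ((- 1 - complex.Re z) / complex.Im z) - atan ((1 - complex.Re z) / complex.Im z).
Proof.
case: z => a b zI /=.
have [n1 n2] := normc_endpoints_gt0 zI.
have nz : (a +i* b + 1) / (a +i* b - 1) != 0 by rewrite -normc_gt0 normc_div divr_gt0.
set N := normc (_ + 1) in n1; set D := normc (_ - 1) in n2.
have D2 : D ^+ 2 = (1 - a) ^+ 2 + b ^+ 2.
  by rewrite /D /= sqr_sqrtr ?addr_ge0 ?sqr_ge0// subr0; ring.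
have N2 : N ^+ 2 = (-1 - a) ^+ 2 + b ^+ 2.
  by rewrite /N /= sqr_sqrtr ?addr_ge0 ?sqr_ge0// addr0; ring.
have ratioE : (a +i* b + 1) / (a +i* b - 1) =
    ((a ^+ 2 - 1 + b ^+ 2) / D ^+ 2) +i* (- 2 * b / D ^+ 2).
  apply/eqP; rewrite eq_complex/= !subr0 !addr0.
  rewrite (_ : (a - 1) ^+ 2 + b ^+ 2 = D ^+ 2); last by rewrite D2; ring.
  by apply/andP; split; apply/eqP; field; rewrite gt_eqF.
have [b0|b0] := eqVneq b 0.
  have -> : atan ((-1 - a) / b) - atan ((1 - a) / b) = 0.
    by rewrite b0 invr0 !mulr0 subrr.
  apply: argC_unique => //.
    by rewrite oppr_lt0 pi_gt0 pi_ge0.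
  rewrite cos0 sin0 mulr0 mulr1 normc_div -/N -/D ratioE; congr (_ +i* _); last first.
    by rewrite b0 mulr0 mul0r.
  have a1 : 1 < a ^+ 2.
    rewrite ltNge; apply/negP => a1; apply: zI; exists a; last by rewrite b0.
    by rewrite /= in_itv/=; apply/andP; split; nra.
  apply/(mulIf (x := D ^+ 2)); first by rewrite sqrf_eq0 gt_eqF.
  rewrite divfK ?sqrf_eq0 ?gt_eqF// expr2 mulrA divfK ?gt_eqF//.
  apply/eqP; rewrite -(eqrXn2 (n := 2))//.
  - by rewrite exprMn N2 D2 b0; apply/eqP; ring.
  - by rewrite b0 expr0n/= addr0; lra.
  - by rewrite mulr_ge0// ltW.
set u := (-1 - a) / b; set u' := (1 - a) / b.
have cosE (c M : R) : 0 < M -> M ^+ 2 = c ^+ 2 + b ^+ 2 -> cos (atan (c / b)) = `|b| / M.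
  move=> M0 M2; rewrite cos_atan -[RHS]invrK invf_div; congr (_^-1).
  rewrite -[RHS]ger0_norm ?divr_ge0 ?(ltW M0)// -sqrtr_sqr; congr Num.sqrt.
  rewrite !expr_div_n real_normK ?num_real// M2; by field.
have c1 := cosE _ _ n1 N2; have c2 := cosE _ _ n2 D2; rewrite -/u in c1; rewrite -/u' in c2.
apply: argC_unique => //.
  have := atan_gtNpi2 u; have := atan_ltpi2 u; have := atan_gtNpi2 u'; have := atan_ltpi2 u'.
  by move=> h1 h2 h3 h4; apply/andP; split; lra.
have b2 : `|b| * `|b| = b ^+ 2 by rewrite -expr2 real_normK ?num_real.
rewrite cosB sinB !sin_atanE c1 c2 normc_div -/N -/D ratioE; congr (_ +i* _).
  transitivity ((`|b| * `|b|) * (1 + u * u') / D ^+ 2); last by field; rewrite !gt_eqF.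
  by rewrite b2 /u /u'; field; rewrite b0 gt_eqF.
transitivity ((`|b| * `|b|) * (u - u') / D ^+ 2); last by field; rewrite !gt_eqF.
by rewrite b2 /u /u'; field; rewrite b0 gt_eqF.
Qed.

End PrincipalArgument.

(** * Transforms of the uniform law *)

Section UniformTransforms.
Context (R : realType).
Implicit Types (x : R) (z : R[i]).
Local Notation I := (`[(-1)%R, 1%R]%classic).
Local Notation mu := (@lebesgue_measure R).

Lemma uniformE (A : set R) : measurable A -> A `<=` I ->
  lambda R A = ((1 / 2)%:E * mu A)%E.
Proof.
move=> mA AI; transitivity (\int[mu]_(x in A) (uniform_pdf (-1) 1 x)%:E)%E; first by [].
rewrite (eq_integral (fun=> (1 / 2)%:E)); first by rewrite integral_cst.
move=> x /set_mem/AI; rewrite /= in_itv/= /uniform_pdf => ->.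
by congr (_%:E); rewrite opprK div1r.
Qed.

Lemma uniform_segment : lambda R I = 1%E.
Proof.
rewrite [LHS]uniformE// lebesgue_measure_itv/= lte_fin ltN11 -EFinD -EFinM.
by congr (_%:E); field.
Qed.

Lemma integral_uniform_segment (f : R -> R) (M : R) :
  measurable_fun setT f -> (forall x, -1 <= x <= 1 -> `|f x| <= M) ->
  \int[lambda R]_(x in I) f x = 1 / 2 * \int[mu]_(x in I) f x.
Proof.
move=> mf fM; rewrite /Rintegral.
have h0 : 0 <= 1 / 2 :> R by lra.
have -> : (\int[lambda R]_(x in I) (f x)%:E =
           \int[mscale (NngNum h0) mu]_(x in I) (f x)%:E)%E.
  by apply: eq_measure_integral => A mA AI; exact: uniformE.
have mI : (mu I < +oo)%E.
  have -> : mu I = 2%:E; last by rewrite ltry.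
  by apply: etrans (lebesgue_measure_itv _) _; rewrite /= lte_fin ltN11 -EFinD; congr (_%:E); lra.
have If : mu.-integrable I (EFin \o f).
  apply: measurable_bounded_integrable => //; first exact: measurable_funTS.
  exists M; split; first exact: num_real.
  by move=> y My x /= xI; apply: le_trans (ltW My); apply: fM; rewrite in_itv in xI.
have mE : measurable_fun (I : set R) (EFin \o f) by apply: measurable_funTS; exact/measurable_EFinP.
rewrite [X in fine X = _]integralE [X in _ = _ * fine X]integralE.
rewrite !ge0_integral_mscale//=; [|exact: measurable_funeneg|exact: measurable_funepos].
rewrite -muleBr//; last first.
  by rewrite fin_num_adde_defl// fin_numN integrable_neg_fin_num.
by rewrite fineM//= fin_numB integrable_pos_fin_num// integrable_neg_fin_num.
Qed.

Lemma integral_uniform_FTC (f F : R -> R) (M : R) :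
  measurable_fun setT f -> (forall x, -1 <= x <= 1 -> `|f x| <= M) ->
  (forall x, -1 <= x <= 1 -> {for x, continuous f}) ->
  (forall x, -1 <= x <= 1 -> is_derive x 1 F (f x)) ->
  \int[lambda R]_(x in I) f x = (F 1 - F (-1)) / 2.
Proof.
move=> mf fM fc dF; rewrite (integral_uniform_segment mf fM) mulrC div1r; congr (_ * _).
have dF' x : -1 <= x <= 1 -> derivable F x 1 by move=> /dF h; exact: ex_derive.
have cF x : -1 <= x <= 1 -> {for x, continuous F}.
  by move=> /dF' h; apply: differentiable_continuous; exact/derivable1_diffP.
rewrite /Rintegral (@continuous_FTC2 _ f F) ?ltN11//.
- by apply: continuous_in_subspaceT => x /set_mem; rewrite /= in_itv/=; exact: fc.
- split.
  + by move=> x; rewrite in_itv/= => /andP[x1 x2]; apply: dF'; rewrite !ltW.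
  + by apply: cvg_at_right_filter; apply: cF; rewrite lexx ltW// ltN11.
  + by apply: cvg_at_left_filter; apply: cF; rewrite lexx ltW// ltN11.
- move=> x; rewrite in_itv/= => /andP[x1 x2]; have /dF h : -1 <= x <= 1 by rewrite !ltW.
  by rewrite derive1E; exact: derive_val.
Qed.

Section Antiderivatives.
Variables (a b : R) (zI : ~ segment (a +i* b)).

Let Q x : R := (x - a) ^+ 2 + b ^+ 2.

Let Q_gt0 x : -1 <= x <= 1 -> 0 < Q x.
Proof.
move=> xI; rewrite /Q; rewrite lt_neqAle addr_ge0 ?sqr_ge0// andbT eq_sym.
rewrite paddr_eq0 ?sqr_ge0// !sqrf_eq0; apply/negP => /andP[/eqP xa /eqP b0].
apply: zI; exists x; first by rewrite /= in_itv.
by rewrite b0; apply/eqP; rewrite eq_complex/= eqxx andbT; apply/eqP; lra.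
Qed.

Let normc_Q x : normc (x%:C - (a +i* b)) = Num.sqrt (Q x).
Proof. by rewrite /Q/= sub0r sqrrN. Qed.

Let ln_Q x : -1 <= x <= 1 -> ln (normc (x%:C - (a +i* b))) = ln (Q x) / 2.
Proof.
move=> xI; rewrite normc_Q; have q := Q_gt0 xI.
rewrite -{2}(sqr_sqrtr (ltW q)) lnXn ?sqrtr_gt0// mulr2n; lra.
Qed.

Let dQ x : is_derive x 1 Q (2 * (x - a)).
Proof.
rewrite /Q; apply: is_derive_eq.
by rewrite /GRing.scale/=; ring.
Qed.

Let dlnQ x : -1 <= x <= 1 -> is_derive x 1 (@ln R \o Q) (2 * (x - a) / Q x).
Proof.
move=> xI; have d1 := is_derive1_ln (Q_gt0 xI); have d2 := dQ x.
by rewrite mulrC; exact: is_derive1_comp.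
Qed.

Let datan x : -1 <= x <= 1 ->
  is_derive x 1 (fun x => atan ((x - a) / b)) (b / Q x).
Proof.
move=> xI; have d1 := is_derive1_atan ((x - a) / b).
have d2 : is_derive x 1 (fun x : R => (x - a) / b) b^-1.
  by apply: is_derive_eq; rewrite /GRing.scale/=; ring.
have d := @is_derive1_comp R (@atan R) (fun x : R => (x - a) / b) x _ _ d1 d2.
apply: (is_derive_eq d).
have [->|b0] := eqVneq b 0; first by rewrite invr0 mulr0 mul0r.
have := Q_gt0 xI; rewrite /Q => q.
by field; rewrite b0 andbT gt_eqF.
Qed.

Let Q_continuous x : {for x, continuous Q}.
Proof.
apply: differentiable_continuous; apply/derivable1_diffP.
by have := dQ x => d; exact: ex_derive.
Qed.

Let invQ_continuous x : -1 <= x <= 1 -> {for x, continuous (fun x => (Q x)^-1)}.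
Proof.
by move=> xI; apply: cvgV; [rewrite gt_eqF// Q_gt0 | exact: Q_continuous].
Qed.

Let thetap := atan ((1 - a) / b).
Let thetam := atan ((-1 - a) / b).
Let rp := normc ((a +i* b) - 1).
Let rm := normc ((a +i* b) + 1).

Let ln_Q1 : ln (Q 1) = 2 * ln rp.
Proof.
have xI : -1 <= (1 : R) <= 1 by rewrite lexx ltW// ltN11.
have := ln_Q xI; rewrite -normcN opprB rmorph1 -/rp => ->; lra.
Qed.

Let ln_QN1 : ln (Q (-1)) = 2 * ln rm.
Proof.
have xI : -1 <= (-1 : R) <= 1 by rewrite lexx ltW// ltN11.
have := ln_Q xI; rewrite -normcN opprB rmorphN rmorph1 opprK -/rm => ->; lra.
Qed.

Lemma integral_uniform_ln :
  \int[lambda R]_(x in I) (- ln (normc (x%:C - (a +i* b)))) =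
  1 - ((1 - a) * ln rp + (1 + a) * ln rm + b * (thetap - thetam)) / 2.
Proof.
have [M hM] := ln_normc_sub_bounded zI.
pose F : R -> R := fun x => - ((x - a) * ln (Q x) / 2 - x + b * atan ((x - a) / b)).
have fc x : -1 <= x <= 1 -> {for x, continuous (fun x => - ln (normc (x%:C - (a +i* b))))}.
  move=> xI; rewrite (_ : (fun x => _) = (fun x => - (@ln R \o (@Num.sqrt R \o Q)) x)); last first.
    by apply/funext => y; rewrite normc_Q.
  apply: cvgN; apply: continuous_comp; last first.
    by apply: continuous_ln; rewrite /= sqrtr_gt0 Q_gt0.
  by apply: continuous_comp; [exact: Q_continuous | exact: sqrt_continuous].
have dF x : -1 <= x <= 1 -> is_derive x 1 F (- ln (normc (x%:C - (a +i* b)))).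
  move=> xI; have d1 := dlnQ xI; have d2 := datan xI.
  have q := Q_gt0 xI.
  have d3 : is_derive x 1 (fun x : R => x - a) 1 by apply: is_derive_eq; rewrite subr0.
  have d4 := is_deriveM d3 d1; have d5 := is_deriveZ (2^-1) d4.
  have d6 := is_deriveZ b d2; have d7 := is_deriveN (is_deriveD (is_deriveB d5 (is_derive_id x 1)) d6).
  have FE : F = - ((2^-1 *: ((fun x : R => x - a) * (@ln R \o Q)) - id) + b *: (fun x => atan ((x - a) / b))).
    by apply/funext => y; rewrite /F/= mulrC.
  rewrite FE; apply: (is_derive_eq d7).
  rewrite ln_Q// /GRing.scale/=.
  have := Q_gt0 xI; rewrite /Q => qq; field; exact: lt0r_neq0.
rewrite (integral_uniform_FTC (measurable_ln_normc _) hM fc dF).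
by rewrite /F ln_Q1 ln_QN1 -/thetap -/thetam; field.
Qed.

Lemma integral_uniform_resolvent :
  (\int[lambda R]_(x in I) complex.Re ((a +i* b) - x%:C)^-1) +i*
  (\int[lambda R]_(x in I) complex.Im ((a +i* b) - x%:C)^-1) =
  ((ln rm - ln rp) / 2) +i* ((thetam - thetap) / 2).
Proof.
have [M hM] := resolvent_bounded zI.
have ReE x : complex.Re ((a +i* b) - x%:C)^-1 = (a - x) / Q x.
  by rewrite /= subr0 (_ : (a - x) ^+ 2 = (x - a) ^+ 2)//; ring.
have ImE x : complex.Im ((a +i* b) - x%:C)^-1 = - (b / Q x).
  by rewrite /= subr0 (_ : (a - x) ^+ 2 = (x - a) ^+ 2) ?mulNr//; ring.
congr (_ +i* _).
- pose F : R -> R := fun x => - (ln (Q x) / 2).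
  have fM x : -1 <= x <= 1 -> `|complex.Re ((a +i* b) - x%:C)^-1| <= M.
    by move=> xI; exact: le_trans (Re_le_normc _) (hM _ xI).
  have fc x : -1 <= x <= 1 -> {for x, continuous (fun x => complex.Re ((a +i* b) - x%:C)^-1)}.
    move=> xI; rewrite (_ : (fun x => _) = (fun x => (a - x) / Q x)); last exact/funext.
    apply: cvgM; last exact: invQ_continuous.
    by apply: cvgB; [exact: cvg_cst|exact: cvg_id].
  have dF x : -1 <= x <= 1 -> is_derive x 1 F (complex.Re ((a +i* b) - x%:C)^-1).
    move=> xI; have d1 := is_deriveZ (- 2^-1) (dlnQ xI).
    have FE : F = (- 2^-1) *: (@ln R \o Q) by apply/funext => y; rewrite -[RHS]/(- 2^-1 * ln (Q y)) /F; field.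
    rewrite FE; apply: (is_derive_eq d1); rewrite ReE /GRing.scale/=.
    by have := Q_gt0 xI; rewrite /Q => qq; field; exact: lt0r_neq0.
  rewrite (integral_uniform_FTC (measurable_Re_resolvent _) fM fc dF).
  by rewrite /F ln_Q1 ln_QN1; field.
- pose F : R -> R := fun x => - atan ((x - a) / b).
  have fM x : -1 <= x <= 1 -> `|complex.Im ((a +i* b) - x%:C)^-1| <= M.
    by move=> xI; exact: le_trans (Im_le_normc _) (hM _ xI).
  have fc x : -1 <= x <= 1 -> {for x, continuous (fun x => complex.Im ((a +i* b) - x%:C)^-1)}.
    move=> xI; rewrite (_ : (fun x => _) = (fun x => - (b / Q x))); last exact/funext.
    by apply: cvgN; apply: cvgM; [exact: cvg_cst|exact: invQ_continuous].
  have dF x : -1 <= x <= 1 -> is_derive x 1 F (complex.Im ((a +i* b) - x%:C)^-1).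
    by move=> xI; rewrite ImE; exact: is_deriveN (datan xI).
  rewrite (integral_uniform_FTC (measurable_Im_resolvent _) fM fc dF).
  by rewrite /F -/thetap -/thetam; field.
Qed.

End Antiderivatives.
End UniformTransforms.

(** * Potentials on the segment as vertical limits *)

Section PotentialOnSegment.
Context (R : realType).
Local Notation I := (`[(-1)%R, 1%R]%classic).

(** Approaching the segment vertically, the logarithmic kernel increases to its
    value on the segment, including at the singularity. *)
Lemma cvg_potential_segment (P : probability (measurableTypeR R) R) (x0 : R)
    (p : nat -> R) (l : R) : P I = 1%E -> -1 <= x0 <= 1 ->
  (forall n, potential P (x0 +i* harmonic n) = (p n)%:E) -> p @ \oo --> l ->
  potential P x0%:C = l%:E.
Proof.
move=> PI x0I potE pl.
pose k z (x : R) : \bar R := lne ((normc (x%:C - z))%:E^-1)%E.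
pose z n : R[i] := x0 +i* harmonic n.
have nE n x : normc (x%:C - z n) = Num.sqrt ((x - x0) ^+ 2 + (harmonic n) ^+ 2).
  by rewrite /= sub0r sqrrN.
have n0E x : normc (x%:C - x0%:C) = `|x - x0| by rewrite -rmorphB normcR.
have n_gt0 n x : 0 < normc (x%:C - z n).
  by rewrite nE sqrtr_gt0 ltr_wpDl ?sqr_ge0// exprn_gt0// harmonic_gt0.
have kE n x : k (z n) x = (- ln (normc (x%:C - z n)))%:E.
  by rewrite /k log_kernelE leNgt n_gt0.
have hle1 n : @harmonic R n <= 1 by rewrite /harmonic/= invf_le1// ler1n.
have h0 n : 0 < @harmonic R n by exact: harmonic_gt0.
(* The distance is at most the square root of [2 ^ 2 + 1], hence below [3]. *)
have k_ge n x : -1 <= x <= 1 -> (((- ln 3)%:E : \bar R) <= k (z n) x)%E.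
  move=> xI; rewrite kE lee_fin lerN2 ler_ln ?posrE//.
  rewrite nE -(ler_pXn2r (n := 2)) ?nnegrE ?sqrtr_ge0// sqr_sqrtr ?addr_ge0 ?sqr_ge0//.
  by have := hle1 n; have := h0 n; nra.
have k_nd x : -1 <= x <= 1 -> {homo (fun n => k (z n) x) : m n / (m <= n)%N >-> (m <= n)%E}.
  move=> xI m n mn; rewrite !kE lee_fin lerN2 ler_ln ?posrE// !nE.
  apply: ler_wsqrtr; rewrite lerD2l ler_pXn2r ?nnegrE ?harmonic_ge0//.
  by rewrite /harmonic/= lef_pV2 ?posrE// ler_nat.
have ln_harm : @harmonic R @ \oo --> 0 by exact: cvg_harmonic.
have k_cvg x : -1 <= x <= 1 -> k (z n) x @[n --> \oo] --> k x0%:C x.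
  move=> xI; rewrite /k log_kernelE n0E.
  have [->|xx0] := eqVneq x x0.
    rewrite subrr normr0 lexx; apply/cvgeyPge => A.
    have eA : 0 < expR (- A) by exact: expR_gt0.
    have [N _ hN] := near_infty_natSinv_lt (PosNum eA).
    exists N => // n /= Nn; rewrite -/(k (z n) x0) kE lee_fin lerNr.
    rewrite -[leRHS](expRK) ler_ln ?posrE ?expR_gt0// nE subrr expr0n/= add0r.
    by rewrite sqrtr_sqr ger0_norm ?harmonic_ge0//; exact/ltW/hN.
  have d0 : 0 < `|x - x0| by rewrite normr_gt0 subr_eq0.
  rewrite leNgt d0/=.
  rewrite [X in X @ _](_ : _ = (fun n => (- ln (Num.sqrt ((x - x0) ^+ 2 + harmonic n ^+ 2)))%:E)); last first.
    by apply/funext => n; rewrite -[LHS]/(k (z n) x) kE nE.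
  apply: cvg_EFin; first exact: nearW.
  rewrite (_ : `|x - x0| = Num.sqrt ((x - x0) ^+ 2 + 0 ^+ 2)); last by rewrite expr0n/= addr0 sqrtr_sqr.
  apply: cvgN; apply: continuous_cvg.
    by apply: continuous_ln; rewrite sqrtr_gt0 expr0n/= addr0 exprn_even_gt0//= subr_eq0.
  apply: continuous_cvg; first exact: sqrt_continuous.
  apply: cvgD; first exact: cvg_cst.
  by rewrite !expr2; apply: cvgM.
have mk y : measurable_fun setT (k y) by exact: measurable_log_kernel.
have k_ge0 y x : ((- ln 3)%:E <= k y x)%E -> (0 <= k y x + (ln 3)%:E)%E.
  by move=> h; rewrite -leeBlDr// sub0e -EFinN.
have ln3 : 0 <= ln 3 :> R by rewrite ln_ge0// ler1n.
pose g n x := (k (z n) x + (ln 3)%:E)%E.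
have Pg n : (\int[P]_(x in I) g n x = (p n + ln 3)%:E)%E.
  rewrite EFinD -potE /potential (integral_full_set _ PI)//; last exact: mk.
  apply: integral_add_cst => //; first exact: measurable_funTS.
  by move=> x; rewrite /= in_itv/= => xI; exact: k_ge.
have gl x : -1 <= x <= 1 -> g n x @[n --> \oo] --> (k x0%:C x + (ln 3)%:E)%E.
  move=> xI; apply: cvgeD; [|exact: k_cvg|exact: cvg_cst].
  by rewrite fin_num_adde_defl.
have k0_ge x : -1 <= x <= 1 -> ((- ln 3)%:E <= k x0%:C x)%E.
  move=> xI; apply: le_trans (k_ge 0%N x xI) _.
  have := k_cvg _ xI => /cvg_lim <- //; apply: lime_ge.
    by apply: ereal_nondecreasing_is_cvgn; exact: k_nd.
  by apply: nearW => n; exact: k_nd.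
have Ig : (\int[P]_(x in I) g n x)%E @[n --> \oo] --> (\int[P]_(x in I) (k x0%:C x + (ln 3)%:E))%E.
  rewrite (_ : (\int[P]_(x in I) _)%E = (\int[P]_(x in I) limn (g ^~ x))%E); last first.
    by apply: eq_integral => x /set_mem; rewrite /= in_itv/= => /gl/cvg_lim ->.
  apply: cvg_monotone_convergence => //.
  - by move=> n; apply: measurable_funTS; apply: emeasurable_funD; [exact: mk | exact: measurable_cst].
  - by move=> n x; rewrite /= in_itv/= => xI; apply: k_ge0; exact: k_ge.
  - by move=> x; rewrite /= in_itv/= => xI m n mn; rewrite leeD2r// k_nd.
have Ip : (\int[P]_(x in I) g n x)%E @[n --> \oo] --> (l + ln 3)%:E.
  under eq_fun do rewrite Pg.
  by apply: cvg_EFin; [exact: nearW | apply: cvgD; [exact: pl | exact: cvg_cst]].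
have : (\int[P]_(x in I) (k x0%:C x + (ln 3)%:E) = (l + ln 3)%:E)%E.
  exact: cvg_unique Ig Ip.
rewrite integral_add_cst//; last exact: measurable_funTS.
rewrite /potential (integral_full_set _ PI)//; last exact: mk.
by rewrite EFinD => /(congr1 (fun y => y - (ln 3)%:E)%E); rewrite !addeK.
Qed.

End PotentialOnSegment.

(** * The candidate equilibrium measure *)

Section EquilibriumMeasure.
Context (R : realType).
Implicit Types (x : R).
Local Notation I := (`[(-1)%R, 1%R]%classic).
Local Notation mu := (@lebesgue_measure R).

Lemma pi_gt2 : 2 < pi :> R.
Proof.
rewrite lt_neqAle pi_ge2 andbT; apply/eqP => e.
have := cos1_gt0 R; rewrite (_ : 1 = pi / 2); last by rewrite -e divff.
by rewrite cos_pihalf ltxx.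
Qed.

Variables (tau : R) (htau1 : -1 <= tau) (htau2 : tau <= 2 / (pi - 2)).

Definition equilibrium_pdf x : R :=
  if -1 < x < 1 then equilibrium_density tau x else 0.

Let upper_pdf x : R := if -1 < x < 1 then 1 / 2 else 0.

(** For positive [tau] the density is smallest at the origin, where the upper
    bound on [tau] says that it is nonnegative. *)
Lemma equilibrium_pdf_ge0 x : 0 <= equilibrium_pdf x.
Proof.
rewrite /equilibrium_pdf; case: ifPn => // xI; rewrite /equilibrium_density.
have p2 := pi_gt2; have p0 := pi_gt0 R.
have htau : tau * (pi - 2) <= 2 by rewrite -ler_pdivlMr// subr_gt0.
have s0 : 0 < Num.sqrt (1 - x ^+ 2) by rewrite sqrtr_gt0; nra.
have s1 : Num.sqrt (1 - x ^+ 2) <= 1 by rewrite -[leRHS]sqrtr1 ler_wsqrtr// gerBl sqr_ge0.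
rewrite subr_ge0 ler_pdivlMr ?mulr_gt0//.
set q := Num.sqrt _ in s0 s1 *.
move: p2 p0 htau; move: (pi : R) => p p2 p0 htau.
have pq0 : 0 < p * q by rewrite mulr_gt0.
have pqp : p * q <= p by rewrite ler_piMr// ltW.
have [t0|t0] := leP tau 0.
  apply: (@le_trans _ _ 0); last by rewrite -lerBlDl sub0r.
  by rewrite mulr_le0_ge0//; [lra | exact: ltW].
have : tau / 2 * (p * q) <= tau / 2 * p by rewrite ler_wpM2l// divr_ge0// ltW.
by nra.
Qed.

Lemma equilibrium_pdfE x :
  equilibrium_pdf x = (1 + tau) * arcsine_pdf x - tau * upper_pdf x.
Proof.
rewrite /equilibrium_pdf /arcsine_pdf /upper_pdf; case: ifP => _; last by rewrite !mulr0 subr0.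
by rewrite /equilibrium_density; congr (_ - _); field.
Qed.

Let measurable_upper_pdf : measurable_fun setT upper_pdf.
Proof.
apply: measurable_fun_if => //=.
by apply: measurable_and => //; exact: measurable_fun_ltr.
Qed.

Lemma measurable_equilibrium_pdf : measurable_fun setT equilibrium_pdf.
Proof.
rewrite (_ : equilibrium_pdf = fun x => (1 + tau) * arcsine_pdf x - tau * upper_pdf x); last first.
  by apply/funext => x; exact: equilibrium_pdfE.
apply: measurable_funB; apply: measurable_funM => //.
exact: measurable_arcsine_pdf.
Qed.

Let upper_pdf_ge0 x : 0 <= upper_pdf x.
Proof. by rewrite /upper_pdf; case: ifP => // _; lra. Qed.

Let endpoints_null : mu [set -1; 1] = 0%E.
Proof.
by rewrite measureU// ?[X in (X + _)%E]lebesgue_measure_set1 ?[X in (_ + X)%E]lebesgue_measure_set1 ?adde0//;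
  apply/seteqP; split => x //= [-> h]; have := ltN11 R; rewrite h ltxx.
Qed.

Let notin_endpoints (x : R) : ~ [set -1; 1] x -> (-1 < x < 1) = (-1 <= x <= 1).
Proof.
move=> xe; rewrite !lt_neqAle; case: eqVneq => [e|_] /=; first by case: xe; left.
by case: eqVneq => [e|_] //=; case: xe; right.
Qed.

Lemma uniform_pdfE (A : set R) : measurable A ->
  lambda R A = (\int[mu]_(x in A) (upper_pdf x)%:E)%E.
Proof.
move=> mA; apply: ge0_ae_eq_integral => //.
- by apply/measurable_funTS/measurable_EFinP; exact: measurable_uniform_pdf.
- by apply/measurable_funTS/measurable_EFinP.
- by move=> x _; rewrite lee_fin uniform_pdf_ge0 ?ltN11.
- by move=> x _; rewrite lee_fin.
exists [set -1; 1]; split => //; first exact: measurableU.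
move=> x /=; apply: contra_notP => xe _; rewrite /uniform_pdf /upper_pdf notin_endpoints//.
by rewrite opprK div1r.
Qed.

Let tp := Num.max tau 0.
Let tm := Num.max (- tau) 0.

Let tp0 : 0 <= tp. Proof. by rewrite le_max lexx orbT. Qed.
Let tm0 : 0 <= tm. Proof. by rewrite le_max lexx orbT. Qed.
Let t10 : 0 <= 1 + tau. Proof. by rewrite -lerBlDl sub0r. Qed.
Let tE : tp - tm = tau.
Proof. by rewrite /tp /tm; case: (leP tau 0) => h; case: (leP (- tau) 0) => h'; lra. Qed.

(* The sign of [tau] is not known; its positive and negative parts go to
   different sides, so that both sides are positive measures. *)
Let pdf_mix (A : set R) : measurable A ->
  (\int[mu]_(x in A) (equilibrium_pdf x)%:E + tp%:E * lambda R A =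
   (1 + tau)%:E * arcsine R A + tm%:E * lambda R A)%E.
Proof.
move=> mA; rewrite uniform_pdfE//.
have -> : arcsine R A = (\int[mu]_(x in A) (arcsine_pdf x)%:E)%E by [].
have mu' : measurable_fun A (EFin \o upper_pdf) by apply/measurable_funTS/measurable_EFinP.
have ma : measurable_fun A (EFin \o @arcsine_pdf R).
  by apply/measurable_funTS/measurable_EFinP; exact: measurable_arcsine_pdf.
have me : measurable_fun A (EFin \o equilibrium_pdf).
  by apply/measurable_funTS/measurable_EFinP; exact: measurable_equilibrium_pdf.
have u0 x : A x -> (0 <= (upper_pdf x)%:E)%E by rewrite lee_fin.
have a0 x : A x -> (0 <= (arcsine_pdf x)%:E)%E by rewrite lee_fin arcsine_pdf_ge0.
rewrite -!ge0_integralZl_EFin//.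
rewrite -!ge0_integralD//; last first.
all: try by move=> x _; rewrite -?EFinM lee_fin ?equilibrium_pdf_ge0// mulr_ge0 ?arcsine_pdf_ge0.
all: try exact: measurable_funeM.
apply: eq_integral => x _; rewrite -!EFinM -!EFinD equilibrium_pdfE; congr (_%:E).
by have := tE; nra.
Qed.

Lemma integral_equilibrium_pdf : (\int[mu]_x (equilibrium_pdf x)%:E = 1)%E.
Proof.
have := pdf_mix measurableT; rewrite !probability_setT !mule1 -EFinD => e.
have fin : (\int[mu]_x (equilibrium_pdf x)%:E)%E \is a fin_num.
  by case: integral e.
move: e; rewrite -(fineK fin) -EFinD => -[e]; congr (_%:E); have := tE; lra.
Qed.

Definition equilibrium_prob : probability (measurableTypeR R) R :=
  density_prob measurable_equilibrium_pdf equilibrium_pdf_ge0 integral_equilibrium_pdf.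

Lemma equilibrium_probE (A : set R) : measurable A -> equilibrium_prob A =
  (\int[mu]_(x in A `&` [set x : R | -1 <= x <= 1]%R) (equilibrium_density tau x)%:E)%E.
Proof.
move=> mA; rewrite [RHS]integral_mkcondr; apply: ae_eq_integral => //.
- by apply/measurable_funTS/measurable_EFinP; exact: measurable_equilibrium_pdf.
- have mI : measurable [set x : R | -1 <= x <= 1].
    by rewrite (_ : [set x | _] = I)//; apply/seteqP; split => x; rewrite /= in_itv.
  apply: measurable_funTS.
  apply/(measurable_restrictT (fun x => (equilibrium_density tau x)%:E) mI).
  apply/measurable_funTS/measurable_EFinP; apply: measurable_funB => //.
  apply: measurable_funM => //; apply: measurableT_comp (@measurable_invr R) _.
  apply: measurable_funM => //; apply: measurableT_comp (@measurable_sqrtr R) _.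
  by apply: measurable_funB => //; exact: exprn_measurable.
exists [set -1; 1]; split => //; first exact: measurableU.
move=> x /=; apply: contra_notP => xe _; rewrite /equilibrium_pdf notin_endpoints// patchE.
by case: ifPn => xI; [rewrite mem_set | rewrite memNset//; exact/negP].
Qed.

Lemma equilibrium_prob_segment : equilibrium_prob I = 1%E.
Proof.
have := pdf_mix (measurable_itv `[-1, 1]).
rewrite [X in (_ + _ * X = _)%E]uniform_segment [X in (_ = _ + _ * X)%E]uniform_segment.
rewrite [X in (_ = _ * X + _)%E]arcsine_segment !mule1.
rewrite -[X in (X + _ = _)%E]/(equilibrium_prob I) => e.
have fin : equilibrium_prob I \is a fin_num by exact: fin_num_measure.
move: e; rewrite -(fineK fin) -EFinD => -[e]; congr (_%:E); have := tE; lra.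
Qed.

(** [pdf_mix] only speaks of nonnegative integrands, so the bound [M] is added
    to [f] and removed at the end. *)
Lemma integral_equilibrium (f : R -> R) (M : R) :
  measurable_fun setT f -> (forall x, -1 <= x <= 1 -> `|f x| <= M) ->
  \int[equilibrium_prob]_(x in I) f x =
  (1 + tau) * \int[@arcsine R]_(x in I) f x - tau * \int[lambda R]_(x in I) f x.
Proof.
move=> mf fM.
have M0 : 0 <= M by rewrite (le_trans _ (fM 0 _))//; lra.
pose g x : \bar R := ((f x)%:E + M%:E)%E.
have g0 x : I x -> (0 <= g x)%E.
  rewrite /= in_itv/= => /fM; rewrite ler_norml /g -EFinD lee_fin => /andP[h _]; lra.
have mg : measurable_fun (I : set R) g.
  by apply: measurable_funTS; apply: emeasurable_funD => //; exact/measurable_EFinP.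
have mix : (\int[equilibrium_prob]_(x in I) g x + tp%:E * \int[lambda R]_(x in I) g x =
   (1 + tau)%:E * \int[@arcsine R]_(x in I) g x + tm%:E * \int[lambda R]_(x in I) g x)%E.
  rewrite -[tp]/(NngNum tp0)%:num -[tm]/(NngNum tm0)%:num -[1 + tau]/(NngNum t10)%:num.
  rewrite -!ge0_integral_mscale// -!ge0_integral_measure_add//.
  apply: eq_measure_integral => A mA _.
  apply: etrans (measure_addE _ _ _) _; apply: etrans (pdf_mix mA) _.
  exact/esym/measure_addE.
have gE (P : probability (measurableTypeR R) R) : P I = 1%E ->
    (\int[P]_(x in I) g x = (\int[P]_(x in I) f x + M)%:E)%E.
  move=> PI; rewrite integral_add_cst//; last 2 first.
  - by apply/measurable_funTS/measurable_EFinP.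
  - by move=> x; rewrite /= in_itv/= => /fM; rewrite ler_norml lee_fin => /andP[].
  rewrite EFinD fineK// integrable_fin_num//.
  exact: integrable_bounded_segment fM.
move: mix; rewrite (gE _ equilibrium_prob_segment) (gE _ (@arcsine_segment R)) (gE _ (@uniform_segment R)).
rewrite -!EFinM -!EFinD => -[].
set E := Rintegral _ _ _; set A := Rintegral _ _ _; set L := Rintegral _ _ _.
have e := tE.
have -> : tp = tau + tm by lra.
by move=> h; lra.
Qed.

End EquilibriumMeasure.

(** * Vertical limits of the explicit potentials *)

Section SegmentLimits.
Context (R : realType).
Implicit Types (x : R) (z : R[i]).
Local Notation I := (`[(-1)%R, 1%R]%classic).

(** The logarithmic potential of the uniform measure, where the two inverse
    tangents are the angles of [z - 1] and [z + 1] from the vertical. *)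
Definition uniform_potential z : R :=
  1 - ((1 - complex.Re z) * ln (normc (z - 1)) + (1 + complex.Re z) * ln (normc (z + 1))
       + complex.Im z * (atan ((1 - complex.Re z) / complex.Im z)
                         - atan ((- 1 - complex.Re z) / complex.Im z))) / 2.

Lemma potential_uniform_off z : ~ segment z ->
  potential (lambda R) z = (uniform_potential z)%:E.
Proof.
by case: z => a b zI; rewrite potential_off ?uniform_segment// integral_uniform_ln.
Qed.

Lemma notin_segment_Im (a b : R) : b != 0 -> ~ segment (a +i* b).
Proof. by move=> b0 [x _] [_ e]; rewrite -e eqxx in b0. Qed.

Let vertical x n : R[i] := x +i* @harmonic R n.

Let vertical_notin x n : ~ segment (vertical x n).
Proof. by apply: notin_segment_Im; rewrite gt_eqF// harmonic_gt0. Qed.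

Let sqrt_le (y h : R) : 0 <= y -> 0 <= h -> Num.sqrt (y ^+ 2 + h ^+ 2) <= y + h.
Proof.
move=> y0 h0; rewrite -[leRHS]ger0_norm ?addr_ge0// -sqrtr_sqr ler_wsqrtr//; nra.
Qed.

Let cvg_ln_dist (c : R) : 0 <= c ->
  c * ln (Num.sqrt (c ^+ 2 + @harmonic R n ^+ 2)) @[n --> \oo] --> c * ln c.
Proof.
rewrite le_eqVlt => /predU1P[<-|c0].
  by under eq_fun do rewrite mul0r; rewrite mul0r; exact: cvg_cst.
apply: cvgM; first exact: cvg_cst.
rewrite (_ : ln c = ln (Num.sqrt (c ^+ 2 + 0 ^+ 2))); last first.
  by rewrite expr0n/= addr0 sqrtr_sqr ger0_norm// ltW.
apply: continuous_cvg.
  by apply: continuous_ln; rewrite sqrtr_gt0 expr0n/= addr0 exprn_gt0.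
apply: continuous_cvg; first exact: sqrt_continuous.
apply: cvgD; first exact: cvg_cst.
by rewrite !expr2; apply: cvgM; exact: cvg_harmonic.
Qed.

Lemma cvg_uniform_potential x : -1 <= x <= 1 ->
  uniform_potential (vertical x n) @[n --> \oo] -->
  1 - ((1 - x) * ln (1 - x) + (1 + x) * ln (1 + x)) / 2.
Proof.
move=> xI; rewrite -[X in _ - X / _]addr0.
apply: cvgB; first exact: cvg_cst.
apply: cvgMl; apply: cvgD; first apply: cvgD.
- have := @cvg_ln_dist (1 - x); rewrite subr_ge0 => /(_ (andP xI).2).
  apply: cvg_trans; apply: near_eq_cvg; apply: nearW => n /=.
  by rewrite subr0 (_ : (x - 1) ^+ 2 = (1 - x) ^+ 2)//; ring.
- have x1 : 0 <= 1 + x by lra.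
  have := cvg_ln_dist x1; apply: cvg_trans; apply: near_eq_cvg; apply: nearW => n /=.
  by rewrite addr0 [x + 1]addrC.
- have hp : @harmonic R n * pi @[n --> \oo] --> 0.
    by rewrite -[X in _ --> X](mul0r (pi : R)); apply: cvgMl; exact: cvg_harmonic.
  have hpN : - (@harmonic R n * pi) @[n --> \oo] --> 0 by rewrite -oppr0; apply: cvgN.
  apply: (squeeze_cvgr _ hpN hp); apply: nearW => n.
  rewrite -[X in _ <= X <= _]/(@harmonic R n *
    (atan ((1 - x) / @harmonic R n) - atan ((- 1 - x) / @harmonic R n))).
  have h0 := @harmonic_ge0 R n.
  set u := atan _; set v := atan _.
  have u1 : - (pi / 2) < u by exact: atan_gtNpi2.
  have u2 : u < pi / 2 by exact: atan_ltpi2.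
  have v1 : - (pi / 2) < v by exact: atan_gtNpi2.
  have v2 : v < pi / 2 by exact: atan_ltpi2.
  by rewrite -mulrN !ler_wpM2l//; lra.
Qed.

Lemma potential_uniform_segment x : -1 <= x <= 1 -> potential (lambda R) x%:C =
  (1 - ((1 - x) * ln (1 - x) + (1 + x) * ln (1 + x)) / 2)%:E.
Proof.
move=> xI; apply: (@cvg_potential_segment _ _ _ (fun n => uniform_potential (vertical x n))) => //.
- exact: uniform_segment.
- by move=> n; exact/potential_uniform_off/vertical_notin.
- exact: cvg_uniform_potential.
Qed.

(** [|w|] is determined by the sum of the distances from [z] to the endpoints,
    since [w] maps confocal ellipses to circles. *)
Lemma normc_branch_ellipse (s : R[i] -> R[i]) z : is_sqrt_branch s -> ~ segment z ->
  normc (z + s z) ^+ 2 + 1 = normc (z + s z) * (normc (z - 1) + normc (z + 1)).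
Proof.
move=> hs zI; have w1 := normc_branch_gt1 hs zI; have wV := branch_wV hs zI.
set w := z + s z in w1 wV *.
have w0 : w != 0 by rewrite -normc_gt0; lra.
have zE : 2 * z * w = w ^+ 2 + 1.
  by transitivity (w ^+ 2 + w * (z - s z)); [rewrite /w; ring | rewrite wV].
have e1 : 2 * w * (z - 1) = (w - 1) ^+ 2.
  transitivity (2 * z * w - 2 * w); first by ring.
  by rewrite zE; ring.
have e2 : 2 * w * (z + 1) = (w + 1) ^+ 2.
  transitivity (2 * z * w + 2 * w); first by ring.
  by rewrite zE; ring.
have n2 : normc (2 : R[i]) = 2 by rewrite -(rmorph_nat (real_complex R)) normcR ger0_norm.
have := congr1 (@normc R) e1; have := congr1 (@normc R) e2.
rewrite !normcX !ComplexField.Normc.normcM n2 => f2 f1.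
have : normc (w - 1) ^+ 2 + normc (w + 1) ^+ 2 = 2 * (normc w ^+ 2 + 1).
  case: (w) => a b /=; rewrite !sqr_sqrtr ?addr_ge0 ?sqr_ge0//; ring.
by rewrite -f1 -f2; nra.
Qed.

(** Near the segment the sum of the distances to the endpoints exceeds [2] by at
    most [2 h], which by [normc_branch_ellipse] forces [(|w| - 1) ^+ 2 <= 8 h]. *)
Lemma cvg_ln_normc_branch (s : R[i] -> R[i]) x : is_sqrt_branch s -> -1 <= x <= 1 ->
  ln (normc (vertical x n + s (vertical x n))) @[n --> \oo] --> 0.
Proof.
move=> hs /andP[x1 x2].
have h8 : Num.sqrt (8 * @harmonic R n) @[n --> \oo] --> 0.
  rewrite -[X in _ --> X](@sqrtr0 R); apply: continuous_cvg; first exact: sqrt_continuous.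
  by rewrite -[X in _ --> X](mulr0 (8 : R)); apply: cvgMr; exact: cvg_harmonic.
apply: (squeeze_cvgr _ (cvg_cst 0) h8); apply: nearW => n.
have w1 := normc_branch_gt1 hs (@vertical_notin x n).
have := normc_branch_ellipse hs (@vertical_notin x n).
move: w1; set r := normc (_ + s _) => r1 rE.
have h0 : 0 <= @harmonic R n by exact: harmonic_ge0.
have h1 : @harmonic R n <= 1 by rewrite /harmonic/= invf_le1// ler1n.
have b1 : normc (vertical x n - 1) <= 1 - x + harmonic n.
  rewrite (_ : normc _ = Num.sqrt ((1 - x) ^+ 2 + harmonic n ^+ 2)).
    by rewrite sqrt_le// subr_ge0.
  by rewrite /= subr0 (_ : (x - 1) ^+ 2 = (1 - x) ^+ 2)//; ring.
have b2 : normc (vertical x n + 1) <= 1 + x + harmonic n.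
  rewrite (_ : normc _ = Num.sqrt ((1 + x) ^+ 2 + harmonic n ^+ 2)).
    by rewrite sqrt_le//; lra.
  by rewrite /= addr0 [x + 1]addrC.
set h := harmonic n in h0 h1 b1 b2 *.
have r4 : r ^+ 2 + 1 <= r * (2 + 2 * h) by rewrite rE ler_wpM2l//; lra.
have r4' : r <= 4 by nra.
have r5 : (r - 1) ^+ 2 <= 8 * h by nra.
rewrite ln_ge0/=; last exact: ltW.
apply: (@le_trans _ _ (r - 1)).
  by have := @le_ln1Dx R (r - 1); rewrite [1 + _]addrC subrK; apply; lra.
by rewrite -[leLHS]ger0_norm ?subr_ge0 ?(ltW r1)// -sqrtr_sqr ler_wsqrtr.
Qed.

End SegmentLimits.

(** * Transforms of the candidate *)

Section EquilibriumTransforms.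
Context (R : realType).
Variables (tau : R) (htau1 : -1 <= tau) (htau2 : tau <= 2 / (pi - 2)).
Variables (s : R[i] -> R[i]) (hs : is_sqrt_branch s).
Local Notation I := (`[(-1)%R, 1%R]%classic).
Local Notation nu := (equilibrium_prob htau1 htau2).

Lemma potential_equilibrium_off z : ~ segment z -> potential nu z =
  ((1 + tau) * (ln 2 - ln (normc (z + s z))) - tau * uniform_potential z)%:E.
Proof.
move=> zI; have [M hM] := ln_normc_sub_bounded zI.
rewrite potential_off ?equilibrium_prob_segment//.
rewrite (integral_equilibrium htau1 htau2 (measurable_ln_normc z) hM).
rewrite (integral_arcsine_ln hs zI); congr (_ - _ * _)%:E.
by have := potential_uniform_off zI; rewrite potential_off ?uniform_segment// => -[].
Qed.

Lemma potential_equilibrium_segment x : -1 <= x <= 1 -> potential nu x%:C =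
  ((1 + tau) * ln 2 -
    tau * (1 - ((1 - x) * ln (1 - x) + (1 + x) * ln (1 + x)) / 2))%:E.
Proof.
move=> xI.
apply: (@cvg_potential_segment _ _ _ (fun n =>
  (1 + tau) * (ln 2 - ln (normc (x +i* harmonic n + s (x +i* harmonic n))))
  - tau * uniform_potential (x +i* harmonic n))) => //.
- exact: equilibrium_prob_segment.
- by move=> n; apply/potential_equilibrium_off/notin_segment_Im; rewrite gt_eqF// harmonic_gt0.
- apply: cvgB; last by apply: cvgMr; exact: cvg_uniform_potential.
  apply: cvgMr; rewrite -[X in _ --> X]subr0; apply: cvgB; first exact: cvg_cst.
  exact: cvg_ln_normc_branch.
Qed.

(** On the segment the logarithms in the two potentials cancel and leave the
    constant; the support lies in the segment because the measure does. *)
Lemma equilibrium_prob_is_equilibrium : is_equilibrium tau nu ((1 + tau) * ln 2).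
Proof.
have total x : -1 <= x <= 1 ->
    (potential nu x%:C + tau%:E * potential (lambda R) x%:C = ((1 + tau) * ln 2)%:E)%E.
  move=> xI; rewrite potential_equilibrium_segment// potential_uniform_segment//.
  by rewrite -EFinM -EFinD subrK.
split; first exact: equilibrium_prob_segment.
- move=> x xs; apply: total; rewrite -ler_norml leNgt; apply/negP => x1.
  have e0 : 0 < `|x| - 1 by rewrite subr_gt0.
  have := xs _ e0; apply/negP; rewrite -leNgt.
  have nI : nu (~` I) = 0%E by rewrite probability_setC// equilibrium_prob_segment subee.
  rewrite -[leRHS]nI le_measure ?inE//.
  + exact: measurable_ball.
  + exact: measurableC.
  + move=> y; rewrite /ball/= in_itv/= -ler_norml => xy; apply/negP; rewrite -ltNge.
    by have := lerB_dist x y; have := ler_normB x (x - y); rewrite subKr => h1 h2; lra.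
- by move=> x xI; rewrite total.
Qed.

(** The transform of the arcsine law is [(s z)^-1]; that of the uniform law is
    half the logarithm of the ratio, with argument from [argC_segment_ratio]. *)
Lemma cauchy_equilibrium z : ~ segment z -> cauchy_transform nu z =
  (1 + tau)%:C / s z - (tau / 2)%:C * logC ((z + 1) / (z - 1)).
Proof.
move=> zI; rewrite cauchy_transformE ?equilibrium_prob_segment//.
have [M hM] := resolvent_bounded zI.
rewrite (integral_equilibrium htau1 htau2 (measurable_Re_resolvent z)
  (fun x xI => le_trans (Re_le_normc _) (hM x xI))).
rewrite (integral_equilibrium htau1 htau2 (measurable_Im_resolvent z)
  (fun x xI => le_trans (Im_le_normc _) (hM x xI))).
rewrite -(integral_arcsine_resolvent hs zI) /logC argC_segment_ratio//.
have := zI; case: z zI {hM} => a b zI _.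
have := integral_uniform_resolvent zI => -[-> ->].
have [n1 n2] := normc_endpoints_gt0 zI.
rewrite normc_div ln_div ?posrE//.
set A := Rintegral _ _ _; set B := Rintegral _ _ _.
by apply/eqP; rewrite eq_complex /=; apply/andP; split; apply/eqP; field.
Qed.

End EquilibriumTransforms.

(** * Energies of positive mixtures *)

Section MixtureKernel.
Context d (Z : measurableType d) (R : realType).
Variable m : {sigma_finite_measure set Z -> \bar R}.
Variable phi : Z * measurableTypeR R -> R.
Hypothesis mphi : measurable_fun setT phi.
Hypothesis phi0 : forall p, 0 <= phi p.
Hypothesis phiB : forall z, exists M, forall x, phi (z, x) <= M.
Implicit Types (P Q : probability (measurableTypeR R) R) (x y : R) (z : Z).

(** A kernel of this form is positive definite. *)
Definition mix_ker x y : \bar R := (\int[m]_z (phi (z, x) * phi (z, y))%:E)%E.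

(** The profile of a measure against the family, in terms of which the energy
    is an inner product. *)
Definition profile P z : R := \int[P]_x phi (z, x).

Definition mix_potential P x : \bar R := (\int[m]_z (phi (z, x) * profile P z)%:E)%E.

Let measurable_phi_l z : measurable_fun setT (fun x : measurableTypeR R => phi (z, x)).
Proof. exact: measurableT_comp mphi (pair1_measurable z). Qed.

Let measurable_phi_r (x : measurableTypeR R) : measurable_fun setT (fun z => phi (z, x)).
Proof. exact: measurableT_comp mphi (pair2_measurable x). Qed.

Let profileE P z : (profile P z)%:E = (\int[P]_x (phi (z, x))%:E)%E.
Proof.
rewrite fineK//.
have [M hM] := phiB z.
apply: integrable_fin_num => //; apply: measurable_bounded_integrable => //.
- exact: le_lt_trans (probability_le1 _ _) (ltry _).
- exists M; split; first exact: num_real.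
  by move=> y My x _; rewrite /= ger0_norm// (le_trans (hM x))// ltW.
Qed.

Lemma profile_ge0 P z : 0 <= profile P z.
Proof. by apply: Rintegral_ge0. Qed.

Lemma measurable_profile P : measurable_fun setT (profile P).
Proof.
apply/measurable_EFinP; rewrite (_ : EFin \o _ = fun z => (\int[P]_x (phi (z, x))%:E)%E).
  apply: (measurable_fun_fubini_tonelli_F (fun p => (phi p)%:E)) => [|p].
    exact/measurable_EFinP.
  by rewrite lee_fin.
by apply/funext => z /=; rewrite profileE.
Qed.

Let ker_integrand x (p : measurableTypeR R * Z) : \bar R :=
  (phi (p.2, x) * phi (p.2, p.1))%:E.

Let measurable_ker_integrand x : measurable_fun setT (ker_integrand x).
Proof.
apply/measurable_EFinP; apply: measurable_funM.
  exact: measurableT_comp (measurable_phi_r x) measurable_snd.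
apply: measurableT_comp mphi _.
by apply: measurable_fun_pair; [exact: measurable_snd|exact: measurable_fst].
Qed.

Let ker_integrand_ge0 x p : (0 <= ker_integrand x p)%E.
Proof. by rewrite lee_fin mulr_ge0. Qed.

Lemma measurable_mix_ker x : measurable_fun setT (mix_ker x).
Proof.
exact: (measurable_fun_fubini_tonelli_F _ (measurable_ker_integrand x)
  (ker_integrand_ge0 x)).
Qed.

Lemma mix_ker_ge0 x y : (0 <= mix_ker x y)%E.
Proof. by apply: integral_ge0 => z _; rewrite lee_fin mulr_ge0. Qed.

Lemma mix_potentialE P x : mix_potential P x = (\int[P]_y mix_ker x y)%E.
Proof.
rewrite /mix_potential /mix_ker.
have := @fubini_tonelli _ _ _ _ R P m _ (measurable_ker_integrand x) (ker_integrand_ge0 x).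
rewrite /ker_integrand/= => ->.
apply: eq_integral => z _.
under [in RHS]eq_integral do rewrite EFinM.
rewrite ge0_integralZl_EFin//; last by apply/measurable_EFinP; exact: measurable_phi_l.
  by rewrite EFinM profileE.
by move=> y _; rewrite lee_fin.
Qed.

Lemma mix_potential_ge0 P x : (0 <= mix_potential P x)%E.
Proof. by apply: integral_ge0 => z _; rewrite lee_fin mulr_ge0// profile_ge0. Qed.

Let measurable_potential_integrand P : measurable_fun setT
  (fun p : measurableTypeR R * Z => (phi (p.2, p.1) * profile P p.2)%:E).
Proof.
apply/measurable_EFinP; apply: measurable_funM.
  apply: measurableT_comp mphi _.
  by apply: measurable_fun_pair; [exact: measurable_snd|exact: measurable_fst].
exact: measurableT_comp (measurable_profile P) measurable_snd.
Qed.

Let potential_integrand_ge0 P (p : measurableTypeR R * Z) : (0 <= (phi (p.2, p.1) * profile P p.2)%:E)%E.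
Proof. by rewrite lee_fin mulr_ge0// profile_ge0. Qed.

Lemma measurable_mix_potential P : measurable_fun setT (mix_potential P).
Proof. exact: (measurable_fun_fubini_tonelli_F _ (measurable_potential_integrand P) (potential_integrand_ge0 P)). Qed.

Lemma mix_energyE Q P :
  (\int[Q]_x mix_potential P x = \int[m]_z (profile Q z * profile P z)%:E)%E.
Proof.
have := @fubini_tonelli _ _ _ _ R Q m _ (measurable_potential_integrand P) (potential_integrand_ge0 P); rewrite /mix_potential/= => ->.
apply: eq_integral => z _.
under eq_integral do rewrite EFinM muleC.
rewrite ge0_integralZl_EFin ?profile_ge0//; last by apply/measurable_EFinP; exact: measurable_phi_l.
  by rewrite -profileE -EFinM mulrC.
by move=> y _; rewrite lee_fin.
Qed.

Lemma mix_energyC Q P : (\int[Q]_x mix_potential P x = \int[P]_x mix_potential Q x)%E.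
Proof. by rewrite !mix_energyE; apply: eq_integral => z _; rewrite mulrC. Qed.

Let msq Q P : measurable_fun setT (fun z => (profile Q z * profile P z)%:E).
Proof. by apply/measurable_EFinP; apply: measurable_funM; exact: measurable_profile. Qed.

Let sq0 Q P z : (0 <= (profile Q z * profile P z)%:E)%E.
Proof. by rewrite lee_fin mulr_ge0// profile_ge0. Qed.

Let energyD Q P : (\int[Q]_x mix_potential Q x + \int[P]_x mix_potential P x =
  \int[m]_z (profile Q z ^+ 2 + profile P z ^+ 2)%:E)%E.
Proof.
by rewrite !mix_energyE -ge0_integralD.
Qed.

Let energy2 Q P : (\int[Q]_x mix_potential P x + \int[Q]_x mix_potential P x =
  \int[m]_z (2 * profile Q z * profile P z)%:E)%E.
Proof.
rewrite !mix_energyE -ge0_integralD//; apply: eq_integral => z _.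
by rewrite -EFinD; congr (_%:E); ring.
Qed.

(** The pointwise inequality [2 a b <= a ^+ 2 + b ^+ 2] for the two profiles,
    stated without subtraction since energies may be infinite. *)
Lemma mix_energy_ge Q P : (\int[Q]_x mix_potential P x + \int[Q]_x mix_potential P x <=
  \int[Q]_x mix_potential Q x + \int[P]_x mix_potential P x)%E.
Proof.
rewrite [leRHS]energyD [leLHS]energy2; apply: ge0_le_integral => //.
- by move=> z _; rewrite lee_fin !mulr_ge0// profile_ge0.
- apply/measurable_EFinP; apply: measurable_funM; last exact: measurable_profile.
  by apply: measurable_funM => //; exact: measurable_profile.
- by apply/measurable_EFinP; apply: measurable_funD; apply: measurable_funX; exact: measurable_profile.
- move=> z _; rewrite lee_fin -subr_ge0.
  by rewrite (_ : _ - _ = (profile Q z - profile P z) ^+ 2) ?sqr_ge0//; ring.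
Qed.

(** A finite mutual energy makes all the energies finite, and then the integral
    of the squared difference of the profiles vanishes. *)
Lemma mix_energy_eq Q P :
  (\int[Q]_x mix_potential Q x + \int[P]_x mix_potential P x <=
    \int[Q]_x mix_potential P x + \int[Q]_x mix_potential P x)%E ->
  (\int[Q]_x mix_potential P x < +oo)%E ->
  ae_eq m setT (profile Q) (profile P).
Proof.
move=> le fin; rewrite [leRHS]energy2 [leLHS]energyD in le.
have fin2 : (\int[m]_z (2 * profile Q z * profile P z)%:E < +oo)%E.
  by rewrite -energy2 lte_add_pinfty.
have m1 : measurable_fun setT (fun z => (profile Q z ^+ 2 + profile P z ^+ 2)%:E).
  by apply/measurable_EFinP; apply: measurable_funD; apply: measurable_funX; exact: measurable_profile.
have m2 : measurable_fun setT (fun z => (2 * profile Q z * profile P z)%:E).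
  apply/measurable_EFinP; apply: measurable_funM; last exact: measurable_profile.
  by apply: measurable_funM => //; exact: measurable_profile.
have i1 : m.-integrable setT (fun z => (profile Q z ^+ 2 + profile P z ^+ 2)%:E).
  apply/integrableP; split => //.
  under eq_integral => z _ do rewrite gee0_abs ?lee_fin ?addr_ge0 ?sqr_ge0//.
  exact: le_lt_trans le fin2.
have i2 : m.-integrable setT (fun z => (2 * profile Q z * profile P z)%:E).
  apply/integrableP; split => //.
  by under eq_integral => z _ do rewrite gee0_abs ?lee_fin ?mulr_ge0 ?profile_ge0//.
have : (\int[m]_z `| ((profile Q z - profile P z) ^+ 2)%:E | = 0)%E.
  under eq_integral => z _ do rewrite gee0_abs ?lee_fin ?sqr_ge0//.
  transitivity (\int[m]_z ((profile Q z ^+ 2 + profile P z ^+ 2)%:E - (2 * profile Q z * profile P z)%:E))%E.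
    by apply: eq_integral => z _; rewrite -EFinB; congr (_%:E); ring.
  rewrite integralB//; apply/eqP; rewrite eq_le; apply/andP; split.
    by rewrite sube_le0.
  have := mix_energy_ge Q P; rewrite [leRHS]energyD [leLHS]energy2.
  by rewrite sube_ge0// integrable_fin_num.
have mh : measurable_fun setT (fun z => ((profile Q z - profile P z) ^+ 2)%:E).
  apply/measurable_EFinP; apply: measurable_funX.
  by apply: measurable_funB; exact: measurable_profile.
move/(proj1 (ae_eq_integral_abs m measurableT mh)).
apply: filterS => z /= /(_ I) [] /eqP.
by rewrite sqrf_eq0 subr_eq0 => /eqP.
Qed.

End MixtureKernel.

(** * The logarithmic kernel as a mixture of overlapping windows *)

Section LogKernel.
Context {R : realType}.
Local Notation mu := (@lebesgue_measure R).
Local Notation I := (`[(-1)%R, 1%R]%classic : set R).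
Implicit Types (a t x y : R).

(** The squared height is the second derivative of the mixture in the distance
    [t] of the two points. Its value [a ^- 2] for lengths up to [2] gives
    [- ln t] up to an affine function; its value [1 / 4] for lengths between [2]
    and [4] cancels the linear term. *)
Definition window_height a : R :=
  if 0 < a <= 4 then Num.max a^-1 2^-1 else 0.

(** The argument is [((a, u), x)]. For fixed [a] and two values of [x] the product
    integrates over [u] to the length of the overlap of two windows of length
    [a]. *)
Definition window (p : (measurableTypeR R * measurableTypeR R) * measurableTypeR R) : R :=
  window_height p.1.1 * (p.2 <= p.1.2 <= p.2 + p.1.1)%R%:R.

Lemma window_height_ge0 a : 0 <= window_height a.
Proof. by rewrite /window_height; case: ifP => // _; rewrite le_max [0 <= 2^-1]invr_ge0 ler0n orbT. Qed.

Lemma window_height_small a : 0 < a <= 2 -> window_height a = a^-1.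
Proof.
move=> /andP[a0 a2]; rewrite /window_height a0 (le_trans a2) ?ler_nat//=.
by apply/max_idPl; rewrite lef_pV2// posrE.
Qed.

Lemma window_height_large a : 2 <= a <= 4 -> window_height a = 2^-1.
Proof.
move=> /andP[a2 a4]; have a0 : 0 < a by exact: lt_le_trans a2.
rewrite /window_height a0 a4/=.
by apply/max_idPr; rewrite lef_pV2// posrE.
Qed.

Lemma measurable_window_height : measurable_fun setT window_height.
Proof.
rewrite (_ : window_height = fun a => \1_(`]0%R, 4%R]%classic : set R) a * Num.max a^-1 2^-1).
  apply: measurable_funM; first exact: measurable_indic.
  by apply: (measurable_maxr (g := cst 2^-1)); [exact: measurable_invr|exact: measurable_cst].
apply/funext => a; rewrite /window_height indicE mem_setE in_itv/=.
by case: ifP; rewrite ?mul1r ?mul0r.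
Qed.

Lemma measurable_window : measurable_fun setT window.
Proof.
pose J := (`[0%R, +oo[%classic : set R).
rewrite (_ : window = fun p => window_height p.1.1 *
   (\1_J (p.1.2 - p.2 : measurableTypeR R) * \1_J (p.2 + p.1.1 - p.1.2 : measurableTypeR R))).
  have m11 : measurable_fun setT (fun p : (measurableTypeR R * measurableTypeR R) * measurableTypeR R => p.1.1).
    exact: measurableT_comp measurable_fst measurable_fst.
  have m12 : measurable_fun setT (fun p : (measurableTypeR R * measurableTypeR R) * measurableTypeR R => p.1.2).
    exact: measurableT_comp measurable_snd measurable_fst.
  have m2 : measurable_fun setT (fun p : (measurableTypeR R * measurableTypeR R) * measurableTypeR R => p.2).
    exact: measurable_snd.
  have mJ : measurable_fun setT (\1_J : measurableTypeR R -> R) by apply: measurable_indic; exact: measurable_itv.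
  apply: measurable_funM; first exact: measurableT_comp measurable_window_height m11.
  apply: measurable_funM; apply: (measurableT_comp mJ).
    exact: measurable_funB.
  by apply: measurable_funB => //; exact: measurable_funD.
apply/funext => p; rewrite /window !indicE !mem_setE !in_itv/= !andbT !subr_ge0.
by case: (_ <= _) => //; rewrite ?mul1r ?mul0r.
Qed.

Lemma window_ge0 p : 0 <= window p.
Proof. by rewrite mulr_ge0 ?window_height_ge0. Qed.

Lemma window_bounded z : exists M, forall x, window (z, x) <= M.
Proof.
by exists (window_height z.1) => x; rewrite /window ler_piMr ?window_height_ge0//; case: (_ <= _ <= _).
Qed.

Lemma integral_overlap a x y :
  (\int[mu]_u ((x <= u <= x + a)%R%:R * (y <= u <= y + a)%R%:R)%:E =
    (Num.max 0 (a - `|x - y|))%:E)%E.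
Proof.
wlog xy : x y / x <= y.
  move=> h; have [/h//|/ltW/h] := leP x y.
  by rewrite distrC => <-; apply: eq_integral => u _; rewrite mulrC.
transitivity (\int[mu]_u (\1_(`[y, (x + a)%R]%classic : set R) u)%:E)%E.
  apply: eq_integral => u _; congr (_%:E).
  rewrite indicE mem_setE in_itv/= -natrM mulnb; congr (_%:R); congr nat_of_bool.
  by apply/idP/idP; lra.
rewrite integral_indic// setIT; apply: etrans (lebesgue_measure_itv _) _; rewrite /= lte_fin.
rewrite ler0_norm ?subr_le0//; case: ltP => h.
  by rewrite -EFinB; congr (_%:E); symmetry; rewrite max_r; lra.
by congr (_%:E); symmetry; rewrite max_l//; lra.
Qed.

(** A name of its own, to which a sigma-finite structure is attached. *)
Definition plane_lebesgue : set (measurableTypeR R * measurableTypeR R)%type -> \bar R := (mu \x mu)%E.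

HB.instance Definition _ := Measure.on plane_lebesgue.

Lemma plane_lebesgue_sigma_finite : sigma_finite setT plane_lebesgue.
Proof.
have /sigma_finiteP[F [TF ndF Foo]] := sigma_finiteT mu.
exists (fun n => F n `*` F n).
  rewrite -setXTT TF predeqE => -[x y]; split.
    move=> [/= [n _ Fnx] [k _ Gky]]; exists (maxn n k) => //; split.
    - by move: x Fnx; exact/subsetPset/ndF/leq_maxl.
    - by move: y Gky; exact/subsetPset/ndF/leq_maxr.
  by move=> [n _ []/= ? ?]; split; exists n.
move=> k; have [? ?] := Foo k; split; first exact: measurableX.
by rewrite /plane_lebesgue product_measure1E// lte_mul_pinfty// ge0_fin_numE.
Qed.

HB.instance Definition _ := Measure_isSigmaFinite.Build _ _ _ plane_lebesgue plane_lebesgue_sigma_finite.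


Definition radial t a : R := window_height a ^+ 2 * Num.max 0 (a - t).

Lemma mix_ker_window x y : mix_ker plane_lebesgue window x y = (\int[mu]_a (radial `|x - y| a)%:E)%E.
Proof.
have mw v : measurable_fun setT (fun p => window (p, v)).
  exact: measurableT_comp measurable_window (pair2_measurable v).
rewrite /mix_ker.
have := @fubini_tonelli1 _ _ _ _ R mu mu (fun p => (window (p, x) * window (p, y))%:E).
rewrite /fubini_F/= => ->; last 2 first.
- by apply/measurable_EFinP; exact: measurable_funM.
- by move=> p; rewrite lee_fin mulr_ge0// window_ge0.
apply: eq_integral => a _.
rewrite /radial EFinM -integral_overlap -ge0_integralZl_EFin ?sqr_ge0//; last first.
- apply/measurable_EFinP; rewrite (_ : (fun u => _) =
    fun u => \1_(`[x, (x + a)%R]%classic : set R) u * \1_(`[y, (y + a)%R]%classic : set R) u).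
    by apply: measurable_funM; exact: measurable_indic.
  by apply/funext => u; rewrite !indicE !mem_setE !in_itv.
apply: eq_integral => u _; rewrite -EFinM /window/=; congr (_%:E); ring.
Qed.

Lemma radial_ge0 t a : 0 <= radial t a.
Proof. by rewrite mulr_ge0 ?sqr_ge0// le_max lexx. Qed.

Lemma measurable_radial t : measurable_fun setT (radial t).
Proof.
apply: measurable_funM; first exact: measurable_funX measurable_window_height.
apply: (measurable_maxr (f := cst 0)); first exact: measurable_cst.
by apply: measurable_funB; [exact: measurable_id|exact: measurable_cst].
Qed.

Lemma integral_radial_small t : 0 < t <= 2 ->
  (\int[mu]_(a in `[t, 2%R]) (radial t a)%:E = (ln 2 + t / 2 - ln t - 1)%:E)%E.
Proof.
move=> /andP[t0]; rewrite le_eqVlt => /orP[/eqP->|t2].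
  by rewrite set_itv1 integral_set1; congr (_%:E); field.
transitivity (\int[mu]_(a in `[t, 2%R]) (a^-1 - t / a ^+ 2)%:E)%E.
  apply: eq_integral => a; rewrite inE/= in_itv/= => /andP[ta a2].
  have a0 : 0 < a by exact: lt_le_trans ta.
  rewrite /radial window_height_small ?a0// max_r ?subr_ge0//; congr (_%:E).
  by field; rewrite gt_eqF.
have dF a : t <= a <= 2 -> is_derive a 1 (fun a => ln a + t / a) (a^-1 - t / a ^+ 2).
  move=> /andP[ta _]; have a0 : 0 < a by exact: lt_le_trans ta.
  have d1 := is_derive1_ln a0.
  have d2 : is_derive a 1 (fun a => t / a) (- (t / a ^+ 2)).
    have dV := @is_deriveV R id a 1 1 (lt0r_neq0 a0) (is_derive_id _ _).
    have := is_deriveZ t dV.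
    by move=> h; apply: (is_derive_eq h); rewrite /GRing.scale/= mulr1; ring.
  exact: is_deriveD d1 d2.
have cF a : t <= a <= 2 -> {for a, continuous (fun a => ln a + t / a)}.
  by move=> /dF h; apply: differentiable_continuous; apply/derivable1_diffP; exact: ex_derive.
rewrite (@continuous_FTC2 _ _ (fun a => ln a + t / a))//.
- by rewrite -EFinB; congr (_%:E); field; rewrite gt_eqF.
- apply: continuous_in_subspaceT => a /set_mem; rewrite /= in_itv/= => /andP[ta _].
  have a0 : 0 < a by exact: lt_le_trans ta.
  have a1 : a != 0 by rewrite gt_eqF.
  apply: cvgB; first exact: cvgV.
  apply: cvgM; first exact: cvg_cst.
  by apply: cvgV; [rewrite sqrf_eq0|rewrite expr2; apply: cvgM; exact: cvg_id].
- split.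
  + by move=> a; rewrite in_itv/= => /andP[a1 a2]; have /dF h : t <= a <= 2 by rewrite !ltW.
  + by apply: cvg_at_right_filter; apply: cF; rewrite lexx ltW.
  + by apply: cvg_at_left_filter; apply: cF; rewrite lexx ltW.
- move=> a; rewrite in_itv/= => /andP[a1 a2]; have /dF h : t <= a <= 2 by rewrite !ltW.
  by rewrite derive1E; exact: derive_val.
Qed.

Lemma integral_radial_large t : 0 < t <= 2 ->
  (\int[mu]_(a in `[2%R, 4%R]) (radial t a)%:E = (3 / 2 - t / 2)%:E)%E.
Proof.
move=> /andP[t0 t2].
have h24 : (2 : R) < 4 by rewrite ltr_nat.
transitivity (\int[mu]_(a in `[2%R, 4%R]) ((a - t) / 4)%:E)%E.
  apply: eq_integral => a; rewrite inE/= in_itv/= => /andP[a2 a4].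
  rewrite /radial window_height_large ?a2// max_r; last by rewrite subr_ge0 (le_trans t2).
  by congr (_%:E); field.
have dF a : is_derive a 1 (fun a => (a - t) ^+ 2 / 8) ((a - t) / 4).
  have d0 : is_derive a 1 (fun a => a - t) (1 - 0).
    exact: is_deriveB (is_derive_id a 1) (is_derive_cst t a 1).
  have d1 := is_deriveX 2 d0.
  have := is_deriveZ 8^-1 d1.
  rewrite (_ : _ \*: _ = fun a => (a - t) ^+ 2 / 8); last first.
    by apply/funext => u; rewrite /= /GRing.scale/= mulrC.
  by move=> h; apply: (is_derive_eq h); rewrite /GRing.scale/= expr1 subr0 mulr1; field.
have cF a : {for a, continuous (fun a => (a - t) ^+ 2 / 8)}.
  by apply: differentiable_continuous; apply/derivable1_diffP; exact: ex_derive.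
rewrite (@continuous_FTC2 _ _ (fun a => (a - t) ^+ 2 / 8))//.
- by rewrite -EFinB; congr (_%:E); field.
- apply: continuous_in_subspaceT => a _.
  apply: cvgM; last exact: cvg_cst.
  by apply: cvgB; [exact: cvg_id|exact: cvg_cst].
- split.
  + by move=> a _; have h := dF a; exact: ex_derive.
  + by apply: cvg_at_right_filter; apply: cF.
  + by apply: cvg_at_left_filter; apply: cF.
- by move=> a _; have h := dF a; rewrite derive1E; exact: derive_val.
Qed.

Lemma integral_radial t : 0 < t <= 2 ->
  (\int[mu]_a (radial t a)%:E = (ln 2 + 2^-1 - ln t)%:E)%E.
Proof.
move=> tI; have /andP[t0 t2] := tI.
have mr (D : set (measurableTypeR R)) : measurable_fun D (fun a : measurableTypeR R => (radial t a)%:E).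
  by apply: measurable_funTS; apply/measurable_EFinP; exact: measurable_radial.
transitivity (\int[mu]_(a in `[t, 2%R] `|` `]2%R, 4%R]) (radial t a)%:E)%E.
  rewrite [RHS]integral_mkcond; apply: eq_integral => a _; rewrite patchE.
  case: ifPn => //; rewrite notin_setE/= !in_itv/= => h.
  rewrite /radial /window_height; case: ifPn => [/andP[a0 a4]|_]; last by rewrite expr0n/= mul0r.
  suff -> : Num.max 0 (a - t) = 0 by rewrite mulr0.
  apply: max_l; rewrite leNgt; apply/negP => ta; apply: h.
  by case: (leP a 2) => a2; [left|right]; rewrite ?a4//; lra.
rewrite ge0_integral_setU//=; last 2 first.
- by move=> a _; rewrite lee_fin radial_ge0.
- apply/disj_setPS => a /= []; rewrite !in_itv/= => /andP[_ a2] /andP[a2' _].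
  by move: (le_lt_trans a2 a2'); rewrite ltxx.
rewrite [X in (_ + X)%E](_ : _ = \int[mu]_(a in `[2%R, 4%R]) (radial t a)%:E)%E; last first.
  exact: integral_itv_obnd_cbnd (mr _).
rewrite [X in (X + _)%E]integral_radial_small// [X in (_ + X)%E]integral_radial_large//.
by rewrite -EFinD; congr (_%:E); field.
Qed.

(** Monotonicity in [t] bounds the integral from below by the values at small
    positive [t], which tend to infinity. *)
Lemma integral_radial0 : (\int[mu]_a (radial 0 a)%:E = +oo)%E.
Proof.
apply/eqyP => A A0.
pose e : R := Num.min 2 (expR (- A)).
have e0 : 0 < e by rewrite lt_min ltr0n expR_gt0.
have e2 : e <= 2 by rewrite ge_min lexx.
have : (\int[mu]_a (radial e a)%:E <= \int[mu]_a (radial 0 a)%:E)%E.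
  apply: ge0_le_integral => //.
  - by move=> a _; rewrite lee_fin radial_ge0.
  - by apply/measurable_EFinP; exact: measurable_radial.
  - by apply/measurable_EFinP; exact: measurable_radial.
  - move=> a _; rewrite lee_fin ler_wpM2l ?sqr_ge0// ge_max le_max lexx/=.
    by rewrite le_max; apply/orP; right; lra.
rewrite integral_radial ?e0//; apply: le_trans; rewrite lee_fin.
have lnA : ln e <= - A by rewrite -[leRHS]expRK ler_ln ?posrE ?expR_gt0// ge_min lexx orbT.
have : 0 <= ln (2 : R) by rewrite ln_ge0// ler1n.
by move: (ln _) (ln _) lnA => u v; lra.
Qed.

(** The logarithmic kernel on the segment, up to an additive constant, is a
    mixture of overlaps of windows; both are infinite on the diagonal. *)
Lemma mix_ker_windowE x y : -1 <= x <= 1 -> -1 <= y <= 1 ->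
  (mix_ker plane_lebesgue window x y = (ln 2 + 2^-1)%:E + lne ((normc (y%:C - x%:C))%:E^-1))%E.
Proof.
move=> xI yI; rewrite mix_ker_window -rmorphB normcR distrC.
have [->|xy] := eqVneq y x.
  by rewrite subrr normr0 integral_radial0 inve0 /= addey.
rewrite integral_radial; last first.
  by rewrite normr_gt0 subr_eq0 xy/= ler_norml; apply/andP; split; lra.
rewrite inver gt_eqF ?normr_gt0 ?subr_eq0// lne_EFin ?invr_gt0 ?normr_gt0 ?subr_eq0//.
by rewrite -EFinD lnV// posrE normr_gt0 subr_eq0.
Qed.

End LogKernel.

(** * Supports and distribution functions *)

Section Support.
Context {R : realType}.
Implicit Types P Q : probability (measurableTypeR R) R.

(** Every point outside the support lies in a null interval with rational
    endpoints, and there are countably many of these. *)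
Lemma msupport_full P : P.-negligible (~` msupport P).
Proof.
pose G (ab : rat * rat) : set R := `](ratr ab.1 : R), (ratr ab.2 : R)[%classic.
pose F n : set R := if (unpickle n : option (rat * rat)) is Some ab then
  (if P (G ab) == 0%E then G ab else set0) else set0.
apply: (@negligibleS _ _ _ P (\bigcup_n F n)).
  move=> x /= /existsNP[e /not_implyP[e0 /negP]]; rewrite -leNgt => Pe.
  have [a] := @rat_in_itvoo R (x - e) x ltac:(lra).
  have [b] := @rat_in_itvoo R x (x + e) ltac:(lra).
  rewrite !in_itv/= => /andP[b1 b2] /andP[a1 a2].
  exists (pickle (a, b)); first exact: Logic.I.
  rewrite /F pickleK.
  suff -> : P (G (a, b)) == 0%E by rewrite /G/= in_itv/= a2 b1.
  rewrite -measure_le0; apply: le_trans Pe.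
  apply: le_measure; rewrite ?inE; [exact: measurable_itv|exact: measurable_ball|].
  by move=> y; rewrite /G/= in_itv/= ball_itv/= in_itv/= => /andP[y1 y2]; apply/andP; split; lra.
apply: negligible_bigcup => n; rewrite /F.
case: (unpickle n) => [ab|]; last exact: negligible_set0.
case: ifPn => [/eqP h|_]; last exact: negligible_set0.
by exists (G ab); split => //; exact: measurable_itv.
Qed.

Lemma msupport_meets P (D : set R) : measurable D -> P D = 1%E ->
  exists2 x, D x & msupport P x.
Proof.
move=> mD PD; apply: contrapT => h.
have : P.-negligible [set: R].
  apply: (@negligibleS _ _ _ P (~` msupport P `|` ~` D)).
    move=> x _; have [Dx|nDx] := pselect (D x); last by right.
    by left => Sx; apply: h; exists x.
  apply: negligibleU; first exact: msupport_full.
  exists (~` D); split => //; first exact: measurableC.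
  by have := probability_setC P mD; rewrite PD subee// => ->.
move=> /(measure_negligible measurableT) P0; have := probability_setT P.
by rewrite P0 => /esym/eqP; rewrite onee_eq0.
Qed.

(** A distribution function is continuous from the right, so agreement at
    points accumulating to the right of [r] is enough. *)
Lemma cdf_le_right P Q (r : R) :
  (forall e, 0 < e -> exists2 u, r < u < r + e &
    P `]-oo, u]%classic = Q `]-oo, u]%classic) ->
  (P `]-oo, r]%classic <= Q `]-oo, r]%classic)%E.
Proof.
move=> h; pose F n : set R := `]-oo, (r + n.+1%:R^-1)%R]%classic.
have FE : \bigcap_n F n = `]-oo, r]%classic :> set R.
  apply/seteqP; split => [x Fx|x /=]; last first.
    by rewrite in_itv/= => xr n _; rewrite /F/= in_itv/= (le_trans xr)// lerDl invr_ge0.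
  rewrite /= in_itv/= leNgt; apply/negP => rx.
  have xr0 : 0 < x - r by lra.
  have [n _ /(_ _ (leqnn _)) /= hn] := near_infty_natSinv_lt (PosNum xr0).
  by have := Fx n Logic.I; rewrite /F/= in_itv/= => h1; move: hn h1; move: (_^-1) => v; lra.
have QF : (Q \o F) @ \oo --> Q (\bigcap_n F n).
  apply: nonincreasing_cvg_mu => //.
  - apply: (@le_lt_trans _ _ 1%E); last exact: ltry.
    by apply: probability_le1; exact: measurable_itv.
  - by move=> n; exact: measurable_itv.
  - by rewrite FE; exact: measurable_itv.
  - move=> m n mn; apply/subsetPset => x; rewrite /F/= !in_itv/= => /le_trans; apply.
    by rewrite lerD2l lef_pV2 ?posrE// ler_nat ltnS.
rewrite -FE -(cvg_lim _ QF)//; apply: lime_ge; first by apply/cvg_ex; eexists; exact: QF.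
near=> n; have n0 : 0 < n.+1%:R^-1 :> R by rewrite invr_gt0.
have [u /andP[ru un] PQ] := h _ n0.
apply: (@le_trans _ _ (P `]-oo, u]%classic)).
  apply: le_measure; rewrite ?inE; [rewrite FE; exact: measurable_itv|exact: measurable_itv|].
  by rewrite FE => x /=; rewrite !in_itv/= => /le_trans; apply; exact: ltW.
rewrite [leLHS]PQ; apply: le_measure; rewrite ?inE; [exact: measurable_itv|exact: measurable_itv|].
by move=> x; rewrite /F/= !in_itv/= => /le_trans; apply; exact: ltW.
Unshelve. all: by end_near. Qed.

End Support.

(** * Uniqueness of the equilibrium measure *)

Section Uniqueness.
Context {R : realType}.
Local Notation mu := (@lebesgue_measure R).
Local Notation I := (`[(-1)%R, 1%R]%classic : set R).
Implicit Types P Q : probability (measurableTypeR R) R.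
Local Notation U := (mix_potential (@plane_lebesgue R) (@window R)).
Local Notation c := (ln 2 + 2^-1 : R).

Let mI : measurable (I : set (measurableTypeR R)). Proof. exact: measurable_itv. Qed.

(** The kernel is bounded below on the segment, so the constant splits off even
    where the potential is infinite. *)
Lemma energy_potentialE P x : P I = 1%E -> -1 <= x <= 1 ->
  U P x = (potential P x%:C + c%:E)%E.
Proof.
move=> P1 xI.
rewrite mix_potentialE; [|exact: measurable_window|exact: window_ge0|exact: window_bounded].
have mk := @measurable_mix_ker _ _ _ plane_lebesgue _ measurable_window window_ge0 x.
rewrite (integral_full_set mI P1 mk) /potential.
rewrite (integral_full_set mI P1 (measurable_log_kernel x%:C)).
have c0 : 0 <= c by rewrite addr_ge0// ln_ge0// ler1n.
have kE y : I y -> mix_ker plane_lebesgue window x y = (lne ((normc (y%:C - x%:C))%:E^-1) + c%:E)%E.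
  by rewrite /= in_itv/= => yI; rewrite mix_ker_windowE// addeC.
rewrite -(@integral_add_cst _ P I _ c mI P1) //.
- by apply: eq_integral => y /set_mem; exact: kE.
- exact: measurable_funTS (measurable_log_kernel x%:C).
- move=> y Iy; have := mix_ker_ge0 plane_lebesgue window_ge0 x y; rewrite kE// EFinN.
  by rewrite -leeBlDr// sub0e.
Qed.

Lemma integral_energy_segment P Q : P I = 1%E ->
  (\int[P]_x U Q x = \int[P]_(x in I) U Q x)%E.
Proof.
move=> P1; apply: (integral_full_set mI P1).
exact: measurable_mix_potential measurable_window window_ge0 window_bounded _.
Qed.

(** Windows longer than the segment see a measure on the segment through its
    distribution function. *)
Lemma profile_windowE P a u : P I = 1%E -> 2 < a <= 4 -> -1 <= u < 1 ->
  profile window P (a, u) = 2^-1 * fine (P `]-oo, u]%classic).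
Proof.
move=> P1 /andP[a2 a4] /andP[u1 u2]; rewrite /profile /Rintegral.
have mw : measurable_fun setT (fun x : measurableTypeR R => (window ((a, u), x))%:E).
  by apply/measurable_EFinP; exact: measurableT_comp measurable_window (pair1_measurable _).
have mi : measurable_fun setT (fun x : measurableTypeR R => ((2^-1 : R)%:E * (\1_(`]-oo, u]%classic : set R) x)%:E)%E).
  apply: measurable_funeM; apply/measurable_EFinP; apply: measurable_indic; exact: measurable_itv.
rewrite (integral_full_set mI P1 mw).
transitivity (fine (\int[P]_(x in I) ((2^-1 : R)%:E * (\1_(`]-oo, u]%classic : set R) x)%:E)%E)).
  congr (fine _); apply: eq_integral => x /set_mem; rewrite /= in_itv/= => /andP[x1 x2].
  have hE : window_height a = 2^-1 by rewrite window_height_large// a4 andbT ltW.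
  rewrite /window/= hE EFinM; congr (_ * _%:E)%E.
  rewrite indicE mem_setE in_itv/=; congr ((nat_of_bool _)%:R).
  by rewrite (_ : u <= x + a) ?andbT//; lra.
rewrite -(integral_full_set mI P1 mi) ge0_integralZl_EFin//; last first.
  by apply/measurable_EFinP; apply: measurable_indic; exact: measurable_itv.
rewrite integral_indic ?setIT//.
have Pf : P `]-oo, u]%classic \is a fin_num by apply: fin_num_measure; exact: measurable_itv.
by rewrite fineM.
Qed.

Section Comparison.
Variables (P Q : probability (measurableTypeR R) R) (g : R -> R) (k M : R).
Hypotheses (P1 : P I = 1%E) (Q1 : Q I = 1%E).
Hypothesis Qg : forall x, -1 <= x <= 1 -> potential Q x%:C = (g x)%:E.
Hypothesis gM : forall x, -1 <= x <= 1 -> `|g x| <= M.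
Hypothesis Pg : forall x, -1 <= x <= 1 -> ((g x + k)%:E <= potential P x%:C)%E.
Hypothesis Pg_supp : forall x, -1 <= x <= 1 -> msupport P x ->
  potential P x%:C = (g x + k)%:E.

Let u x : R := fine (U Q x).

Let measurable_U (N : probability (measurableTypeR R) R) : measurable_fun setT (U N).
Proof. exact: measurable_mix_potential measurable_window window_ge0 window_bounded _. Qed.

Let measurable_u : measurable_fun setT u.
Proof. exact: measurableT_comp (@fine_measurable R setT measurableT) (measurable_U Q). Qed.

Let potentialQE x : -1 <= x <= 1 -> U Q x = (u x)%:E.
Proof. by move=> xI; rewrite /u energy_potentialE// Qg. Qed.

Let uE x : -1 <= x <= 1 -> u x = g x + c.
Proof. by move=> xI; rewrite /u energy_potentialE// Qg. Qed.

Let u_bounded x : -1 <= x <= 1 -> `|u x| <= M + `|c|.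
Proof. by move=> xI; rewrite uE// (le_trans (ler_normD _ _))// lerD2r gM. Qed.

Let integrable_u (N : probability (measurableTypeR R) R) : N.-integrable I (EFin \o u).
Proof. exact: integrable_bounded_segment measurable_u u_bounded. Qed.

Let integral_potentialQ (N : probability (measurableTypeR R) R) : N I = 1%E -> (\int[N]_x U Q x = (\int[N]_(x in I) u x)%:E)%E.
Proof.
move=> N1; rewrite integral_energy_segment// /Rintegral fineK; last first.
  exact: integrable_fin_num (integrable_u N).
by apply: eq_integral => x /set_mem; rewrite /= in_itv/=; exact: potentialQE.
Qed.

Let integral_shifted (N : probability (measurableTypeR R) R) : N I = 1%E -> (\int[N]_(x in I) (u x + k)%:E = (\int[N]_(x in I) u x + k)%:E)%E.
Proof.
move=> N1; under eq_integral do rewrite EFinD.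
have ik : N.-integrable I (EFin \o cst k).
  by apply: (@integrable_bounded_segment R N (cst k) `|k|).
rewrite (integralD_EFin mI (integrable_u N) ik).
rewrite [X in (_ + X)%E](_ : _ = k%:E); last first.
  by transitivity (k%:E * N I)%E; [exact: (@integral_cst _ _ _ N I mI k%:E)|rewrite [X in (_ * X)%E]N1 mule1].
by rewrite EFinD fineK//; exact: integrable_fin_num (integrable_u N).
Qed.

Let energyPP : (\int[P]_x U P x = (\int[P]_(x in I) u x + k)%:E)%E.
Proof.
rewrite integral_energy_segment// -integral_shifted//.
apply: ae_eq_integral => //; first exact: measurable_funTS (measurable_U P).
  by apply/measurable_funTS/measurable_EFinP; exact: measurable_funD.
apply: negligibleS (msupport_full P) => x; apply: contra_not => Sx /=.
rewrite in_itv/= => xI; rewrite energy_potentialE// Pg_supp// uE// -EFinD; congr (_%:E).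
ring.
Qed.

(* The potential of [P] is integrable for [Q] because the mutual energy is
   symmetric and finite. *)
Let energyQP : ((\int[Q]_(x in I) u x + k)%:E <= \int[P]_x U Q x)%E.
Proof.
have eC := mix_energyC plane_lebesgue measurable_window window_ge0 window_bounded P Q.
have iUP : Q.-integrable I (U P).
  apply/integrableP; split; first exact: measurable_funTS (measurable_U P).
  apply: (@le_lt_trans _ _ (\int[Q]_(x in I) U P x)%E).
    rewrite le_eqVlt; apply/orP; left; apply/eqP; apply: eq_integral => x _.
    by rewrite gee0_abs//; exact: mix_potential_ge0 window_ge0 _ _.
  by rewrite -integral_energy_segment// -eC integral_potentialQ// ltry.
rewrite eC integral_energy_segment// -integral_shifted//; apply: le_integral => //.
- apply: (@integrable_bounded_segment R Q (fun x => u x + k) (M + `|c| + `|k|)).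
    exact: measurable_funD.
  by move=> x xI; rewrite (le_trans (ler_normD _ _))// lerD2r u_bounded.
- move=> x /set_mem; rewrite /= in_itv/= => xI.
  rewrite energy_potentialE// uE// addrAC EFinD leeD2r//; exact: Pg.
Qed.

(** Integrating the comparison of potentials against [P] and against [Q], the
    constant [k] cancels: the energies of [P] and [Q] add up to at most twice
    the mutual energy, which is the equality case of [mix_energy_ge]. *)
Lemma profile_comparison : ae_eq plane_lebesgue setT (profile window P) (profile window Q).
Proof.
apply: (mix_energy_eq measurable_window window_ge0 window_bounded).
  rewrite energyPP integral_potentialQ// [X in (_ <= X)%E]addeC; rewrite (integral_potentialQ P1) EFinD.
  have := energyQP; rewrite integral_potentialQ// lee_fin => h.
  by rewrite -!EFinD lee_fin; lra.
by rewrite integral_potentialQ// ltry.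
Qed.

(** Profiles agree outside a null set, which cannot contain a rectangle of lengths
    in []3, 4[] and points in []a, b[]. *)
Lemma cdf_comparison_dense a b : -1 <= a -> a < b -> b <= 1 ->
  exists2 r, a < r < b & P `]-oo, r]%classic = Q `]-oo, r]%classic.
Proof.
move=> a1 ab b1; apply: contrapT => h.
have [N [mN N0 hN]] := profile_comparison.
have : (plane_lebesgue (`]3%R, 4%R[%classic `*` `]a, b[%classic) <= plane_lebesgue N)%E.
  apply: le_measure; rewrite ?inE//; first by apply: measurableX; exact: measurable_itv.
  move=> [w r] [/=]; rewrite !in_itv/= => /andP[w3 w4] /andP[r1 r2].
  apply: hN => /= /(_ Logic.I) e; apply: h; exists r; first by rewrite r1.
  have wI : 2 < w <= 4 by apply/andP; split; lra.
  have rI : -1 <= r < 1 by apply/andP; split; lra.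
  move: e; rewrite !profile_windowE// => /(mulfI _) e.
  rewrite -[LHS]fineK; last by apply: fin_num_measure; exact: measurable_itv.
  rewrite -[RHS]fineK; last by apply: fin_num_measure; exact: measurable_itv.
  by rewrite e// invr_neq0.
have -> : plane_lebesgue (`]3%R, 4%R[%classic `*` `]a, b[%classic) = (mu `]3%R, 4%R[%classic * mu `]a, b[%classic)%E.
  by apply: product_measure1E; exact: measurable_itv.
rewrite N0.
have -> : mu `]3%R, 4%R[%classic = (4 - 3)%:E.
  by apply: etrans (lebesgue_measure_itv _) _; rewrite /= lte_fin ltr_nat.
have -> : mu `]a, b[%classic = (b - a)%:E.
  by apply: etrans (lebesgue_measure_itv _) _; rewrite /= lte_fin ab.
rewrite -EFinM lee_fin; by apply/negP; rewrite -ltNge mulr_gt0; lra.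
Qed.

Let cdf_out (N : probability (measurableTypeR R) R) r : N I = 1%E -> (r < -1 -> N `]-oo, r]%classic = 0%E) /\
  (1 <= r -> N `]-oo, r]%classic = 1%E).
Proof.
move=> N1; split => hr.
  apply/eqP; rewrite -measure_le0; apply: (@le_trans _ _ (N (~` I))); last first.
    by have := probability_setC N mI; rewrite N1 subee// => ->.
  apply: le_measure; rewrite ?inE; [exact: measurable_itv|exact: measurableC|].
  by move=> x /=; rewrite !in_itv/= => xr /andP[x1 _]; move: (le_lt_trans (le_trans x1 xr) hr); rewrite ltxx.
apply/eqP; rewrite eq_le probability_le1/=; last exact: measurable_itv.
rewrite -[leLHS]N1; apply: le_measure; rewrite ?inE; [exact: measurable_itv|exact: measurable_itv|].
by move=> x /=; rewrite !in_itv/= => /andP[_ /le_trans]; apply.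
Qed.

(** The distribution functions agree on a dense subset of the segment, hence
    everywhere by right continuity. *)
Theorem equal_of_comparison A : measurable A -> P A = Q A.
Proof.
apply: probability_eq_cdf => [|r]; first exact: probability_setT.
have [r1|r1] := ltP r (-1); first by apply: etrans ((cdf_out r P1).1 r1) _; apply/esym; exact: (cdf_out r Q1).1.
have [r2|r2] := leP 1 r; first by apply: etrans ((cdf_out r P1).2 r2) _; apply/esym; exact: (cdf_out r Q1).2.
have h e : 0 < e -> exists2 v, r < v < r + e & P `]-oo, v]%classic = Q `]-oo, v]%classic.
  move=> e0; have [|||v /andP[v1 v2] PQ] := @cdf_comparison_dense r (Num.min 1 (r + e)).
  - by [].
  - by rewrite lt_min r2/= ltrDl.
  - by rewrite ge_min lexx.
  - by exists v => //; rewrite v1/= (lt_le_trans v2)// ge_min lexx orbT.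
apply/eqP; rewrite eq_le; apply/andP; split; apply: cdf_le_right => //.
by move=> e /h[v rv PQ]; exists v.
Qed.

End Comparison.
End Uniqueness.

(** * The equilibrium measure *)

Section EquilibriumUnique.
Context (R : realType).
Variables (tau : R) (htau1 : -1 <= tau) (htau2 : tau <= 2 / (pi - 2)).
Variables (s : R[i] -> R[i]) (hs : is_sqrt_branch s).
Local Notation I := (`[(-1)%R, 1%R]%classic : set R).
Local Notation nu := (equilibrium_prob htau1 htau2).

(** Both bounds come from [ln t <= t - 1], at [y] and at [y^-1]. *)
Lemma xlnx_bounded (y : R) : 0 <= y <= 2 -> `|y * ln y| <= 2.
Proof.
move=> /andP[]; rewrite le_eqVlt => /predU1P[<- _|y0 y2]; first by rewrite mul0r normr0.
have h1 : ln y <= y - 1 by rewrite -[leLHS]/(ln y) -[X in ln X](subrK 1) addrC le_ln1Dx//; lra.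
have h2 : - ln y <= y^-1 - 1.
  by rewrite -lnV ?posrE// -[X in ln X](subrK 1) addrC le_ln1Dx//; have := y0; rewrite -invr_gt0; lra.
rewrite ler_norml; apply/andP; split; last first.
  have := ler_wpM2l (ltW y0) h1; nra.
have := ler_wpM2l (ltW y0) h2; rewrite mulrBr divff ?gt_eqF//; lra.
Qed.

Lemma potential_equilibrium_bounded : exists M : R, forall x, -1 <= x <= 1 ->
  `|(1 + tau) * ln 2 -
    tau * (1 - ((1 - x) * ln (1 - x) + (1 + x) * ln (1 + x)) / 2)| <= M.
Proof.
exists (`|(1 + tau) * ln 2| + `|tau| * 3) => x xI.
apply: le_trans (ler_normB _ _) _; rewrite lerD2l normrM ler_wpM2l//.
have := @xlnx_bounded (1 - x) ltac:(lra); have := @xlnx_bounded (1 + x) ltac:(lra).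
by rewrite !ler_norml; move: (_ * ln _) (_ * ln _) => u v; lra.
Qed.

(** The sum of the two equilibrium potentials is real on the segment, so the
    difference of the equilibrium conditions compares the two potentials as in
    [equal_of_comparison]. Once the measures agree, the constants are compared
    at a point of the common support. *)
Theorem equilibrium_unique (P : probability (measurableTypeR R) R) (omega : R) :
  is_equilibrium tau P omega ->
  omega = (1 + tau) * ln 2 /\ forall A, measurable A -> P A = nu A.
Proof.
move=> [P1 Psupp Pge].
have [M hM] := potential_equilibrium_bounded.
have mI : measurable (I : set (measurableTypeR R)) by exact: measurable_itv.
pose v x : R := 1 - ((1 - x) * ln (1 - x) + (1 + x) * ln (1 + x)) / 2.
have Pv x : -1 <= x <= 1 -> (potential P x%:C + tau%:E * potential (lambda R) x%:C =
    potential P x%:C + (tau * v x)%:E)%E.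
  by move=> xI; rewrite potential_uniform_segment// -EFinM.
have PA A : measurable A -> P A = nu A.
  apply: (@equal_of_comparison R P nu _ (omega - (1 + tau) * ln 2) M P1
    (equilibrium_prob_segment _ _) (potential_equilibrium_segment htau1 htau2 hs) hM).
  - move=> x xI; have := Pge x xI; rewrite Pv// -leeBlDr//; apply: le_trans.
    by rewrite -EFinB lee_fin /v; lra.
  - move=> x xI Sx; have := Psupp x Sx; rewrite Pv// => e.
    have -> : potential P x%:C = (potential P x%:C + (tau * v x)%:E - (tau * v x)%:E)%E.
      by rewrite addeK.
    by rewrite e -EFinB /v; congr (_%:E); ring.
split=> //.
have [x Ix Sx] := msupport_meets mI P1.
have xI : -1 <= x <= 1 by rewrite /= in_itv in Ix.
have e1 := Psupp x Sx.
have [_ nusupp _] := equilibrium_prob_is_equilibrium htau1 htau2 hs.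
have Sx' : msupport nu x.
  move=> e e0; have := Sx e e0; congr (_ < _)%E.
  by apply: PA; exact: measurable_ball.
have := nusupp x Sx'.
have -> : potential nu x%:C = potential P x%:C.
  by apply: eq_measure_integral => A mA _; apply/esym; exact: PA.
by rewrite e1 => -[].
Qed.

Lemma potential_equilibrium_offE z : ~ segment z -> potential nu z =
  (- (1 + tau) * ln (normc ((z + s z) / 2)) - tau
   - tau / 2 *
     (complex.Re z * ln (normc ((z - 1) / (z + 1)))
      + complex.Im z * argC ((z + 1) / (z - 1))
      - ln (normc (z ^+ 2 - 1))))%:E.
Proof.
move=> zI; rewrite (potential_equilibrium_off _ _ hs)//; congr (_%:E).
have [n1 n2] := normc_endpoints_gt0 zI.
have w1 := normc_branch_gt1 hs zI.
have w0 : 0 < normc (z + s z) by exact: lt_trans w1.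
have n3 : normc (2 : R[i]) = 2.
  by rewrite -(rmorph_nat (real_complex R)) normcR ger0_norm.
rewrite argC_segment_ratio// /uniform_potential !normc_div n3 !ln_div ?posrE//.
rewrite (_ : z ^+ 2 - 1 = (z - 1) * (z + 1)); last by rewrite -subr_sqr expr1n.
rewrite ComplexField.Normc.normcM lnM ?posrE//.
move: (ln _) (ln _) (ln _) (ln _) (atan _) (atan _) => a1 a2 a3 a4 a5 a6.
by field.
Qed.

End EquilibriumUnique.

Theorem theorem2p1 (R : realType) (tau : R) (s : R[i] -> R[i])
    (htau1 : -1 <= tau) (htau2 : tau <= 2 / (pi - 2))
    (hs : is_sqrt_branch s) :
  (exists (mu : probability (measurableTypeR R) R) (omega : R),
      is_equilibrium tau mu omega) /\
  forall (mu : probability (measurableTypeR R) R) (omega : R),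
    is_equilibrium tau mu omega ->
    [/\ forall A : set (measurableTypeR R), measurable A ->
          mu A = (\int[lebesgue_measure]_(x in A `&` [set x : R | -1 <= x <= 1]%R)
                    (equilibrium_density tau x)%:E)%E,
        forall z : R[i], ~ segment z ->
          cauchy_transform mu z =
            (1 + tau)%:C / s z - (tau / 2)%:C * logC ((z + 1) / (z - 1)),
        forall z : R[i], ~ segment z ->
          potential mu z =
            (- (1 + tau) * ln (normc ((z + s z) / 2)) - tau
             - tau / 2 *
               (complex.Re z * ln (normc ((z - 1) / (z + 1)))
                + complex.Im z * argC ((z + 1) / (z - 1))
                - ln (normc (z ^+ 2 - 1))))%:E,
        forall x : R, -1 <= x <= 1 ->
          potential mu x%:C =
            (tau / 2 * ((1 + x) * ln (1 + x) + (1 - x) * ln (1 - x) - 2)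
             + omega)%:E
      & omega = (1 + tau) * ln 2].
Proof.
split=> [|mu omega mu_eq].
  exists (equilibrium_prob htau1 htau2), ((1 + tau) * ln 2).
  exact: equilibrium_prob_is_equilibrium hs.
have [omegaE muE] := equilibrium_unique htau1 htau2 hs mu_eq.
have intE (f : R -> \bar R) : (\int[mu]_x f x = \int[equilibrium_prob htau1 htau2]_x f x)%E.
  by apply: eq_measure_integral => A mA _; exact: muE.
have potE z : potential mu z = potential (equilibrium_prob htau1 htau2) z by exact: intE.
split=> //.
- by move=> A mA; rewrite muE// equilibrium_probE.
- move=> z zI; rewrite -(cauchy_equilibrium htau1 htau2 hs zI) /cauchy_transform /Rintegral.
  by rewrite !intE.
- by move=> z zI; rewrite potE (potential_equilibrium_offE _ _ hs).
- move=> x xI; rewrite potE (potential_equilibrium_segment _ _ hs)// omegaE.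
  by congr (_%:E); field.
Qed.
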